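(* Let $S$ be a set of primes which has a natural density. Then \[ \lim_{x\to \infty}\frac{1}{\log x}\sum_{\substack{n\leq x\\P^-(n)\in S}} \frac{\mu(n)\log n }{n}=0. \] Moreover, \[ \lim_{x\to \infty}\frac{1}{\log x}\sum_{\substack{n\leq x\\P^+(n)\in S}} \frac{\mu(n)\log n }{n}=0. \]
   Context: Here $\mu$ is the Möbius function. For an integer $n\ge 2$, $P^-(n)$ and $P^+(n)$ denote the smallest and the largest prime factor of $n$, respectively, and $P^-(1)=P^+(1)=1$. Sums $\sum_{n\le x}$ run over positive integers $n\le x$, with $x$ real. A set $S$ of primes is said to have a natural density if the limit $\lim_{x\to\infty} \frac{\#\{p\in S: p\leq x\}}{\#\{p \text{ prime}: p\leq x\}}$ exists. *)

(* Defs.v *)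
From mathcomp Require Import all_boot all_order all_algebra.
From mathcomp Require Import all_classical all_reals all_analysis.
Set Implicit Arguments.
Unset Strict Implicit.
Unset Printing Implicit Defensive.
Import Order.TTheory GRing.Theory Num.Theory numFieldNormedType.Exports.
Local Open Scope classical_set_scope.
Local Open Scope ring_scope.

(* Only the values at n >= 1 matter; the guard sets the junk value at 0 to 0. *)
Definition moebius (n : nat) : int :=
  if (0 < n)%N && all (fun p => logn p n == 1%N) (primes n)
  then (-1) ^+ size (primes n) else 0.

(* For real x, the positive integers n <= x are those with
   1 <= n < (Num.truncn x).+1; Num.truncn x = 0 when x < 1. *)
Definition count_upto (R : realType) (A : set nat) (x : R) : nat :=
  (\sum_(1 <= n < (Num.truncn x).+1 | n \in A) 1)%N.

Definition has_natural_density (R : realType) (S : set nat) : Prop :=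
  exists d : R,
    (count_upto S (x : R))%:R / (count_upto [set p | prime p] x)%:R
      @[x --> +oo%R] --> d.

(* f is the prime factor selector: pdiv is P^- and max_pdiv is P^+, both of
   which take the value 1 at n = 1. *)
Definition moebius_log_sum (R : realType) (f : nat -> nat) (S : set nat)
    (x : R) : R :=
  \sum_(1 <= n < (Num.truncn x).+1 | f n \in S)
     (moebius n)%:~R * ln n%:R / n%:R.

(* Main.v *)
(* Let m(N) be the sum of mu(n)/n over n <= N.  By partial summation both claims
   follow once the sum of mu(n)/n over n <= x with P^-(n) (resp. P^+(n)) in S
   converges.  Writing n = p k with p = P^-(n) (resp. P^+(n)), this sum becomes
   - sum_(p in S) h_p(x/p) / p, where h_p(y) is the sum of mu(k)/k over the
   k <= y all of whose prime factors are > p (resp. < p).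
   - For bounded p, h_p(y) has a limit: for P^- it is 0 by the prime number
     theorem in the form m(N) -> 0, and for P^+ the sum h_p is finite.
   - For P < p <= x^(1/U), elementary estimates give
     h_p(y) << log p / log y + 1 / log p, which contributes O(1/U + 1/log P).
   - For p > x^(1/U), in the case of P^+ the prime number theorem and Buchstab's
     identity give h_p(x/p) -> 0, uniformly as long as x/p is large.  In the case
     of P^-, p |-> h_p(x/p) has bounded variation, so that partial summation
     against #{p <= t : p in S} - d pi(t) = o(pi(t)) compares the sum with d times
     the sum over all primes, which is d (1 - m(x)) in total.
   The prime number theorem comes from Selberg's formula, which yields
   |m(N)| log^2 N <= 2 sum_(k <= N) (log k / k) |m(N/k)| + O(log N).  As m varies
   slowly and its logarithmic integral is bounded, |m| is small on a positive
   proportion of the range, so that any eventual bound on |m| can be improved. *)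
Require Import Defs.
From mathcomp Require Import all_boot all_order all_algebra.
From mathcomp Require Import all_classical all_reals all_analysis.
From mathcomp Require Import ring lra zify.
Import Order.TTheory GRing.Theory Num.Theory numFieldNormedType.Exports.
Local Open Scope classical_set_scope.
Local Open Scope ring_scope.
Set Implicit Arguments.
Unset Strict Implicit.

(** The prime number theorem argument rests on exact leading constants: the weights 2 ln k / k sum
    to ln^2 N to leading order, so the inequality reproduces an eventual bound b on |m| without
    loss, and smaller values on a positive proportion strictly lower it. The two claims differ at
    large primes. If p > sqrt x, every k <= x/p has all its prime factors below p, so for P^+ one
    has h_p(x/p) = m(x/p), small once x/p is large. For P^- only k = 1 survives and h_p(x/p) = 1;
    what remains is the sum of 1/p over the p in S between sqrt x and x, which need not converge for
    an irregular set. This is where the density enters. All sums are taken at natural numbers, with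
    quotients [N %/ k]. For k <= N, replacing ln (N/k) by ln (N %/ k) costs at most 1, and the bound
    1 on every restricted sum of mu(n)/n makes such rounding harmless. *)

(* [lra] does not treat the inverse of a non-constant as an atom. *)
Ltac gen_inv := intros; repeat (match goal with
  | |- context [@GRing.inv ?T ?x] => let v := fresh "v" in set (v := @GRing.inv T x) in *
  | _ : context [@GRing.inv ?T ?x] |- _ => let v := fresh "v" in set (v := @GRing.inv T x) in *
  end);
  repeat (match goal with
  | u := @GRing.inv _ ?a, v := @GRing.inv _ ?b |- _ => unify a b; change v with u in *; clear v
  end);
  repeat (match goal with u := @GRing.inv _ _ |- _ => clearbody u end).
Ltac lrai := gen_inv; lra.

(** * Divisor sums *)

Lemma dvdn_div_gt0 d n : (0 < n)%N -> (d %| n)%N -> (0 < n %/ d)%N.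
Proof. by move=> n0 dn; rewrite divn_gt0 ?(dvdn_gt0 n0 dn) // dvdn_leq. Qed.

Section Divisor_sums.
Variable V : zmodType.
Implicit Types F : nat -> V.

Lemma sum_multiples F (d N : nat) : (0 < d)%N ->
  \sum_(1 <= n < N.+1 | (d %| n)%N) F n =
  \sum_(1 <= k < (N %/ d).+1) F (d * k)%N.
Proof.
move=> d0; elim: N => [|N IH]; first by rewrite div0n !big_geq.
rewrite big_mkcond big_nat_recr //= -big_mkcond /= IH divnS //.
case: ifP => dN; last by rewrite addr0.
rewrite add1n [RHS]big_nat_recr //=; congr (_ + F _).
by rewrite -[in RHS](add1n (N %/ d)) -[1%N]/(nat_of_bool true) -dN -divnS // mulnC divnK.
Qed.

Lemma sum_single (P : pred nat) F (m n i : nat) : (m <= i < n)%N -> P i ->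
  (forall j, (m <= j < n)%N -> P j -> j != i -> F j = 0) ->
  \sum_(m <= j < n | P j) F j = F i.
Proof.
move=> imn Pi F0; transitivity (\sum_(m <= j < n | P j && (j == i)) F j); last first.
  by rewrite big_nat1_cond_eq imn Pi.
rewrite [RHS]big_mkcondr [LHS]big_nat_cond [RHS]big_nat_cond.
by apply: eq_bigr => j /andP[jmn Pj]; case: eqP => // /eqP /F0 ->.
Qed.

Lemma divisor_sum_widen F (n N : nat) : (0 < n <= N)%N ->
  \sum_(1 <= d < n.+1 | (d %| n)%N) F d = \sum_(1 <= d < N.+1 | (d %| n)%N) F d.
Proof.
move=> /andP[n0 nN]; rewrite [RHS](big_cat_nat _ (n := n.+1)) //=.
rewrite [X in _ + X]big_nat_cond [X in _ + X]big_pred0 ?addr0 // => d.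
by apply/negP => /andP[/andP[nd _] dn]; move: (dvdn_leq n0 dn); lia.
Qed.

Lemma dirichlet_sum (F : nat -> nat -> V) N :
  \sum_(1 <= n < N.+1) \sum_(1 <= d < n.+1 | (d %| n)%N) F d (n %/ d)%N =
  \sum_(1 <= d < N.+1) \sum_(1 <= k < (N %/ d).+1) F d k.
Proof.
rewrite (eq_big_nat _ _ (F2 := fun n =>
    \sum_(1 <= d < N.+1 | (d %| n)%N) F d (n %/ d)%N)); last first.
  by move=> n /andP[n0 nN]; apply: divisor_sum_widen; rewrite n0.
rewrite (exchange_big_dep_nat xpredT) //=; apply: eq_big_nat => d /andP[d0 _].
rewrite (sum_multiples (fun n => F d (n %/ d)%N)) //.
by apply: eq_bigr => k _; rewrite mulKn.
Qed.

(** Both sides run over the pairs with [d * k] dividing [n]; [half] brings a side to this symmetric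
    form. *)
Lemma divisor_sum_swap (F : nat -> nat -> V) n : (0 < n)%N ->
  \sum_(1 <= d < n.+1 | (d %| n)%N)
     \sum_(1 <= k < (n %/ d).+1 | (k %| n %/ d)%N) F d k =
  \sum_(1 <= k < n.+1 | (k %| n)%N)
     \sum_(1 <= d < (n %/ k).+1 | (d %| n %/ k)%N) F d k.
Proof.
move=> n0.
have half (G : nat -> nat -> V) :
    \sum_(1 <= d < n.+1 | (d %| n)%N)
       \sum_(1 <= k < (n %/ d).+1 | (k %| n %/ d)%N) G d k =
    \sum_(1 <= d < n.+1) \sum_(1 <= k < n.+1 | (k * d %| n)%N) G d k.
  rewrite big_mkcond; apply: eq_big_nat => d /andP[d0 dn]; case: ifPn => dvd.
    rewrite (@divisor_sum_widen (G d) (n %/ d) n); last first.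
      by rewrite divn_gt0 // (dvdn_leq n0 dvd) leq_div.
    by apply: eq_bigl => k; rewrite dvdn_divRL.
  rewrite big_pred0 // => k; apply: contraNF dvd; exact: dvdn_trans (dvdn_mull _ _).
rewrite half (half (fun k d => F d k)) (exchange_big_dep_nat xpredT) //=.
by apply: eq_bigr => k _; apply: eq_bigl => d; rewrite mulnC.
Qed.

(** The involution d -> n/d comes from [divisor_sum_swap]: F at n/d is written as a sum over the
    divisors k of n/d that is supported on k = n/d. *)
Lemma divisor_sum_rev F n : (0 < n)%N ->
  \sum_(1 <= d < n.+1 | (d %| n)%N) F (n %/ d)%N =
  \sum_(1 <= d < n.+1 | (d %| n)%N) F d.
Proof.
move=> n0.
have single (d : nat) (x : V) : (0 < d)%N ->
    \sum_(1 <= k < d.+1 | (k %| d)%N) (if k == d then x else 0) = x.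
  by move=> d0; rewrite -big_mkcondr big_nat1_cond_eq d0 ltnSn dvdnn.
transitivity (\sum_(1 <= d < n.+1 | (d %| n)%N)
    \sum_(1 <= k < (n %/ d).+1 | (k %| n %/ d)%N) if k == (n %/ d)%N then F k else 0).
  rewrite big_nat_cond [RHS]big_nat_cond; apply: eq_bigr => d /andP[/andP[d0 _] dn].
  rewrite -(single (n %/ d)%N (F (n %/ d)%N)); last exact: dvdn_div_gt0.
  by apply: eq_bigr => k _; case: eqP => // ->.
rewrite (divisor_sum_swap (fun d k => if k == (n %/ d)%N then F k else 0)) //.
rewrite big_nat_cond [RHS]big_nat_cond; apply: eq_bigr => k /andP[/andP[k0 _] kn].
rewrite -[in RHS](single (n %/ k)%N (F k)); last exact: dvdn_div_gt0.
rewrite big_nat_cond [RHS]big_nat_cond.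
apply: eq_bigr => d /andP[/andP[d0 _] dk].
have dn : (d %| n)%N by apply: dvdn_trans dk (dvdn_div kn).
congr (if _ then _ else _); rewrite -(eqn_pmul2r d0) divnK //.
by rewrite -[RHS](eqn_pmul2r k0) divnK // mulnC eq_sym.
Qed.

End Divisor_sums.

(** * The Moebius and von Mangoldt functions *)

Section Moebius.
Variable R : realType.

Definition mu (n : nat) : R := (moebius n)%:~R.

Lemma mu1 : mu 1 = 1.
Proof. by []. Qed.

Lemma mu_square p n : prime p -> (p ^ 2 %| n)%N -> mu n = 0.
Proof.
move=> pp pn; rewrite /mu /moebius; case: ifP => // /andP[n0 /allP h].
have pn' : p \in primes n by rewrite mem_primes pp n0 (dvdn_trans _ pn) ?dvdn_exp.
by move: pn; rewrite pfactor_dvdn // (eqP (h _ pn')).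
Qed.

Lemma mu_prime_mul p n : prime p -> (0 < n)%N -> ~~ (p %| n)%N ->
  mu (p * n)%N = - mu n.
Proof.
move=> pp n0 pn; have p0 := prime_gt0 pp.
have E : perm_eq (primes (p * n)) (p :: primes n).
  apply: uniq_perm; rewrite ?primes_uniq //= ?primes_uniq.
    by rewrite mem_primes pp n0 (negPf pn).
  by move=> q; rewrite primesM // primes_prime // !inE.
rewrite /mu /moebius muln_gt0 p0 n0 (perm_all _ E) (perm_size E) /=.
rewrite lognM // logn_prime // eqxx lognE (negPf pn) /= !andbF /=.
rewrite (@eq_in_all _ _ (fun q => logn q n == 1%N)); last first.
  move=> q qn; rewrite lognM // logn_prime //.
  case: (eqVneq q p) => // qp; move: qn pn; rewrite qp mem_primes.
  by case/and3P=> _ _ ->.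
by case: ifP => _; rewrite ?oppr0 // exprS mulN1r rmorphN.
Qed.

Lemma norm_mu_le1 n : `|mu n| <= 1.
Proof.
rewrite /mu /moebius; case: ifP => _; last by rewrite normr0.
by rewrite rmorphXn /= normrX rmorphN normrN1 expr1n.
Qed.

(** The full, rough and smooth sums are the cases [predT], [rough z] and [smooth z], so they share
    one set of identities. *)
Definition mu_on (pi : nat_pred) n : R := if pi.-nat n then mu n else 0.

Lemma norm_mu_on_le1 pi n : `|mu_on pi n| <= 1.
Proof. by rewrite /mu_on; case: ifP => _; rewrite ?normr0 ?norm_mu_le1. Qed.

(** If a prime p of [pi] divides n, the divisors p e with e prime to p cancel against the divisors
    e, since mu(p e) = - mu(e); those divisible by p^2 contribute nothing. *)
Lemma sum_mu_on pi n : (0 < n)%N ->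
  \sum_(1 <= d < n.+1 | (d %| n)%N) mu_on pi d = ((negn pi).-nat n)%:R.
Proof.
move=> n0; have [nn|/negP nn] := boolP ((negn pi).-nat n).
  rewrite (sum_single (i := 1%N)) ?dvd1n //.
  move=> d /andP[d0 _] dn d1; rewrite /mu_on; case: ifP => // dpi.
  have := pnat_coprime dpi (pnat_dvd dn nn).
  by rewrite /coprime gcdnn (negPf d1).
have /allPn[p] : ~~ all [in negn pi] (primes n) by move: nn; rewrite /pnat n0 => /negP.
rewrite mem_primes inE /= negbK => /and3P[pp _ pn] ppi.
have p0 := prime_gt0 pp.
have np0 : (0 < n %/ p)%N by rewrite divn_gt0 // dvdn_leq.
pose F e : R := if (p %| e)%N then 0 else mu_on pi e.
rewrite (bigID (fun d => p %| d)%N) /=.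
have -> : \sum_(1 <= d < n.+1 | (d %| n)%N && (p %| d)%N) mu_on pi d =
    \sum_(1 <= e < n.+1 | (e %| n %/ p)%N) - F e.
  rewrite -divisor_sum_widen ?np0 ?leq_div //.
  rewrite (eq_bigl (fun d => (p %| d)%N && (d %| n)%N)); last by move=> d; rewrite andbC.
  rewrite big_mkcondr (sum_multiples (fun d => if (d %| n)%N then mu_on pi d else 0)) //.
  rewrite -big_mkcond (eq_bigl (fun e => (e %| n %/ p)%N)); last first.
    by move=> e; rewrite dvdn_divRL // mulnC.
  rewrite [LHS]big_nat_cond [RHS]big_nat_cond.
  apply: eq_bigr => e /andP[/andP[e0 _] _]; rewrite /F /mu_on pnatM.
  have -> : pi.-nat p by rewrite pnatE.
  have [pe|pe] := boolP (p %| e)%N; last first.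
    by rewrite /=; case: ifP => _; rewrite ?oppr0 // mu_prime_mul.
  rewrite oppr0; case: ifP => // _; apply: (@mu_square p) => //.
  by rewrite expnS expn1 dvdn_pmul2l.
have -> : \sum_(1 <= d < n.+1 | (d %| n)%N && ~~ (p %| d)%N) mu_on pi d =
    \sum_(1 <= e < n.+1 | (e %| n %/ p)%N) F e.
  rewrite [RHS](bigID (fun d => p %| d)%N) /= [X in X + _]big1 ?add0r; last first.
    by move=> e /andP[_]; rewrite /F => ->.
  rewrite (eq_bigl (fun e => (e %| n %/ p)%N && ~~ (p %| e)%N)); last first.
    move=> e; have [|pe] /= := boolP (p %| e)%N; rewrite ?andbF ?andbT //.
    by rewrite dvdn_divRL // Gauss_dvd ?pn ?andbT // coprime_sym prime_coprime.
  by apply: eq_bigr => e /andP[_]; rewrite /F => /negPf ->.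
by rewrite sumrN addNr.
Qed.

Lemma sum_mu n : (0 < n)%N ->
  \sum_(1 <= d < n.+1 | (d %| n)%N) mu d = (n == 1%N)%:R.
Proof.
move=> n0; transitivity (\sum_(1 <= d < n.+1 | (d %| n)%N) mu_on predT d).
  rewrite [LHS]big_nat_cond [RHS]big_nat_cond; apply: eq_bigr => d /andP[/andP[d0 _] _].
  by rewrite /mu_on /pnat d0 (eq_all (a2 := predT)) ?all_predT.
rewrite sum_mu_on //; congr (_ _)%:R; have := primes_eq0 n.
rewrite /pnat n0 /=; case: (primes n) => [|p s] /=; first by case: n n0 => [|[]].
by case: n n0 => [|[]].
Qed.

Lemma mobius_inversion (f F : nat -> R) :
  (forall n, (0 < n)%N -> \sum_(1 <= d < n.+1 | (d %| n)%N) f d = F n) ->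
  forall n, (0 < n)%N ->
    \sum_(1 <= d < n.+1 | (d %| n)%N) mu d * F (n %/ d)%N = f n.
Proof.
move=> fF n n0.
transitivity (\sum_(1 <= d < n.+1 | (d %| n)%N)
    \sum_(1 <= k < (n %/ d).+1 | (k %| n %/ d)%N) mu d * f k).
  rewrite [LHS]big_nat_cond [RHS]big_nat_cond; apply: eq_bigr => d /andP[/andP[d0 _] dn].
  by rewrite -fF ?mulr_sumr // divn_gt0 // dvdn_leq.
rewrite (divisor_sum_swap (fun d k => mu d * f k)) //.
rewrite (sum_single (i := n)) ?n0 ?ltnSn //.
  by rewrite divnn n0 -mulr_suml sum_mu // mul1r.
move=> k /andP[k0 _] kn kn1; rewrite -mulr_suml sum_mu; last exact: dvdn_div_gt0.
by rewrite eq_sym eqn_div // mul1n (negPf kn1) mul0r.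
Qed.

(** At most one pair (q, j) contributes. Writing the value as a double sum reduces sums against
    [mangoldt] to exchanges of summation, as in [sum_mangoldt_pow]. *)
Definition mangoldt (n : nat) : R :=
  \sum_(1 <= q < n.+1 | prime q) \sum_(1 <= j < n.+1 | (q ^ j == n)%N) ln q%:R.

Lemma mangoldt_ge0 n : 0 <= mangoldt n.
Proof.
by apply: sumr_ge0 => q /prime_gt0 q0; apply: sumr_ge0 => j _; rewrite ln_ge0 // ler1n.
Qed.

Lemma mangoldt1 : mangoldt 1 = 0.
Proof. by rewrite /mangoldt big_mkcond big_nat1. Qed.

Lemma ln_nat_prod (I : Type) (r : seq I) (P : pred I) (f : I -> nat) :
  (forall i, P i -> (0 < f i)%N) ->
  ln (\prod_(i <- r | P i) f i)%N%:R = \sum_(i <- r | P i) ln (f i)%:R :> R.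
Proof.
move=> f0; elim: r => [|i r IH]; first by rewrite !big_nil ln1.
rewrite !big_cons; case: ifP => // Pi; rewrite natrM lnM ?IH //.
  by rewrite posrE ltr0n f0.
by rewrite posrE ltr0n prodn_cond_gt0.
Qed.

Lemma sum_mangoldt_pow (f : nat -> R) N :
  \sum_(1 <= n < N.+1) mangoldt n * f n =
  \sum_(1 <= q < N.+1 | prime q) \sum_(1 <= j < N.+1 | (q ^ j <= N)%N) ln q%:R * f (q ^ j)%N.
Proof.
have E n : (1 <= n < N.+1)%N -> mangoldt n * f n =
    \sum_(1 <= q < N.+1 | prime q) \sum_(1 <= j < N.+1 | (q ^ j == n)%N)
      ln q%:R * f (q ^ j)%N.
  move=> /andP[n0 nN].
  have widen q : prime q ->
      \sum_(1 <= j < n.+1 | (q ^ j == n)%N) (ln q%:R * f (q ^ j)%N) =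
      \sum_(1 <= j < N.+1 | (q ^ j == n)%N) (ln q%:R * f (q ^ j)%N).
    move=> pq; rewrite [RHS](big_cat_nat _ (n := n.+1)) //=.
    rewrite [X in _ + X]big_nat_cond [X in _ + X]big_pred0 ?addr0 // => j.
    apply/negP => /andP[/andP[nj _] /eqP qj].
    by have := ltn_expl j (prime_gt1 pq); rewrite qj ltnNge (ltnW nj).
  rewrite [RHS](big_cat_nat _ (n := n.+1)) //= [X in _ + X]big_nat_cond.
  rewrite [X in _ + X]big1 ?addr0 => [|q /andP[/andP[nq _] pq]]; last first.
    rewrite big_nat_cond big_pred0 // => j; apply/negP => /andP[/andP[j0 _] /eqP qj].
    have : (q %| n)%N by rewrite -qj dvdn_exp.
    by move=> /dvdn_leq -/(_ n0); rewrite leqNgt nq.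
  rewrite /mangoldt mulr_suml; apply: eq_bigr => q pq; rewrite -widen // mulr_suml.
  by apply: eq_bigr => j /eqP ->.
rewrite (eq_big_nat _ _ E) (exchange_big_dep_nat (fun q => prime q)) //=.
apply: eq_bigr => q pq; rewrite (exchange_big_dep_nat xpredT) //= [RHS]big_mkcond.
rewrite [LHS]big_nat_cond [RHS]big_nat_cond; apply: eq_bigr => j /andP[/andP[j0 _] _].
rewrite (eq_bigl (fun n => n == q ^ j)%N) => [|n]; last first.
  by rewrite pq eq_sym.
by rewrite big_nat1_eq expn_gt0 prime_gt0 //= ltnS.
Qed.

(** This is the logarithm of the prime factorisation: the powers of q dividing n are the q^j with 1
    <= j <= [logn q n], and each contributes ln q. *)
Lemma sum_mangoldt_divisors n : (0 < n)%N ->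
  \sum_(1 <= d < n.+1 | (d %| n)%N) mangoldt d = ln n%:R.
Proof.
move=> n0; rewrite big_mkcond.
rewrite (eq_bigr (fun d => mangoldt d * (d %| n)%N%:R)) => [|d _]; last first.
  by case: ifP; rewrite (mulr1, mulr0).
rewrite sum_mangoldt_pow -[in RHS](partnT n0) /partn.
rewrite ln_nat_prod => [|q _]; last first.
  by case: q => [|q]; rewrite ?expn_gt0 // lognE.
rewrite big_ltn // /= expn0 ln1 add0r [RHS](bigID prime) /= addrC.
rewrite [X in _ = X + _]big1 ?add0r => [|q]; last first.
  by rewrite lognE => /negPf ->; rewrite expn0 ln1.
rewrite big_mkcond [RHS]big_mkcond; apply: eq_big_nat => q /andP[q0 qn].
case: ifP => // pq; rewrite natrX lnXn ?ltr0n //.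
have vn : (logn q n <= n)%N.
  by rewrite (leq_trans (ltnW (ltn_expl _ (prime_gt1 pq)))) // dvdn_leq ?pfactor_dvdnn.
rewrite big_mkcond.
rewrite (eq_bigr (fun j => if (j < (logn q n).+1)%N then ln q%:R else 0)) => [|j _]; last first.
  have := @pfactor_dvdn q j n pq n0; rewrite ltnS => <-.
  case: ifPn => [_|qj]; first by case: ifP; rewrite (mulr1, mulr0).
  by case: ifP => // /dvdn_leq -/(_ n0); rewrite (negPf qj).
by rewrite -big_mkcond -(big_nat_widen _ _ _ xpredT) // sumr_const_nat subn1.
Qed.

Lemma mu_conv_ln n : (0 < n)%N ->
  \sum_(1 <= d < n.+1 | (d %| n)%N) mu d * ln (n %/ d)%:R = mangoldt n.
Proof. exact: (mobius_inversion (F := fun n => ln n%:R) sum_mangoldt_divisors). Qed.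

Lemma sum_mu_ln n : (0 < n)%N ->
  \sum_(1 <= d < n.+1 | (d %| n)%N) mu d * ln d%:R = - mangoldt n.
Proof.
move=> n0; rewrite -mu_conv_ln // -sumrN.
transitivity (\sum_(1 <= d < n.+1 | (d %| n)%N) (ln n%:R * mu d - mu d * ln (n %/ d)%:R)).
  rewrite [LHS]big_nat_cond [RHS]big_nat_cond; apply: eq_bigr => d /andP[/andP[d0 _] dn].
  have -> : ln n%:R = ln d%:R + ln (n %/ d)%:R :> R.
    by rewrite -lnM -?natrM ?posrE ?ltr0n ?dvdn_div_gt0 // mulnC divnK.
  by ring.
rewrite big_split /= -mulr_sumr sum_mu //.
by case: eqP => [->|_]; rewrite ?ln1 ?mulr0 ?mul0r add0r.
Qed.

Lemma mu_ln n : (0 < n)%N ->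
  \sum_(1 <= d < n.+1 | (d %| n)%N) mangoldt d * mu (n %/ d)%N = - (mu n * ln n%:R).
Proof.
move=> n0; have := mobius_inversion (F := fun n => - mangoldt n) sum_mu_ln n0.
rewrite -(divisor_sum_rev (fun d => mu d * - mangoldt (n %/ d))) // => <-.
rewrite -sumrN [LHS]big_nat_cond [RHS]big_nat_cond; apply: eq_bigr => d /andP[/andP[d0 _] dn].
have -> : (n %/ (n %/ d) = d)%N by rewrite -{1}(divnK dn) mulKn // dvdn_div_gt0.
by ring.
Qed.

Definition mangoldt_on (pi : nat_pred) n : R := if pi.-nat n then mangoldt n else 0.

Lemma mangoldt_on_ge0 pi n : 0 <= mangoldt_on pi n.
Proof. by rewrite /mangoldt_on; case: ifP => // _; apply: mangoldt_ge0. Qed.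

(** A product is a [pi]-number exactly when both factors are, so restriction to [pi]-numbers
    commutes with Dirichlet convolution and [mu_ln] survives it. *)
Lemma mu_on_ln pi n : (0 < n)%N ->
  \sum_(1 <= d < n.+1 | (d %| n)%N) mangoldt_on pi d * mu_on pi (n %/ d)%N =
  - (mu_on pi n * ln n%:R).
Proof.
move=> n0; have E d : (d %| n)%N -> pi.-nat n = pi.-nat d && pi.-nat (n %/ d)%N.
  by move=> dn; rewrite -{1}(divnK dn) mulnC pnatM.
rewrite [in RHS]/mu_on; case: ifP => [npi|/negP npi].
  rewrite -mu_ln //; apply: eq_bigr => d dn; rewrite /mangoldt_on /mu_on.
  by move: npi; rewrite (E d) // => /andP[-> ->].
rewrite mul0r oppr0 big1 // => d dn; rewrite /mangoldt_on /mu_on.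
by move: npi; rewrite (E d) //; do 2!case: ifP => _; rewrite ?mul0r ?mulr0 // => /negP.
Qed.

End Moebius.

(** * Chebyshev and Mertens estimates *)

Section Elementary_estimates.
Variable R : realType.

Lemma ln_sub_le (a b : R) : 0 < a -> 0 < b -> ln b - ln a <= (b - a) / a.
Proof.
move=> a0 b0; rewrite -ln_div ?posrE //.
have -> : b / a = 1 + (b - a) / a by field; rewrite gt_eqF.
apply: le_ln1Dx; have : 0 < b / a by rewrite divr_gt0.
by rewrite mulrBl divff ?gt_eqF //; lra.
Qed.

Lemma ln_sub_ge (a b : R) : 0 < a -> 0 < b -> (b - a) / b <= ln b - ln a.
Proof. by move=> a0 b0; have := ln_sub_le b0 a0; rewrite -(opprB b a) mulNr; lra. Qed.

Lemma ln_nat_ge0 n : 0 <= ln n%:R :> R.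
Proof. by case: n => [|n]; [rewrite ln0 | rewrite ln_ge0 ?ler1n]. Qed.

Lemma ler_ln_nat m n : (0 < m)%N -> (m <= n)%N -> ln m%:R <= ln n%:R :> R.
Proof. by move=> m0 mn; rewrite ler_ln ?posrE ?ltr0n ?ler_nat // (leq_trans m0). Qed.

Lemma lnS_le n : (0 < n)%N -> ln n.+1%:R - ln n%:R <= n%:R^-1 :> R.
Proof.
move=> n0; have := @ln_sub_le n%:R n.+1%:R; rewrite !ltr0n => /(_ n0 isT).
by rewrite -natrB // subSnn mul1r.
Qed.

Lemma lnS_ge n : (0 < n)%N -> n.+1%:R^-1 <= ln n.+1%:R - ln n%:R :> R.
Proof.
move=> n0; have := @ln_sub_ge n%:R n.+1%:R; rewrite !ltr0n => /(_ n0 isT).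
by rewrite -natrB // subSnn mul1r.
Qed.

Lemma divn_le_div N n : (0 < n)%N -> (N %/ n)%:R <= N%:R / n%:R :> R.
Proof. by move=> n0; rewrite ler_pdivlMr ?ltr0n // -natrM ler_nat leq_divM. Qed.

Lemma div_lt_divnS N n : (0 < n)%N -> N%:R / n%:R < (N %/ n)%:R + 1 :> R.
Proof.
by move=> n0; rewrite ltr_pdivrMr ?ltr0n // natr1 -natrM ltr_nat ltn_ceil.
Qed.

Lemma abel_summation (a phi : nat -> R) M N : (M <= N)%N ->
  \sum_(M <= n < N) a n * phi n =
  (\sum_(M <= k < N) a k) * phi N +
  \sum_(M <= n < N) (\sum_(M <= k < n.+1) a k) * (phi n - phi n.+1).
Proof.
move=> MN; rewrite -(subnKC MN); elim: (N - M)%N => [|d IH].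
  by rewrite addn0 !big_geq // mul0r addr0.
by rewrite addnS !big_nat_recr ?leq_addr //= IH; ring.
Qed.

Lemma abel_le (a phi : nat -> R) M N (C : R) : (M <= N)%N -> 0 <= phi N ->
  (forall n, (M <= n < N)%N -> phi n.+1 <= phi n) ->
  (forall n, (n <= N)%N -> `|\sum_(M <= k < n) a k| <= C) ->
  `|\sum_(M <= n < N) a n * phi n| <= C * phi M.
Proof.
move=> MN phi0 phiS AC; rewrite abel_summation //.
have -> : C * phi M = C * phi N + \sum_(M <= n < N) C * (phi n - phi n.+1).
  rewrite -mulr_sumr -mulrDr; congr (_ * _).
  rewrite -[X in _ + X]opprK -sumrN (eq_bigr (fun n => phi n.+1 - phi n)).
    by rewrite telescope_sumr //; ring.
  by move=> n _; rewrite opprB.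
apply: le_trans (ler_normD _ _) _; apply: lerD.
  by rewrite normrM (ger0_norm phi0) ler_wpM2r // AC.
apply: le_trans (ler_norm_sum _ _ _) _; rewrite big_nat [leRHS]big_nat.
apply: ler_sum => n nN; rewrite normrM [X in _ * X]ger0_norm; last first.
  by rewrite subr_ge0 phiS.
by rewrite ler_wpM2r ?subr_ge0 ?phiS // AC //; case/andP: nN.
Qed.

Definition harmonic_sum N : R := \sum_(1 <= n < N.+1) n%:R^-1.

Lemma harmonic_sumS N : harmonic_sum N.+1 = harmonic_sum N + N.+1%:R^-1.
Proof. by rewrite /harmonic_sum big_nat_recr. Qed.

Lemma harmonic_sum1 : harmonic_sum 1 = 1.
Proof. by rewrite /harmonic_sum big_nat1 invr1. Qed.

Lemma harmonic_sum_le N : (0 < N)%N -> harmonic_sum N <= 1 + ln N%:R.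
Proof.
case: N => // N _; elim: N => [|N IH]; first by rewrite harmonic_sum1 ln1; lra.
rewrite harmonic_sumS; have := @lnS_ge N.+1 isT. lrai.
Qed.

Lemma harmonic_sum_ge N : ln N.+1%:R <= harmonic_sum N.
Proof.
elim: N => [|N IH]; first by rewrite /harmonic_sum big_geq // ln1.
by rewrite harmonic_sumS; have := @lnS_le N.+1 isT; lrai.
Qed.

(** The constant is the supremum of the increasing [v]. It lies below the decreasing [u], and u N -
    v N = 1/(N+1) gives the error term. *)
Lemma euler_constant : exists g : R, 0 <= g <= 1 /\
  forall N, (0 < N)%N -> 0 <= harmonic_sum N - ln N%:R - g <= N%:R^-1.
Proof.
pose u N : R := harmonic_sum N.+1 - ln N.+1%:R.
pose v N : R := harmonic_sum N - ln N.+1%:R.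
have u_dec : {homo u : m n / (m <= n)%N >-> n <= m}.
  apply/nonincreasing_seqP => N; rewrite /u harmonic_sumS.
  by have := @lnS_ge N.+1 isT; lrai.
have v_inc : {homo v : m n / (m <= n)%N >-> m <= n}.
  apply/nondecreasing_seqP => N; rewrite /v harmonic_sumS.
  by have := @lnS_le N.+1 isT; lrai.
have vu m n : v m <= u n.
  have /v_inc h1 := leq_maxl m n; have /u_dec h2 := leq_maxr m n.
  apply: le_trans h1 (le_trans _ h2); rewrite /u /v harmonic_sumS.
  by rewrite lerD2r lerDl invr_ge0 ler0n.
have ub n : ubound (range v) (u n) by move=> _ [m _ <-]; apply: vu.
have hs : has_sup (range v) by split; [exists (v 0%N), 0%N | exists (u 0%N); apply: ub].
exists (sup (range v)); split.
  apply/andP; split.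
    have : v 0%N <= sup (range v) by apply: sup_upper_bound => //; exists 0%N.
    by rewrite /v ln1 /harmonic_sum big_geq // subr0.
  apply: ge_sup; first by exists (v 0%N), 0%N.
  by move=> x /(ub 0%N); rewrite /u harmonic_sum1 ln1 subr0.
case=> // N _; have h1 : sup (range v) <= u N.
  by apply: ge_sup; [exists (v 0%N), 0%N | apply: ub].
have h2 : v N <= sup (range v) by apply: sup_upper_bound => //; exists N.
by move: h1 h2; rewrite /u /v harmonic_sumS => h1 h2; apply/andP; split; lrai.
Qed.

Definition ln_sum N : R := \sum_(1 <= n < N.+1) ln n%:R.

Lemma ln_sumS N : ln_sum N.+1 = ln_sum N + ln N.+1%:R.
Proof. by rewrite /ln_sum big_nat_recr. Qed.

Lemma ln_sum_bounds N : (0 < N)%N ->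
  N%:R * ln N%:R - N%:R <= ln_sum N <= N%:R * ln N%:R - N%:R + ln N%:R + 1.
Proof.
case: N => // N _; elim: N => [|N /andP[l u]].
  by rewrite /ln_sum big_nat1 ln1; lra.
have n0 : 0 < N.+1%:R :> R by rewrite ltr0n.
have h1 : N.+1%:R * (ln N.+2%:R - ln N.+1%:R) <= 1 :> R.
  by rewrite -[leRHS](mulfV (lt0r_neq0 n0)) ler_pM2l // lnS_le.
have h2 : 1 <= N.+2%:R * (ln N.+2%:R - ln N.+1%:R) :> R.
  by rewrite -[leLHS](@mulfV _ N.+2%:R) ?pnatr_eq0 // ler_pM2l ?ltr0n // lnS_ge.
rewrite ln_sumS; apply/andP; split; lra.
Qed.

(** With q the fourth root of t, 1 + ln t = 1 + 4 ln q <= 1 + 4 (q - 1) <= 4 q. *)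
Lemma ln_le_root (t : R) : 1 <= t -> (1 + ln t) ^+ 2 <= 16 * Num.sqrt t.
Proof.
move=> t1; set q := Num.sqrt (Num.sqrt t).
have q2 : q ^+ 2 = Num.sqrt t by rewrite sqr_sqrtr ?sqrtr_ge0.
have q4 : q ^+ 4 = t by rewrite (exprM q 2 2) q2 sqr_sqrtr; lra.
have q1 : 1 <= q by rewrite -[1](@sqrtr1 R) ler_wsqrtr // -[1](@sqrtr1 R) ler_wsqrtr.
have q0 : 0 < q by lra.
have lq : ln q <= q - 1 by have := @ln_sub_le 1 q; rewrite ln1 divr1; lra.
have lt : ln t = 4 * ln q by rewrite -q4 lnXn // mulr_natl.
have l0 : 0 <= ln q by rewrite ln_ge0.
rewrite -q2 lt; nra.
Qed.

Lemma sum_inv_sqrt_le N : \sum_(1 <= n < N.+1) (Num.sqrt n%:R)^-1 <= 2 * Num.sqrt N%:R :> R.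
Proof.
elim: N => [|N IH]; first by rewrite big_geq // mulr_ge0 // sqrtr_ge0.
rewrite big_nat_recr //=; set s := \sum_(_ <= _ < _) _ in IH *.
set a := Num.sqrt N%:R in IH *; set b := Num.sqrt N.+1%:R.
have b0 : 0 < b by rewrite sqrtr_gt0 ltr0n.
have a0 : 0 <= a by rewrite sqrtr_ge0.
have ba : b ^+ 2 = a ^+ 2 + 1 by rewrite !sqr_sqrtr ?ler0n // natr1.
suff : b^-1 <= 2 * b - 2 * a by lra.
rewrite -[leLHS]mul1r ler_pdivrMr //; nra.
Qed.

(** Squares of ln (N/n) are bounded on average; this keeps the error in Selberg's formula at O(N),
    with no logarithm. *)
Lemma sum_ln_sqr_le N :
  \sum_(1 <= n < N.+1) (1 + ln (N%:R / n%:R)) ^+ 2 <= 32 * N%:R :> R.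
Proof.
have [->|N0] := posnP N; first by rewrite big_geq // mulr0.
have E n : (1 <= n < N.+1)%N -> (1 + ln (N%:R / n%:R)) ^+ 2 <=
    16 * Num.sqrt N%:R * (Num.sqrt n%:R)^-1 :> R.
  move=> /andP[n0 nN]; rewrite -mulrA -sqrtrV ?ler0n // -sqrtrM ?ler0n //.
  by apply: ln_le_root; rewrite ler_pdivlMr ?ltr0n // mul1r ler_nat.
rewrite big_nat; apply: le_trans (ler_sum _ (fun n => E n)) _.
rewrite -big_nat -mulr_sumr.
have := sum_inv_sqrt_le N; set s := \sum_(_ <= _ < _) _ => hs.
rewrite -[X in _ <= _ * X](@sqr_sqrtr _ (N%:R : R)) ?ler0n //.
by have := sqrtr_ge0 (N%:R : R); nra.
Qed.

End Elementary_estimates.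

Section Chebyshev_Mertens.
Variable R : realType.
Local Notation mangoldt := (mangoldt R).
Local Notation mu_on := (mu_on R).
Local Notation mangoldt_on := (mangoldt_on R).

Lemma sum_dirichlet (a b f : nat -> R) N :
  \sum_(1 <= n < N.+1) f n * (\sum_(1 <= d < n.+1 | (d %| n)%N) a d * b (n %/ d)%N) =
  \sum_(1 <= d < N.+1) \sum_(1 <= k < (N %/ d).+1) f (d * k)%N * (a d * b k).
Proof.
rewrite -(dirichlet_sum (fun d k => f (d * k)%N * (a d * b k))).
apply: eq_bigr => n _; rewrite mulr_sumr; apply: eq_bigr => d dn.
by rewrite [in RHS]mulnC divnK.
Qed.

Lemma sum_dirichlet1 (a b : nat -> R) N :
  \sum_(1 <= n < N.+1) (\sum_(1 <= d < n.+1 | (d %| n)%N) a d * b (n %/ d)%N) =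
  \sum_(1 <= d < N.+1) a d * \sum_(1 <= k < (N %/ d).+1) b k.
Proof.
rewrite (eq_bigr _ (fun n _ => esym (mul1r _))) (sum_dirichlet a b (fun=> 1)).
by apply: eq_bigr => d _; rewrite mulr_sumr; apply: eq_bigr => k _; rewrite mul1r.
Qed.

Lemma sum_dirichletV (a b : nat -> R) N :
  \sum_(1 <= n < N.+1) (\sum_(1 <= d < n.+1 | (d %| n)%N) a d * b (n %/ d)%N) / n%:R =
  \sum_(1 <= d < N.+1) a d / d%:R * \sum_(1 <= k < (N %/ d).+1) b k / k%:R.
Proof.
rewrite (eq_bigr _ (fun n _ => mulrC _ _)) (sum_dirichlet a b (fun n => n%:R^-1)).
apply: eq_bigr => d _; rewrite mulr_sumr; apply: eq_bigr => k _.
by rewrite natrM invfM; ring.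
Qed.

Lemma divisor_sum_mul1 (a : nat -> R) n :
  \sum_(1 <= d < n.+1 | (d %| n)%N) a d = \sum_(1 <= d < n.+1 | (d %| n)%N) a d * 1.
Proof. by apply: eq_bigr => d _; rewrite mulr1. Qed.

Definition psi N : R := \sum_(1 <= n < N.+1) mangoldt n.

Lemma psi_ge0 N : 0 <= psi N.
Proof. by apply: sumr_ge0 => n _; apply: mangoldt_ge0. Qed.

Lemma ln_sum_mangoldt N :
  ln_sum R N = \sum_(1 <= d < N.+1) mangoldt d * (N %/ d)%:R.
Proof.
rewrite /ln_sum (eq_big_nat _ _ (F2 := fun n =>
    \sum_(1 <= d < n.+1 | (d %| n)%N) mangoldt d * 1)) => [|n /andP[n0 _]].
  rewrite (sum_dirichlet1 mangoldt (fun=> 1)).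
  by apply: eq_bigr => d _; rewrite sumr_const_nat subn1.
by rewrite -divisor_sum_mul1 sum_mangoldt_divisors.
Qed.

Lemma ln_sum_psi N : ln_sum R N = \sum_(1 <= k < N.+1) psi (N %/ k).
Proof.
rewrite /ln_sum (eq_big_nat _ _ (F2 := fun n =>
    \sum_(1 <= d < n.+1 | (d %| n)%N) 1 * mangoldt (n %/ d))) => [|n /andP[n0 _]].
  rewrite (sum_dirichlet1 (fun=> 1) mangoldt).
  by apply: eq_bigr => d _; rewrite mul1r.
rewrite -sum_mangoldt_divisors // -divisor_sum_rev //.
by apply: eq_bigr => d _; rewrite mul1r.
Qed.

(** Chebyshev's argument: by [ln_sum_mangoldt] the coefficient of [mangoldt d] on the right is
    floor(N/d) - 2 floor(N/(2d)), which is nonnegative, and equals 1 for N/2 < d <= N. *)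
Lemma psi_half N : psi N - psi (N %/ 2) <= ln_sum R N - 2 * ln_sum R (N %/ 2).
Proof.
have cut (F : nat -> R) : \sum_(1 <= d < N.+1) F d =
    \sum_(1 <= d < (N %/ 2).+1) F d + \sum_((N %/ 2).+1 <= d < N.+1) F d.
  by rewrite (big_cat_nat _ (n := (N %/ 2).+1)) // ltnS leq_div.
have -> : ln_sum R (N %/ 2) = \sum_(1 <= d < N.+1) mangoldt d * (N %/ d %/ 2)%:R.
  rewrite ln_sum_mangoldt [RHS]cut [X in _ + X]big_nat [X in _ + X]big1 ?addr0.
    by apply: eq_bigr => d _; rewrite divnAC.
  by move=> d /andP[d1 _]; rewrite divnAC divn_small ?mulr0.
rewrite ln_sum_mangoldt mulr_sumr -sumrB.
rewrite /psi (cut mangoldt) [X in X - _]addrC addrK cut -[leLHS]add0r; apply: lerD.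
  apply: sumr_ge0 => d _; rewrite mulrCA -mulrBr mulr_ge0 ?mangoldt_ge0 //.
  by rewrite subr_ge0 -natrM ler_nat mulnC leq_divM.
rewrite big_nat [leRHS]big_nat; apply: ler_sum => d /andP[d1 dN].
have -> : (N %/ d = 1)%N.
  have d0 : (0 < d)%N by lia.
  have : (N %/ d < 2)%N by rewrite ltn_divLR //; lia.
  have : (0 < N %/ d)%N by rewrite divn_gt0 //; lia.
  lia.
by rewrite mulr1 mulr0 mulr0 subr0.
Qed.

Lemma psi_le N : psi N <= 8 * N%:R.
Proof.
elim/ltn_ind: N => N IH.
have [N2|N2] := ltnP N 2.
  rewrite /psi; case: N N2 {IH} => [|[|//]] _; first by rewrite big_geq // mulr0.
  by rewrite big_nat1 mangoldt1; lra.
have IH2 : psi (N %/ 2) <= 8 * (N %/ 2)%:R by apply: IH; rewrite ltn_Pdiv //; lia.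
have := psi_half N; set M := (N %/ 2)%N in IH2 *.
have M0 : (0 < M)%N by rewrite divn_gt0.
have /andP[l _] := ln_sum_bounds R M0.
have N0 : (0 < N)%N by lia.
have /andP[_ u] := ln_sum_bounds R N0.
have M1 : 1 <= M%:R :> R by rewrite ler1n.
have NM : N%:R <= 2 * M%:R + 1 :> R.
  by rewrite -[2]/(2%:R) -natrM natr1 ler_nat /M; lia.
have MN : 2 * M%:R <= N%:R :> R by rewrite -[2]/(2%:R) -natrM ler_nat /M; lia.
have lNM : ln N%:R - ln M%:R <= 2 :> R.
  apply: le_trans (ln_sub_le _ _) _; rewrite ?ltr0n //.
  by rewrite ler_pdivrMr ?ltr0n //; lra.
have lN : ln N%:R <= N%:R - 1 :> R.
  by have := @ln_sub_le R 1 N%:R; rewrite ltr0n ln1 divr1 subr0; apply.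
have lN0 := ln_nat_ge0 R N.
have : 2 * M%:R * (ln N%:R - ln M%:R) <= 2 * M%:R * 2 :> R by rewrite ler_wpM2l //; lra.
have : (N%:R - 2 * M%:R) * ln N%:R <= ln N%:R :> R by rewrite ler_piMl //; lra.
lra.
Qed.

Definition mangoldt_sum N : R := \sum_(1 <= n < N.+1) mangoldt n / n%:R.

(** Removing the floors in [ln_sum_mangoldt] changes the sum by at most [psi N], which is at most 8
    N; the rest is the Stirling bound on [ln_sum]. *)
Lemma mertens N : (0 < N)%N -> `|mangoldt_sum N - ln N%:R| <= 8.
Proof.
move=> N0; have /andP[l u] := ln_sum_bounds R N0.
have n0 : 0 < N%:R :> R by rewrite ltr0n.
have h1 : ln_sum R N <= N%:R * mangoldt_sum N.
  rewrite ln_sum_mangoldt mulr_sumr big_nat [leRHS]big_nat; apply: ler_sum => d /andP[d0 _].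
  by rewrite mulrCA ler_wpM2l ?mangoldt_ge0 // divn_le_div.
have h2 : N%:R * mangoldt_sum N <= ln_sum R N + psi N.
  rewrite ln_sum_mangoldt mulr_sumr -big_split /= big_nat [leRHS]big_nat.
  apply: ler_sum => d /andP[d0 _]; rewrite mulrCA -[X in _ + X]mulr1 -mulrDr.
  by rewrite ler_wpM2l ?mangoldt_ge0 // ltW // div_lt_divnS.
have := psi_le N.
have lN : ln N%:R <= N%:R - 1 :> R.
  by have := @ln_sub_le R 1 N%:R; rewrite ltr0n ln1 divr1 subr0; apply.
by move=> h3; rewrite ler_norml; apply/andP; split; rewrite -(ler_pM2l n0); lra.
Qed.

(** The added term majorises the tail of the series: with it the left-hand side is nonincreasing in
    N, and it starts at 2. *)
Lemma sum_ln_over_sqr_le N :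
  \sum_(2 <= n < N.+2) ln n%:R / (n%:R * (n%:R - 1)) + (ln N.+1%:R + 2) / N.+1%:R <= 2 :> R.
Proof.
elim: N => [|N IH]; first by rewrite big_geq // ln1 divr1; lra.
rewrite big_nat_recr //=; apply: le_trans IH; rewrite -addrA lerD2l.
have -> : N.+2%:R - 1 = N.+1%:R :> R by rewrite -natr1 addrK.
set a : R := N.+1%:R; have a1 : 1 <= a by rewrite ler1n.
have -> : N.+2%:R = a + 1 :> R by rewrite natr1.
have h : (a + 1) * (ln (a + 1) - ln a) <= 2.
  have h : ln (a + 1) - ln a <= a^-1.
    by have := @ln_sub_le R a (a + 1); rewrite addrAC subrr add0r mul1r; apply; lra.
  have : (a + 1) * (ln (a + 1) - ln a) <= (a + 1) * a^-1 by rewrite ler_wpM2l //; lra.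
  move/le_trans; apply; rewrite ler_pdivrMr; lra.
have -> : ln (a + 1) / ((a + 1) * a) + (ln (a + 1) + 2) / (a + 1) =
    (ln (a + 1) + (ln (a + 1) + 2) * a) / ((a + 1) * a) by field; lra.
rewrite ler_pdivrMr; last by nra.
have -> : (ln a + 2) / a * ((a + 1) * a) = (ln a + 2) * (a + 1) by field; lra.
lra.
Qed.

Lemma geometric_tail (x : R) n : 1 < x ->
  \sum_(2 <= j < n.+2) (x ^+ j)^-1 <= (x * (x - 1))^-1.
Proof.
move=> x1; suff : \sum_(2 <= j < n.+2) (x ^+ j)^-1 + (x ^+ n.+1 * (x - 1))^-1 =
    (x * (x - 1))^-1.
  move=> <-; rewrite lerDl invr_ge0 mulr_ge0 ?exprn_ge0 //; lra.
elim: n => [|n IH]; first by rewrite big_geq // add0r expr1.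
rewrite big_nat_recr //= -IH -addrA; congr (_ + _).
rewrite !exprS; field; rewrite expf_neq0 /=; lra.
Qed.

(** Summing the geometric series over exponents j >= 2 leaves ln q / (q (q - 1)) for each prime q.
    Hence Mertens' estimate passes from [mangoldt] to primes at bounded cost. *)
Lemma prime_powers_sum_le N :
  \sum_(1 <= n < N.+1 | ~~ prime n) mangoldt n / n%:R <= 2.
Proof.
rewrite big_mkcond (eq_bigr (fun n => mangoldt n * ((~~ prime n)%:R / n%:R))); last first.
  by move=> n _; case: (prime n); rewrite ?mul0r ?mulr0 // mul1r.
rewrite sum_mangoldt_pow.
apply: (@le_trans _ _ (\sum_(1 <= q < N.+1 | prime q) ln q%:R / (q%:R * (q%:R - 1)))).
  rewrite big_nat_cond [leRHS]big_nat_cond; apply: ler_sum => q /andP[/andP[q0 qN] pq].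
  have q1 : 1 < q%:R :> R by rewrite ltr1n prime_gt1.
  rewrite -mulr_sumr ler_wpM2l ?ln_nat_ge0 //.
  apply: le_trans (geometric_tail N q1); rewrite big_ltn_cond; last by have := prime_gt1 pq; lia.
  rewrite expn1 pq mul0r add0r if_same.
  rewrite [leRHS](big_cat_nat _ (n := N.+1)) //=; last by lia.
  rewrite -[leLHS]addr0 lerD //; last first.
    by apply: sumr_ge0 => j _; rewrite invr_ge0 exprn_ge0 //; lra.
  rewrite big_mkcond; apply: ler_sum => j _; rewrite natrX.
  have h : 0 <= (q%:R ^+ j)^-1 :> R by rewrite invr_ge0 exprn_ge0 //; lra.
  by case: ifP => // _; case: (prime _); rewrite ?mul0r ?mul1r.
case: N => [|N]; first by rewrite big_geq.
rewrite big_ltn_cond //=.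
have := sum_ln_over_sqr_le N; set s := \sum_(_ <= _ < _) _ => hs.
have hs0 : 0 <= (ln N.+1%:R + 2) / N.+1%:R :> R.
  by rewrite divr_ge0 // addr_ge0 // ln_nat_ge0.
apply: (@le_trans _ _ s); last by rewrite (le_trans _ hs) // lerDl.
rewrite big_mkcond /s big_nat [leRHS]big_nat; apply: ler_sum => q /andP[q2 _].
case: ifP => // _; rewrite divr_ge0 ?ln_nat_ge0 // mulr_ge0 // subr_ge0 ler1n; lia.
Qed.

End Chebyshev_Mertens.

(** * Moebius sums over rough and smooth integers *)

Section Moebius_sums.
Variable R : realType.
Local Notation mangoldt := (mangoldt R).
Local Notation mu_on := (mu_on R).
Local Notation mangoldt_on := (mangoldt_on R).
Local Notation mangoldt_sum := (mangoldt_sum R).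

Definition mu_sum (pi : nat_pred) N : R := \sum_(1 <= n < N.+1) mu_on pi n / n%:R.

Definition recip_sum (pi : nat_pred) N : R :=
  \sum_(1 <= n < N.+1) (pi.-nat n)%:R / n%:R.

(* [N * mu_sum pi N] differs from the number of [l <= N] without prime factor in
   [pi] by at most the number of [1 < n <= N] with all prime factors in [pi]. *)
Lemma norm_mu_sum_le1 pi N : `|mu_sum pi N| <= 1.
Proof.
have [->|N0] := posnP N; first by rewrite /mu_sum big_geq // normr0.
have n0 : 0 < N%:R :> R by rewrite ltr0n.
pose A : R := \sum_(1 <= l < N.+1) ((negn pi).-nat l)%:R.
have EA : \sum_(1 <= d < N.+1) mu_on pi d * (N %/ d)%:R = A.
  transitivity (\sum_(1 <= d < N.+1) mu_on pi d * \sum_(1 <= k < (N %/ d).+1) 1).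
    by apply: eq_bigr => d _; rewrite sumr_const_nat subn1.
  rewrite -(sum_dirichlet1 (mu_on pi) (fun=> 1)) /A.
  by apply: eq_big_nat => n /andP[n_0 _]; rewrite -divisor_sum_mul1 sum_mu_on.
pose B : R := \sum_(1 <= n < N.+1) (pi.-nat n && (n != 1%N))%:R.
have EB : `|N%:R * mu_sum pi N - A| <= B.
  rewrite -EA mulr_sumr -sumrB; apply: le_trans (ler_norm_sum _ _ _) _.
  rewrite big_nat [leRHS]big_nat; apply: ler_sum => n /andP[n_0 nN].
  rewrite mulrCA -mulrBr normrM; have := divn_le_div R N n_0.
  have := div_lt_divnS R N n_0 => h1 h2.
  rewrite [X in _ * X]ger0_norm ?subr_ge0 //.
  have [->|n1] := eqVneq n 1%N; first by rewrite divr1 divn1 subrr mulr0.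
  rewrite andbT /mu_on; case: ifP => _; last by rewrite normr0 mul0r.
  by rewrite mulr_ile1 ?subr_ge0 ?norm_mu_le1 // lerBlDl addrC ltW // addrC.
have A0 : 0 <= A by apply: sumr_ge0 => n _; rewrite ler0n.
have AB : A + B <= N%:R.
  have -> : N%:R = \sum_(1 <= n < N.+1) 1 :> R by rewrite sumr_const_nat subn1.
  rewrite -big_split /=.
  rewrite big_nat [leRHS]big_nat; apply: ler_sum => n /andP[n_0 _].
  rewrite -natrD lern1; have [->|n1] := eqVneq n 1%N; first by rewrite andbF addn0 leq_b1.
  have [np|_] /= := boolP (pi.-nat n); last by rewrite addn0 leq_b1.
  have [nn|//] := boolP ((negn pi).-nat n).
  by have := pnat_coprime np nn; rewrite /coprime gcdnn (negPf n1).
rewrite -(ler_pM2l n0) mulr1 -[X in X * _](ger0_norm (ltW n0)) -normrM.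
move: EB; rewrite ler_norml => /andP[l u].
rewrite ler_norml; apply/andP; split; lra.
Qed.

Lemma mu_on_ln_sum pi N :
  \sum_(1 <= n < N.+1) mu_on pi n * ln n%:R / n%:R =
  - \sum_(1 <= k < N.+1) mangoldt_on pi k / k%:R * mu_sum pi (N %/ k).
Proof.
rewrite -sum_dirichletV -sumrN; apply: eq_big_nat => n /andP[n0 _].
by rewrite mu_on_ln // mulNr opprK.
Qed.

(** Here mu stays in the outer sum, so that Mertens' theorem can evaluate the inner one;
    [mu_on_ln_sum] has the opposite nesting. *)
Lemma mu_on_ln_sum' pi N :
  \sum_(1 <= n < N.+1) mu_on pi n * ln n%:R / n%:R =
  - \sum_(1 <= n < N.+1) mu_on pi n / n%:R *
      \sum_(1 <= k < (N %/ n).+1) mangoldt_on pi k / k%:R.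
Proof.
rewrite -sum_dirichletV -sumrN; apply: eq_big_nat => n /andP[n0 _].
rewrite -mulNr; congr (_ / _); apply: oppr_inj; rewrite opprK -mu_on_ln //.
rewrite -(divisor_sum_rev (fun d => mu_on pi d * mangoldt_on pi (n %/ d)))//.
rewrite [LHS]big_nat_cond [RHS]big_nat_cond; apply: eq_bigr => d /andP[/andP[d0 _] dn].
have -> : (n %/ (n %/ d) = d)%N by rewrite -{1}(divnK dn) mulKn // dvdn_div_gt0.
by rewrite mulrC.
Qed.

Lemma mu_sum_log_harmonic pi N :
  recip_sum (negn pi) N = \sum_(1 <= d < N.+1) mu_on pi d / d%:R * harmonic_sum R (N %/ d).
Proof.
transitivity (\sum_(1 <= n < N.+1)
    (\sum_(1 <= d < n.+1 | (d %| n)%N) mu_on pi d * 1) / n%:R).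
  by apply: eq_big_nat => n /andP[n0 _]; rewrite -divisor_sum_mul1 sum_mu_on.
rewrite (sum_dirichletV (mu_on pi) (fun=> 1)); apply: eq_bigr => d _; congr (_ * _).
by apply: eq_bigr => k _; rewrite div1r.
Qed.

(** In [mu_sum_log_harmonic], [harmonic_sum R (N %/ n)] is ln (N/n) + g up to 2 n/N. The errors,
    weighted by 1/n, sum to at most 2, and g times the Moebius sum adds at most 1. *)
Lemma mu_on_lnV_sum pi N : (0 < N)%N ->
  `|\sum_(1 <= n < N.+1) mu_on pi n / n%:R * (ln N%:R - ln n%:R) -
    recip_sum (negn pi) N| <= 3.
Proof.
move=> N0; have n0 : 0 < N%:R :> R by rewrite ltr0n.
have [g [/andP[g0 g1] hg]] := euler_constant R.
rewrite mu_sum_log_harmonic -sumrB.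
have -> : \sum_(1 <= n < N.+1) (mu_on pi n / n%:R * (ln N%:R - ln n%:R) -
      mu_on pi n / n%:R * harmonic_sum R (N %/ n)) =
    \sum_(1 <= n < N.+1) mu_on pi n / n%:R *
      (ln N%:R - ln n%:R - harmonic_sum R (N %/ n) + g) - g * mu_sum pi N.
  by rewrite mulr_sumr -sumrB; apply: eq_bigr => n _; ring.
have h : `|g * mu_sum pi N| <= 1.
  rewrite normrM (ger0_norm g0); have := norm_mu_sum_le1 pi N.
  by have := normr_ge0 (mu_sum pi N); nra.
apply: le_trans (ler_normB _ _) _.
suff : `|\sum_(1 <= n < N.+1) mu_on pi n / n%:R *
      (ln N%:R - ln n%:R - harmonic_sum R (N %/ n) + g)| <= 2 by lra.
apply: le_trans (ler_norm_sum _ _ _) _.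
have -> : 2 = \sum_(1 <= n < N.+1) 2 / N%:R :> R.
  by rewrite sumr_const_nat subn1 -[RHS]mulr_natr divfK ?gt_eqF.
rewrite big_nat [leRHS]big_nat; apply: ler_sum => n /andP[n_0]; rewrite ltnS => nN.
have nn0 : 0 < n%:R :> R by rewrite ltr0n.
set s := (N %/ n)%N; have s0 : (0 < s)%N by rewrite divn_gt0.
have s1 : 1 <= s%:R :> R by rewrite ler1n.
have /andP[l1 u1] := hg _ s0.
have l2 := divn_le_div R N n_0; have u2 := div_lt_divnS R N n_0.
rewrite -/s in l2 u2.
have l3 : 0 <= ln (N%:R / n%:R) - ln s%:R :> R.
  by rewrite subr_ge0 ler_ln ?posrE ?divr_gt0 // ltr0n.
have u3 : ln (N%:R / n%:R) - ln s%:R <= s%:R^-1 :> R.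
  apply: le_trans (ln_sub_le _ _) _; rewrite ?divr_gt0 ?ltr0n //.
  rewrite ler_pdivrMr ?ltr0n // mulVf ?pnatr_eq0 -?lt0n //; lra.
have u4 : s%:R^-1 <= 2 * n%:R / N%:R :> R.
  rewrite -(ler_pM2r n0) divfK ?gt_eqF // ler_pdivrMl ?ltr0n //.
  have : N%:R <= (s%:R + 1) * n%:R :> R by rewrite -ler_pdivrMr // ltW.
  have : n%:R <= s%:R * n%:R :> R by rewrite ler_peMl // ltW.
  lra.
set e := (X in `|_ * X|); have he : `|e| <= 2 * n%:R / N%:R.
  apply: le_trans u4; rewrite /e -ln_div ?posrE // ler_norml.
  by apply/andP; split; lrai.
have -> : 2 / N%:R = n%:R^-1 * (2 * n%:R / N%:R) :> R by field; rewrite !gt_eqF.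
rewrite normrM ler_pM // normrM [X in _ * X]ger0_norm ?invr_ge0 //.
by rewrite ler_piMl ?invr_ge0 // norm_mu_on_le1.
Qed.

Lemma mu_sum_log pi N : (0 < N)%N ->
  `|mu_sum pi N * ln N%:R +
    \sum_(1 <= k < N.+1) mangoldt_on pi k / k%:R * mu_sum pi (N %/ k) -
    recip_sum (negn pi) N| <= 3.
Proof.
move=> N0; apply: le_trans (mu_on_lnV_sum pi N0); rewrite le_eqVlt; apply/orP; left.
apply/eqP; congr (`|_ - _|); rewrite -[X in _ + X]opprK -mu_on_ln_sum mulr_suml -sumrB.
by apply: eq_bigr => n _; ring.
Qed.

Definition smooth (z : nat) : nat_pred := [pred p | (p <= z)%N].
Definition rough (z : nat) : nat_pred := negn (smooth z).

Lemma rough_prime z p : prime p -> (rough z).-nat p = (z < p)%N.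
Proof. by move=> pp; rewrite pnatE // !inE /= -ltnNge. Qed.

Lemma smooth_prime z p : prime p -> (smooth z).-nat p = (p <= z)%N.
Proof. by move=> pp; rewrite pnatE. Qed.

Lemma rough_small z n : (1 < n)%N -> (n <= z)%N -> (rough z).-nat n = false.
Proof.
move=> n1 nz; apply/negP => /andP[_ /allP /(_ (pdiv n))].
rewrite mem_primes pdiv_prime // pdiv_dvd (ltnW n1) => /(_ isT).
by rewrite !inE /= (leq_trans _ nz) // pdiv_leq // ltnW.
Qed.

(** Mertens up to z costs 8. The powers of small primes that exceed z are not primes, and
    [prime_powers_sum_le] bounds them by 2. *)
Lemma mangoldt_smooth_sum z N : (0 < z)%N ->
  \sum_(1 <= k < N.+1) mangoldt_on (smooth z) k / k%:R <= ln z%:R + 10.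
Proof.
move=> z0; have := mertens R z0; rewrite ler_norml => /andP[_ hz].
have hp := prime_powers_sum_le R N.
suff : \sum_(1 <= k < N.+1) mangoldt_on (smooth z) k / k%:R <=
    mangoldt_sum z + \sum_(1 <= n < N.+1 | ~~ prime n) mangoldt n / n%:R by lra.
have -> : mangoldt_sum z = \sum_(1 <= k < (N + z).+1 | (k < z.+1)%N) mangoldt k / k%:R.
  by rewrite -(big_nat_widen _ _ _ xpredT) // ltnS leq_addl.
have F0 k : 0 <= mangoldt k / k%:R by rewrite divr_ge0 ?mangoldt_ge0.
apply: (@le_trans _ _ (\sum_(1 <= k < N.+1 | (k < z.+1)%N) mangoldt k / k%:R +
    \sum_(1 <= n < N.+1 | ~~ prime n) mangoldt n / n%:R)).
  rewrite [X in _ <= X + _]big_mkcond [X in _ <= _ + X]big_mkcond -big_split /=.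
  apply: ler_sum => k _; rewrite /mangoldt_on; case: ifPn => [ks|_]; last first.
    by rewrite mul0r addr_ge0 //; case: ifP.
  case: (ltnP k z.+1) => kz; first by rewrite lerDl; case: ifP.
  case: ifPn => [_|]; first by rewrite add0r.
  by rewrite negbK => pk; move: ks; rewrite smooth_prime // leqNgt kz.
rewrite lerD2r [leRHS](big_cat_nat _ (n := N.+1)) //= ?ltnS ?leq_addr //.
by rewrite lerDl sumr_ge0.
Qed.

Definition mangoldt_rough_sum z N : R :=
  \sum_(1 <= k < N.+1) mangoldt_on (rough z) k / k%:R.

Lemma mangoldt_rough_sum_small z N : (N <= z)%N -> mangoldt_rough_sum z N = 0.
Proof.
move=> Nz; rewrite /mangoldt_rough_sum big_nat big1 // => k /andP[k0 kN].
have [->|k1] := eqVneq k 1%N; first by rewrite /mangoldt_on mangoldt1 mul0r.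
rewrite /mangoldt_on rough_small ?mul0r //; lia.
Qed.

(** The sum of mangoldt(k)/k over z < k <= N costs 8 + 8 by Mertens; it exceeds the rough sum only
    by powers of primes up to z, which are not primes and cost 2. *)
Lemma mangoldt_rough_sum_large z N : (0 < z <= N)%N ->
  `|mangoldt_rough_sum z N - (ln N%:R - ln z%:R)| <= 18.
Proof.
move=> /andP[z0 zN]; have := mertens R z0; rewrite ler_norml => /andP[lz uz].
have N0 : (0 < N)%N by lia.
have := mertens R N0; rewrite ler_norml => /andP[lN uN].
have F0 k : 0 <= mangoldt k / k%:R by rewrite divr_ge0 ?mangoldt_ge0.
have hp := prime_powers_sum_le R N.
have E : mangoldt_sum N - mangoldt_sum z =
    \sum_(1 <= k < N.+1) if (z < k)%N then mangoldt k / k%:R else 0.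
  rewrite /mangoldt_sum (big_cat_nat _ (n := z.+1)) //= [RHS](big_cat_nat _ (n := z.+1)) //=.
  rewrite addrAC subrr add0r [X in _ = X + _]big_nat [X in _ = X + _]big1 ?add0r.
    by apply: eq_big_nat => k /andP[->].
  by move=> k /andP[_]; rewrite ltnS leqNgt => /negPf ->.
have u : mangoldt_rough_sum z N <= mangoldt_sum N - mangoldt_sum z.
  rewrite E /mangoldt_rough_sum big_nat [leRHS]big_nat; apply: ler_sum => k /andP[k0 _].
  rewrite /mangoldt_on; case: ltnP => kz.
    by case: ifP => _ //; rewrite mul0r.
  have [->|k1] := eqVneq k 1%N; first by rewrite mangoldt1 mul0r.
  rewrite rough_small ?mul0r //; lia.
have l : mangoldt_sum N - mangoldt_sum z <= mangoldt_rough_sum z N +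
    \sum_(1 <= n < N.+1 | ~~ prime n) mangoldt n / n%:R.
  rewrite E [X in _ <= _ + X]big_mkcond -big_split /=; apply: ler_sum => k _.
  have G0 : 0 <= mangoldt_on (rough z) k / k%:R by rewrite divr_ge0 ?mangoldt_on_ge0.
  case: ifP => kz; last by rewrite addr_ge0 //; case: ifP.
  case: ifPn => [_|]; first by rewrite lerDr.
  by rewrite negbK addr0 => pk; rewrite /mangoldt_on rough_prime // kz.
rewrite ler_norml; apply/andP; split; lra.
Qed.

Lemma recip_sum_ge0 pi N : 0 <= recip_sum pi N.
Proof. by apply: sumr_ge0 => n _; rewrite divr_ge0. Qed.

(* Every integer has at most one factorisation into an integer [<= z], which is
   [z]-smooth, and a [z]-rough integer. *)
Lemma recip_sum_rough_le z N : (1 < z)%N -> (0 < N)%N ->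
  recip_sum (rough z) N <= (1 + ln z%:R + ln N%:R) / ln z%:R.
Proof.
move=> z1 N0; have z0 : (0 < z)%N by lia.
have lz : 0 < ln z%:R :> R by rewrite ln_gt0 // ltr1n.
rewrite ler_pdivlMr //.
have hz : ln z%:R <= harmonic_sum R z.
  by apply: le_trans (harmonic_sum_ge R z); apply: ler_ln_nat.
apply: (@le_trans _ _ (recip_sum (rough z) N * harmonic_sum R z)).
  by rewrite ler_wpM2l // recip_sum_ge0.
apply: (@le_trans _ _ (harmonic_sum R (z * N))); last first.
  apply: le_trans (harmonic_sum_le R _) _; first by rewrite muln_gt0 z0.
  by rewrite natrM lnM ?posrE ?ltr0n // addrA.
pose a n : R := (n <= z)%N%:R.
pose b n : R := ((rough z).-nat n && (n <= N)%N)%:R.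
apply: (@le_trans _ _ (\sum_(1 <= n < (z * N).+1)
    (\sum_(1 <= d < n.+1 | (d %| n)%N) a d * b (n %/ d)%N) / n%:R)).
  rewrite sum_dirichletV mulrC /harmonic_sum mulr_suml.
  rewrite [leRHS](big_cat_nat _ (n := z.+1)) //= ?ltnS ?leq_pmulr //.
  rewrite -[leLHS]addr0 lerD //; last first.
    apply: sumr_ge0 => d _; apply: mulr_ge0; first by rewrite divr_ge0.
    by apply: sumr_ge0 => k _; rewrite divr_ge0.
  rewrite big_nat [leRHS]big_nat; apply: ler_sum => d /andP[d0]; rewrite ltnS => dz.
  rewrite /a dz div1r ler_wpM2l ?invr_ge0 // [leRHS](big_cat_nat _ (n := N.+1)) //=; last first.
    by rewrite ltnS leq_divRL // mulnC leq_mul2r dz orbT.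
  rewrite -[leLHS]addr0 lerD //; last by apply: sumr_ge0 => k _; rewrite divr_ge0.
  rewrite /recip_sum [leLHS]big_nat [leRHS]big_nat; apply: ler_sum => k /andP[k0].
  by rewrite ltnS /b => ->; rewrite andbT.
rewrite /harmonic_sum big_nat [leRHS]big_nat; apply: ler_sum => n /andP[n0 _].
rewrite -[leRHS]mul1r ler_wpM2r ?invr_ge0 //.
rewrite (sum_single (i := n`_(smooth z))) ?dvdn_part //.
- by rewrite mulr_ile1 ?lern1 ?ler0n ?leq_b1.
- by rewrite part_gt0 ltnS dvdn_leq ?dvdn_part.
move=> d /andP[d0 _] dn /negP dE; rewrite /a /b.
case: leqP => dz; last by rewrite mul0r.
have [/andP[nr _]|_] := boolP ((rough z).-nat (n %/ d)%N && _); last by rewrite mulr0.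
case: dE; rewrite -{1}(divnK dn) partnM ?dvdn_div_gt0 // (part_p'nat nr) mul1n.
rewrite part_pnat_id //; apply/pnatP => // p pp /dvdn_leq -/(_ d0) pd.
by rewrite inE /= (leq_trans pd).
Qed.

End Moebius_sums.

(** * Selberg's formula and the prime number theorem *)

Section Selberg.
Variable R : realType.
Local Notation mangoldt := (mangoldt R).
Local Notation mangoldt_sum := (mangoldt_sum R).
Local Notation psi := (psi R).
Local Notation mu := (mu R).

(** Selberg's function Lambda_2, the Dirichlet convolution of mu with ln^2. *)
Definition selberg_weight (n : nat) : R := mangoldt n * ln n%:R +
  \sum_(1 <= d < n.+1 | (d %| n)%N) mangoldt d * mangoldt (n %/ d)%N.

Lemma ln_nat_le n : ln n%:R <= n%:R :> R.
Proof.
case: n => [|n]; first by rewrite ln0.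
have := @ln_sub_le R 1 n.+1%:R; rewrite ltr0n ln1 divr1 subr0 => /(_ ltr01 isT) h.
by apply: (le_trans h); rewrite gerBl.
Qed.

Lemma mangoldt_lnV_sum N :
  0 <= psi N * ln N%:R - \sum_(1 <= n < N.+1) mangoldt n * ln n%:R <= 8 * N%:R.
Proof.
have -> : psi N * ln N%:R - \sum_(1 <= n < N.+1) mangoldt n * ln n%:R =
    \sum_(1 <= n < N.+1) mangoldt n * (ln N%:R - ln n%:R).
  by rewrite mulr_suml -sumrB; apply: eq_bigr => n _; ring.
apply/andP; split.
  rewrite big_nat; apply: sumr_ge0 => n /andP[n0 nN].
  by rewrite mulr_ge0 ?mangoldt_ge0 // subr_ge0 ler_ln_nat.
case: N => [|N]; first by rewrite big_geq // mulr0.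
rewrite big_nat_recr //= subrr mulr0 addr0.
rewrite abel_summation // subrr mulr0 add0r.
apply: (@le_trans _ _ (\sum_(1 <= n < N.+1) 8)); last first.
  by rewrite sumr_const_nat subn1 -[leLHS]mulr_natr ler_wpM2l // ler_nat.
rewrite [leLHS]big_nat [leRHS]big_nat; apply: ler_sum => n /andP[n0 nN].
have := psi_le R n; rewrite /psi; set s := \sum_(_ <= _ < _) _ => hs.
have nR : 0 < n%:R :> R by rewrite ltr0n.
have -> : ln N.+1%:R - ln n%:R - (ln N.+1%:R - ln n.+1%:R) = ln n.+1%:R - ln n%:R :> R by ring.
have h : ln n.+1%:R - ln n%:R <= n%:R^-1 :> R by rewrite lnS_le.
have h0 : 0 <= ln n.+1%:R - ln n%:R :> R by rewrite subr_ge0 ler_ln_nat.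
apply: (@le_trans _ _ (8 * n%:R * n%:R^-1)); last by rewrite mulfK ?gt_eqF.
apply: ler_pM => //; exact: psi_ge0.
Qed.

(** Collecting the terms with n k = l, the coefficient of F l is the sum of mu(d) (ln N - ln d) over
    d | l, that is [l = 1] ln N + mangoldt(l). *)
Lemma tatuzawa_iseki (F : nat -> R) (N : nat) : (0 < N)%N ->
  \sum_(1 <= n < N.+1) mu n * (ln N%:R - ln n%:R) *
     \sum_(1 <= k < (N %/ n).+1) F (n * k)%N =
  F 1%N * ln N%:R + \sum_(1 <= l < N.+1) F l * mangoldt l.
Proof.
move=> N0; transitivity (\sum_(1 <= d < N.+1) \sum_(1 <= k < (N %/ d).+1)
    F (d * k)%N * (mu d * (ln N%:R - ln d%:R) * 1)).
  by apply: eq_bigr => d _; rewrite mulr_sumr; apply: eq_bigr => k _; ring.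
rewrite -(sum_dirichlet (fun d => mu d * (ln N%:R - ln d%:R)) (fun=> 1)).
transitivity (\sum_(1 <= n < N.+1) ((n == 1%N)%:R * (F n * ln N%:R) + F n * mangoldt n)).
  apply: eq_big_nat => n /andP[n0 _]; rewrite -sum_mu // -[mangoldt n]opprK -sum_mu_ln //.
  rewrite mulrN mulr_suml !mulr_sumr -sumrB; apply: eq_bigr => d _; ring.
rewrite big_split /=; congr (_ + _).
rewrite big_ltn // big_nat big1 ?addr0 ?eqxx ?mul1r // => n /andP[n1 _].
by rewrite gtn_eqF ?mul0r.
Qed.

(* With Euler's constant [g], the choice of [F] in [tatuzawa_iseki] makes the inner
   sums logarithmic. *)
Lemma selberg N : (0 < N)%N ->
  `|\sum_(1 <= n < N.+1) selberg_weight n - 2 * N%:R * ln N%:R| <= 130 * N%:R.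
Proof.
move=> N0; have [g [/andP[g0 g1] hg]] := euler_constant R.
have NR : 0 < N%:R :> R by rewrite ltr0n.
pose F l : R := psi (N %/ l) - N%:R / l%:R + (g + 1).
have := tatuzawa_iseki F N0.
set L := \sum_(1 <= n < _) mu n * _ * _ => EL.
have hL : `|L| <= 96 * N%:R.
  apply: le_trans (ler_norm_sum _ _ _) _.
  apply: (@le_trans _ _ (\sum_(1 <= n < N.+1) 3 * (1 + ln (N%:R / n%:R)) ^+ 2)); last first.
    by rewrite -mulr_sumr; have := sum_ln_sqr_le R N; lra.
  rewrite [leLHS]big_nat [leRHS]big_nat; apply: ler_sum => n /andP[n0]; rewrite ltnS => nN.
  have nR : 0 < n%:R :> R by rewrite ltr0n.
  have -> : ln N%:R - ln n%:R = ln (N%:R / n%:R) :> R by rewrite ln_div ?posrE.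
  set s := (N %/ n)%N; set t := N%:R / n%:R.
  have s0 : (0 < s)%N by rewrite divn_gt0.
  have s1 : 1 <= s%:R :> R by rewrite ler1n.
  have st : s%:R <= t := divn_le_div R N n0.
  have ts : t < s%:R + 1 := div_lt_divnS R N n0.
  have ls0 := ln_nat_ge0 R s.
  have lst : ln s%:R <= ln t by rewrite ler_ln ?posrE //; lra.
  have -> : \sum_(1 <= k < s.+1) F (n * k)%N =
      ln_sum R s - t * harmonic_sum R s + (g + 1) * s%:R.
    rewrite ln_sum_psi /harmonic_sum mulr_sumr -sumrB.
    have -> : (g + 1) * s%:R = \sum_(1 <= k < s.+1) (g + 1).
      by rewrite sumr_const_nat subn1 mulr_natr.
    rewrite -big_split /=; apply: eq_bigr => k _; rewrite /F divnMA natrM invfM /t.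
    by ring.
  have /andP[l1 u1] := hg _ s0; have /andP[l2 u2] := ln_sum_bounds R s0.
  (* With s = floor(t), the main terms s ln s - s, t (ln s + g) and (g + 1) s cancel up to multiples
     of t - s, which is below 1. *)
  set I := (X in _ * X); have hI : `|I| <= ln s%:R + 4.
    set e := harmonic_sum R s - ln s%:R - g in l1 u1.
    have te : t * e <= 2.
      have : t * e <= 2 * s%:R * s%:R^-1 by apply: ler_pM => //; lra.
      by rewrite mulfK //; lra.
    have te0 : 0 <= t * e by rewrite mulr_ge0 //; lra.
    have EI : I = ln_sum R s - t * (e + ln s%:R + g) + (g + 1) * s%:R.
      by rewrite /I /e; ring.
    have d1 : (t - s%:R) * ln s%:R <= ln s%:R by rewrite ler_piMl //; lra.
    have d0 : 0 <= (t - s%:R) * ln s%:R by rewrite mulr_ge0 //; lra.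
    have d3 : (t - s%:R) * g <= 1 by rewrite mulr_ile1 //; lra.
    have d2 : 0 <= (t - s%:R) * g by rewrite mulr_ge0 //; lra.
    rewrite EI ler_norml; apply/andP; split; lra.
  rewrite normrM normrM (ger0_norm (x := ln t)); last by lra.
  have m1 : `|mu n| * ln t <= 1 * ln t by rewrite ler_wpM2r ?norm_mu_le1 //; lra.
  have m2 : `|mu n| * ln t * `|I| <= 1 * ln t * (ln s%:R + 4).
    by apply: ler_pM => //; rewrite mulr_ge0 //; lra.
  nra.
have E1 : \sum_(1 <= l < N.+1) F l * mangoldt l =
    \sum_(1 <= l < N.+1) mangoldt l * psi (N %/ l) - N%:R * mangoldt_sum N + (g + 1) * psi N.
  rewrite !mulr_sumr -sumrB -big_split /=; apply: eq_bigr => l _; rewrite /F; ring.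
have E2 : \sum_(1 <= n < N.+1) selberg_weight n =
    \sum_(1 <= n < N.+1) mangoldt n * ln n%:R + \sum_(1 <= l < N.+1) mangoldt l * psi (N %/ l).
  by rewrite /selberg_weight big_split /= sum_dirichlet1.
have EF1 : F 1%N = psi N - N%:R + (g + 1) by rewrite /F divn1 divr1.
have := mertens R N0; rewrite ler_norml => /andP[l3 u3].
have /andP[l4 u4] := mangoldt_lnV_sum N.
have p0 := psi_ge0 R N; have p1 := psi_le R N.
have lN0 := ln_nat_ge0 R N; have lN1 := ln_nat_le N.
move: hL; rewrite EL E1 EF1 E2 ler_norml => /andP[l5 u5].
have q1 : N%:R * (mangoldt_sum N - ln N%:R) <= N%:R * 8 by rewrite ler_wpM2l // ltW.
have q2 : N%:R * - 8 <= N%:R * (mangoldt_sum N - ln N%:R) by rewrite ler_wpM2l // ltW.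
have q3 : (g + 1) * psi N <= 2 * (8 * N%:R) by apply: ler_pM => //; lra.
have q4 : 0 <= (g + 1) * psi N by rewrite mulr_ge0 //; lra.
have q5 : (g + 1) * ln N%:R <= 2 * N%:R by apply: ler_pM => //; lra.
have q6 : 0 <= (g + 1) * ln N%:R by rewrite mulr_ge0 //; lra.
set A := \sum_(_ <= _ < _) _ in l4 u4 l5 u5 *.
(* The lower bound needs exactly 130 = 96 + 8 + 8 + 16 + 2, from [L], Mertens, [mangoldt_lnV_sum],
   and (g + 1) times psi(N) and ln N. *)
rewrite ler_norml; apply/andP; split; lra.
Qed.

End Selberg.

(** * Selberg's inequality for the sums of mu(n)/n *)

Section Prime_number_theorem.
Variable R : realType.
Local Notation mangoldt := (mangoldt R).
Local Notation mangoldt_on := (mangoldt_on R).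
Local Notation mangoldt_sum := (mangoldt_sum R).
Local Notation mu := (mu R).
Local Notation m := (mu_sum R predT).
Local Notation H := (harmonic_sum R).
Local Notation selberg_weight := (selberg_weight R).

Lemma pnat_predT n : (0 < n)%N -> predT.-nat n.
Proof. by move=> n0; rewrite /pnat n0 (eq_all (a2 := predT)) ?all_predT. Qed.

Lemma recip_sum_negn_predT N : (0 < N)%N -> recip_sum R (negn predT) N = 1.
Proof.
move=> N0; rewrite /recip_sum big_ltn // big_nat big1 ?addr0 ?divr1 //.
move=> n /andP[n1 _]; have n0 : (0 < n)%N by lia.
rewrite -(partn_eq1 predT n0) partnT //.
by rewrite gtn_eqF ?mul0r.
Qed.

Definition log_defect N : R :=
  m N * ln N%:R + \sum_(1 <= k < N.+1) mangoldt k / k%:R * m (N %/ k).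

Lemma log_defect_le N : (0 < N)%N -> `|log_defect N| <= 4.
Proof.
move=> N0; have := mu_sum_log R predT N0; rewrite recip_sum_negn_predT //.
have -> : \sum_(1 <= k < N.+1) mangoldt_on predT k / k%:R * m (N %/ k) =
    \sum_(1 <= k < N.+1) mangoldt k / k%:R * m (N %/ k).
  by apply: eq_big_nat => k /andP[k0 _]; rewrite /mangoldt_on pnat_predT.
rewrite -/(log_defect N) !ler_norml => /andP[l u]; apply/andP; split; lra.
Qed.

Lemma mu_sum_sub u v : (v <= u)%N -> `|m u - m v| <= H u - H v.
Proof.
move=> vu; rewrite /mu_sum /harmonic_sum.
rewrite (big_cat_nat _ (n := v.+1)) //= addrAC subrr add0r.
rewrite [X in _ <= X - _](big_cat_nat _ (n := v.+1)) //= addrAC subrr add0r.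
apply: le_trans (ler_norm_sum _ _ _) _; apply: ler_sum => n _.
by rewrite normrM [X in _ * X]ger0_norm ?invr_ge0 // ler_piMl ?invr_ge0 // norm_mu_on_le1.
Qed.

(** The identity defining [log_defect] is applied twice: m(N) ln^2 N is expanded at N, ln N is split
    as ln k + ln (N/k), and m(N/k) ln (N/k) is expanded again. The terms mangoldt(k) ln k and the
    convolution of mangoldt with itself appear with opposite signs; absolute values turn them into
    [selberg_weight]. *)
Lemma mu_sum_selberg N : (0 < N)%N ->
  `|m N| * ln N%:R ^+ 2 <=
  \sum_(1 <= k < N.+1) selberg_weight k * (`|m (N %/ k)| / k%:R) + 9 * ln N%:R + 40.
Proof.
move=> N0; have lN := ln_nat_ge0 R N.
(* The rounding loss in passing from ln (N/k) to the logarithm of the integer quotient. *)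
pose th k : R := ln N%:R - ln k%:R - ln (N %/ k)%:R.
have thb k : (1 <= k < N.+1)%N -> 0 <= th k <= 1.
  move=> /andP[k0]; rewrite ltnS => kN; have kR : 0 < k%:R :> R by rewrite ltr0n.
  have NR : 0 < N%:R :> R by rewrite ltr0n.
  have s0 : (0 < N %/ k)%N by rewrite divn_gt0.
  have sR : 1 <= (N %/ k)%:R :> R by rewrite ler1n.
  have h1 := divn_le_div R N k0; have h2 := div_lt_divnS R N k0.
  rewrite /th -[X in X - _]ln_div ?posrE // subr_ge0; apply/andP; split.
    by rewrite ler_ln ?posrE //; lra.
  apply: le_trans (ln_sub_le _ _) _; rewrite ?ltr0n //; first by rewrite divr_gt0.
  by rewrite ler_pdivrMr ?ltr0n // mul1r; lra.
have conv : \sum_(1 <= n < N.+1)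
      (\sum_(1 <= d < n.+1 | (d %| n)%N) mangoldt d * mangoldt (n %/ d)%N) * (m (N %/ n) / n%:R) =
    \sum_(1 <= k < N.+1) mangoldt k / k%:R *
      \sum_(1 <= j < (N %/ k).+1) mangoldt j / j%:R * m (N %/ k %/ j).
  transitivity (\sum_(1 <= n < N.+1) (m (N %/ n) / n%:R) *
      (\sum_(1 <= d < n.+1 | (d %| n)%N) mangoldt d * mangoldt (n %/ d)%N)).
    by apply: eq_bigr => n _; rewrite mulrC.
  rewrite (sum_dirichlet mangoldt mangoldt (fun n => m (N %/ n) / n%:R)).
  apply: eq_bigr => d _; rewrite mulr_sumr; apply: eq_bigr => k _.
  by rewrite divnMA natrM invfM; ring.
have E : m N * ln N%:R ^+ 2 =
    log_defect N * ln N%:R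
    - \sum_(1 <= k < N.+1) mangoldt k * ln k%:R * (m (N %/ k) / k%:R)
    + \sum_(1 <= n < N.+1)
      (\sum_(1 <= d < n.+1 | (d %| n)%N) mangoldt d * mangoldt (n %/ d)%N) * (m (N %/ n) / n%:R)
    - \sum_(1 <= k < N.+1) mangoldt k / k%:R * (log_defect (N %/ k) + th k * m (N %/ k)).
  rewrite conv {1}/log_defect mulrDl -!addrA expr2 mulrA -[LHS]addr0; congr (_ + _).
  rewrite mulr_suml -!sumrN -!big_split /=; apply/esym/big1 => k _.
  by rewrite /log_defect /th; ring.
have bnd (c d : nat -> R) (h : forall k, (1 <= k < N.+1)%N -> `|c k| <= d k) :
    `|\sum_(1 <= k < N.+1) c k| <= \sum_(1 <= k < N.+1) d k.
  apply: le_trans (ler_norm_sum _ _ _) _.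
  by rewrite [leLHS]big_nat [leRHS]big_nat; apply: ler_sum.
have last : `|\sum_(1 <= k < N.+1) mangoldt k / k%:R *
    (log_defect (N %/ k) + th k * m (N %/ k))| <= 5 * ln N%:R + 40.
  have := mertens R N0; rewrite ler_norml => /andP[_ hm].
  apply: (@le_trans _ _ (5 * mangoldt_sum N)); last by lra.
  rewrite /mangoldt_sum mulr_sumr; apply: bnd => k kN.
  rewrite normrM mulrC [X in _ * X <= _]ger0_norm; last by rewrite divr_ge0 ?mangoldt_ge0.
  rewrite ler_wpM2r //; first by rewrite divr_ge0 ?mangoldt_ge0.
  have [/andP[k0 kN1] /andP[t0 t1]] := (kN, thb k kN).
  have : `|log_defect (N %/ k)| <= 4 by apply: log_defect_le; rewrite divn_gt0.
  have : `|th k * m (N %/ k)| <= 1.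
    by rewrite normrM mulr_ile1 ?norm_mu_sum_le1 // ger0_norm.
  by have := ler_normD (log_defect (N %/ k)) (th k * m (N %/ k)); lra.
have first' : `|log_defect N * ln N%:R| <= 4 * ln N%:R.
  by rewrite normrM (ger0_norm lN) ler_wpM2r // log_defect_le.
rewrite -[X in _ * X](ger0_norm (sqr_ge0 _)) -normrM E /selberg_weight.
under [X in _ <= X + _ + _]eq_bigr do rewrite mulrDl.
rewrite big_split /=.
set S1 := \sum_(_ <= _ < _) (_ * _ * (m _ / _)).
set S2 := \sum_(_ <= _ < _) (_ * (m _ / _)).
set S3 := \sum_(_ <= _ < _) (_ / _ * (log_defect _ + _)) in last *.
set T1 := \sum_(_ <= _ < _) (_ * _ * (`|m _| / _)).
set T2 := \sum_(_ <= _ < _) (_ * (`|m _| / _)).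
have h1 : `|S1| <= T1.
  apply: bnd => k kN; rewrite normrM [X in X * _ <= _]ger0_norm; last first.
    by rewrite mulr_ge0 ?mangoldt_ge0 ?ln_nat_ge0.
  by rewrite [X in _ * X <= _]normrM [X in _ * (_ * X) <= _]ger0_norm ?invr_ge0.
have h2 : `|S2| <= T2.
  apply: bnd => k kN; rewrite normrM [X in X * _ <= _]ger0_norm; last first.
    by apply: sumr_ge0 => d _; rewrite mulr_ge0 ?mangoldt_ge0.
  by rewrite [X in _ * X <= _]normrM [X in _ * (_ * X) <= _]ger0_norm ?invr_ge0.
have := ler_normB (log_defect N * ln N%:R - S1 + S2) S3.
have := ler_normD (log_defect N * ln N%:R - S1) S2.
have := ler_normB (log_defect N * ln N%:R) S1.
lra.
Qed.

(** By Selberg's formula [selberg_weight k] is 2 ln k on average. Partial summation makes the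
    replacement, because n |phi n - phi (n+1)| is at most H(N/n) - H(N/(n+1)) + 1/n, whose sum is
    O(ln N). *)
Lemma mu_sum_log_average N : (0 < N)%N ->
  `|m N| * ln N%:R ^+ 2 <=
  2 * (\sum_(1 <= k < N.+1) ln k%:R / k%:R * `|m (N %/ k)|) + 600 * (1 + ln N%:R).
Proof.
move=> N0; have lN := ln_nat_ge0 R N.
apply: le_trans (mu_sum_selberg N0) _.
pose phi k : R := `|m (N %/ k)| / k%:R.
pose c k : R := selberg_weight k - 2 * ln k%:R.
(* Selberg's formula contributes 130 and the Stirling bound on twice [ln_sum] contributes 2. *)
have cB n : `|\sum_(1 <= k < n.+1) c k| <= 132 * n%:R.
  case: n => [|n]; first by rewrite big_geq // normr0 mulr0.
  have := @selberg R n.+1 isT; have /andP[] := @ln_sum_bounds R n.+1 isT.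
  rewrite /c sumrB -mulr_sumr -/(ln_sum R n.+1) !ler_norml => l1 u1 /andP[l2 u2].
  have := @ln_sub_le R 1 n.+1%:R; rewrite ltr0n ln1 divr1 subr0 => /(_ ltr01 isT) h.
  set s := \sum_(_ <= _ < _) _ in l2 u2 *; set p := n.+1%:R in l1 u1 l2 u2 h *.
  set q := p * ln p in l1 u1; have l2' : - (130 * p) <= s - 2 * q by rewrite /q; lra.
  have u2' : s - 2 * q <= 130 * p by rewrite /q; lra.
  apply/andP; split; lra.
have -> : \sum_(1 <= k < N.+1) selberg_weight k * (`|m (N %/ k)| / k%:R) =
    2 * (\sum_(1 <= k < N.+1) ln k%:R / k%:R * `|m (N %/ k)|) + \sum_(1 <= k < N.+1) c k * phi k.
  by rewrite mulr_sumr -big_split /=; apply: eq_bigr => k _; rewrite /c /phi; ring.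
suff : \sum_(1 <= k < N.+1) c k * phi k <= 132 * (2 * H N).
  by have := harmonic_sum_le R N0; lra.
apply: le_trans (ler_norm _) _; rewrite abel_summation //.
have -> : phi N.+1 = 0 by rewrite /phi divn_small // /mu_sum big_geq // normr0 mul0r.
rewrite mulr0 add0r; apply: le_trans (ler_norm_sum _ _ _) _.
have tel : \sum_(1 <= n < N.+1) (H (N %/ n) - H (N %/ n.+1)) <= H N.
  rewrite -[X in X <= _]opprK -sumrN (eq_bigr (fun n => H (N %/ n.+1) - H (N %/ n))).
    rewrite telescope_sumr // divn_small // divn1 [H 0]/harmonic_sum big_geq //; lra.
  by move=> n _; rewrite opprB.
apply: (@le_trans _ _ (\sum_(1 <= n < N.+1)
    132 * ((H (N %/ n) - H (N %/ n.+1)) + n%:R^-1))); last first.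
  by rewrite -mulr_sumr big_split /= -/(harmonic_sum R N) ler_wpM2l //; lra.
rewrite [leLHS]big_nat [leRHS]big_nat; apply: ler_sum => n /andP[n0 nN].
have nR : 0 < n%:R :> R by rewrite ltr0n.
rewrite normrM; apply: (@le_trans _ _ (132 * n%:R * `|phi n - phi n.+1|)).
  by rewrite ler_wpM2r.
rewrite -mulrA ler_wpM2l // -ler_pdivlMl // /phi.
set u := (N %/ n)%N; set v := (N %/ n.+1)%N.
have vu : (v <= u)%N by rewrite leq_div2l.
have d := mu_sum_sub vu; have mv := norm_mu_sum_le1 R predT v.
have -> : `|m u| / n%:R - `|m v| / n.+1%:R =
    n%:R^-1 * (`|m u| - `|m v|) + n%:R^-1 * n.+1%:R^-1 * `|m v|.
  by rewrite -natr1; field; rewrite natr1 !pnatr_eq0 /=; lia.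
apply: le_trans (ler_normD _ _) _; rewrite [leRHS]mulrDr; apply: lerD.
  rewrite normrM ger0_norm ?invr_ge0 // ler_wpM2l ?invr_ge0 //.
  by apply: le_trans (ler_dist_dist _ _) d.
rewrite ger0_norm ?mulr_ge0 ?invr_ge0 // -mulrA ler_wpM2l ?invr_ge0 //.
rewrite -[leRHS]mulr1; apply: ler_pM => //; rewrite ?invr_ge0 //.
by rewrite lef_pV2 ?posrE ?ltr0n // ler_nat.
Qed.

End Prime_number_theorem.

(** * Small values of the mean of mu(n)/n *)

Section Mobius_mean.
Variable R : realType.
Local Notation m := (mu_sum R predT).
Local Notation H := (harmonic_sum R).

Lemma mu_sum_log_integral N : (0 < N)%N ->
  `|\sum_(1 <= n < N) m n * (ln n.+1%:R - ln n%:R)| <= 4.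
Proof.
move=> N0; have := mu_on_lnV_sum R predT N0; rewrite recip_sum_negn_predT //.
rewrite big_nat_recr //= subrr mulr0 addr0 abel_summation // subrr mulr0 add0r.
rewrite (eq_bigr (fun n => m n * (ln n.+1%:R - ln n%:R))) => [|n _]; last first.
  by congr (_ * _); ring.
rewrite !ler_norml => /andP[l u]; apply/andP; split; lra.
Qed.

Lemma exists_ln_gt (x : R) : exists2 B, (1 < B)%N & x < ln B%:R.
Proof.
exists (Num.truncn (expR x)).+2 => //.
have h : expR x < (Num.truncn (expR x)).+1%:R by rewrite truncnS_gt.
rewrite -ltr_expR lnK ?posrE ?ltr0n //; apply: lt_le_trans h _.
by rewrite ler_nat.
Qed.

Lemma exists_nat_gt (x : R) : exists2 n, (0 < n)%N & x < n%:R.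
Proof. by exists (Num.truncn x).+1 => //; rewrite truncnS_gt. Qed.

(* [m] cannot stay away from [0] on a long multiplicative window: it would keep
   its sign there, contradicting [mu_sum_log_integral]. *)
Lemma mu_sum_small_value (e : R) : 0 < e -> exists T0 B, [/\ (0 < T0)%N, (1 < B)%N &
  forall T, (T0 <= T)%N -> exists2 t, (T <= t <= B * T)%N & `|m t| <= e].
Proof.
(* A constant sign with modulus above e on [T, B T] would give a sum above e ln B > 8, whereas two
   uses of [mu_sum_log_integral] allow at most 4 + 4. *)
move=> e0; have [B B1 hB] := exists_ln_gt (8 / e).
(* Past T0 consecutive values of m differ by less than 2 e, so m cannot jump from above e to below
   -e. *)
have [T0 T00 hT0] := exists_nat_gt (2 * e)^-1.
exists T0, B; split => // T TT0; have T_gt0 : (0 < T)%N by lia.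
apply: contrapT => no.
have big t : (T <= t <= B * T)%N -> e < `|m t|.
  by move=> tT; rewrite ltNge; apply/negP => h; apply: no; exists t.
have TBT : (T <= B * T)%N by rewrite leq_pmull //; lia.
have sgn (s : R) : `|s| = 1 -> e < s * m T ->
    forall d, (T + d <= B * T)%N -> e < s * m (T + d)%N.
  move=> s1 sT; elim=> [|d IH] dT; first by rewrite addn0.
  have {}IH := IH (ltnW _ : is_true (T + d <= B * T)%N).
  have h1 : e < s * m (T + d)%N by apply: IH; lia.
  have h2 : e < `|s * m (T + d).+1|.
    by rewrite normrM s1 mul1r; apply: big; lia.
  have h3 : `|s * m (T + d).+1 - s * m (T + d)%N| <= (T + d).+1%:R^-1.
    rewrite -mulrBr normrM s1 mul1r; apply: le_trans (mu_sum_sub _ _) _ => //.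
    by rewrite harmonic_sumS addrAC subrr add0r.
  have h4 : (T + d).+1%:R^-1 < 2 * e.
    rewrite invf_plt ?posrE ?ltr0n ?mulr_gt0 //; apply: lt_le_trans hT0 _.
    by rewrite ler_nat; lia.
  rewrite addnS; move: h2 h3; rewrite lter_norml lter_normr => /orP[//|h2] /andP[h3 h5].
  exfalso; lrai.
have tot (s : R) : `|s| = 1 -> e < s * m T -> False.
  move=> s1 sT; have := sgn s s1 sT => {}sgn.
  have V1 := @mu_sum_log_integral (B * T)%N; have V2 := mu_sum_log_integral T_gt0.
  have {}V1 := V1 (leq_trans T_gt0 TBT).
  move: V1; rewrite (big_cat_nat _ (n := T)) //=.
  set S1 := \sum_(1 <= _ < T) _ in V2 *; set S2 := \sum_(T <= _ < _) _ => V1.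
  have : 8 < s * S2.
    apply: (@lt_le_trans _ _ (e * ln B%:R)).
      by rewrite -ltr_pdivrMl // mulrC.
    have -> : ln B%:R = \sum_(T <= n < B * T) (ln n.+1%:R - ln n%:R) :> R.
      by rewrite telescope_sumr // natrM lnM ?posrE ?ltr0n ?addrK //; lia.
    rewrite /S2 !mulr_sumr [leLHS]big_nat [leRHS]big_nat; apply: ler_sum => n /andP[Tn nT].
    rewrite mulrA ler_wpM2r //; first by rewrite subr_ge0 ler_ln_nat //; lia.
    by have := sgn (n - T)%N; rewrite subnKC // => /(_ (ltnW nT))/ltW.
  have : `|s * S2| <= 8.
    rewrite normrM s1 mul1r; have := ler_normB (S1 + S2) S1.
    by rewrite [S1 + S2 - S1]addrAC subrr add0r; lra.
  by rewrite ler_norml => /andP[_]; lra.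
have := big T; rewrite leqnn TBT lter_normr => /(_ isT) /orP[h|h].
  by apply: (tot 1); rewrite ?normr1 ?mul1r.
by apply: (tot (-1)); rewrite ?normrN1 ?mulN1r.
Qed.

(** The leading coefficient 1/2 is what matters: it cancels the factor 2 in [mu_sum_log_average]. *)
Lemma sum_ln_over_le N : (0 < N)%N ->
  \sum_(1 <= k < N.+1) ln k%:R / k%:R <= ln N%:R ^+ 2 / 2 + 1 :> R.
Proof.
case: N => // N _.
(* The term (1 - 1/(N+1))/2 absorbs the error of each induction step. *)
suff : \sum_(1 <= k < N.+2) ln k%:R / k%:R <=
    ln N.+1%:R ^+ 2 / 2 + (1 - N.+1%:R^-1) / 2 :> R.
  move/le_trans; apply; rewrite lerD2l.
  by rewrite ler_pdivrMr // mul1r lerBlDr; apply: ler_wpDr; rewrite ?invr_ge0 //; lra.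
elim: N => [|N IH]; first by rewrite big_nat1 ln1 mul0r expr0n mul0r invr1 subrr mul0r addr0.
rewrite big_nat_recr //=; apply: le_trans (lerD IH (lexx _)) _.
set a : R := ln N.+1%:R; set b : R := ln N.+2%:R.
have h1 : N.+2%:R^-1 <= b - a by rewrite lnS_ge.
have h2 : b - a <= N.+1%:R^-1 by rewrite lnS_le.
have h3 : N.+2%:R^-1 * N.+1%:R^-1 = N.+1%:R^-1 - N.+2%:R^-1 :> R.
  have -> : N.+2%:R = N.+1%:R + 1 :> R by rewrite natr1.
  have : 1 <= N.+1%:R :> R by rewrite ler1n.
  by set q : R := N.+1%:R => q1; field; lra.
have h4 : 0 <= N.+2%:R^-1 :> R by rewrite invr_ge0.
have b0 : 0 <= b := ln_nat_ge0 R _; have a0 : 0 <= a := ln_nat_ge0 R _.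
move: h1 h2 h3 h4; set p := N.+2%:R^-1; set q := N.+1%:R^-1 => h1 h2 h3 h4.
have h5 : 0 <= (b - a - p) * (a + b - p) by rewrite mulr_ge0 //; lra.
have h6 : p * p <= p * q by rewrite ler_wpM2l //; lra.
lra.
Qed.

End Mobius_mean.

(** * Improving eventual bounds: the end of the prime number theorem *)

Section Contraction.
Variable R : realType.
Local Notation m := (mu_sum R predT).
Local Notation H := (harmonic_sum R).

Lemma harmonic_sum_sub_le u v : (0 < v <= u)%N -> H u - H v <= (u%:R - v%:R) / v%:R.
Proof.
move=> /andP[v0 vu]; rewrite /harmonic_sum (big_cat_nat _ (n := v.+1)) //= addrAC subrr add0r.
have -> : (u%:R - v%:R) / v%:R = \sum_(v.+1 <= n < u.+1) v%:R^-1 :> R.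
  by rewrite sumr_const_nat subSS -natrB // mulr_natl.
rewrite [leLHS]big_nat [leRHS]big_nat; apply: ler_sum => n /andP[vn _].
by rewrite lef_pV2 ?posrE ?ltr0n ?ler_nat //; lia.
Qed.

Lemma harmonic_sum_sub_ge u v : (v <= u)%N -> (0 < u)%N -> (u%:R - v%:R) / u%:R <= H u - H v.
Proof.
move=> vu u0; rewrite /harmonic_sum (big_cat_nat _ (n := v.+1)) //= addrAC subrr add0r.
have -> : (u%:R - v%:R) / u%:R = \sum_(v.+1 <= n < u.+1) u%:R^-1 :> R.
  by rewrite sumr_const_nat subSS -natrB // mulr_natl.
rewrite [leLHS]big_nat [leRHS]big_nat; apply: ler_sum => n /andP[vn nu].
by rewrite lef_pV2 ?posrE ?ltr0n ?ler_nat //; lia.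
Qed.

Definition mu_sum_small (e : R) n : bool := `|m n| <= 2 * e.

(** A small value at t stays below 2 e on [t, (1 + e) t], because m varies no faster than the
    harmonic sum. The k with N/k in that range fill (x/(1+e), x] for x = N/t, a set of logarithmic
    mass at least e/4. *)
Lemma mu_sum_small_window (e : R) : 0 < e <= 1 -> exists K0 T1 B (c : R),
  [/\ (0 < K0)%N, (0 < T1)%N, (1 < B)%N & 0 < c /\
  forall N K, (K0 <= K)%N -> (K * T1 <= N)%N ->
    c <= \sum_(K.+1 <= k < (K * B).+1) (mu_sum_small e (N %/ k))%:R / k%:R].
Proof.
move=> /andP[e0 e1]; have [T0 [B [T00 B1 HT]]] := mu_sum_small_value e0.
have [K0 K00 hK0] := exists_nat_gt e^-1.
exists K0, (8 * B * T0)%N, (8 * B)%N, (e / 4); split => //; try lia.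
split=> [|N K K0K KN]; first lra.
have K_gt0 : (0 < K)%N by lia.
have KB0 : (0 < K * (8 * B))%N by rewrite !muln_gt0; lia.
(* With t in [T, B T], this choice places N/t between 4 K and 8 B K, so the good k stay inside the
   window; K e >= 1 makes the interval of k long enough to survive rounding. *)
pose T := (N %/ (K * (8 * B))).+1.
have TT0 : (T0 <= T)%N.
  by rewrite /T ltnW // ltnS leq_divRL // mulnC -mulnA.
have [t /andP[Tt tT] mt] := HT T TT0.
have t0 : (0 < t)%N by lia.
have tR : 0 < t%:R :> R by rewrite ltr0n.
set x : R := N%:R / t%:R.
have NT : (N < T * (K * (8 * B)))%N by rewrite /T ltn_ceil.
have TN : (T.-1 * (K * (8 * B)) <= N)%N by rewrite /T /= leq_divM.
have T2 : (K * (8 * B) <= N)%N by apply: leq_trans KN; rewrite leq_mul2l leq_pmulr ?orbT.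
have xK : x < (K * (8 * B))%:R.
  by rewrite /x ltr_pdivrMr // -natrM ltr_nat; nia.
have Kx : 4 * K%:R <= x.
  rewrite /x ler_pdivlMr // -[4]/(4%:R) -!natrM ler_nat; nia.
have Ke : 1 <= K%:R * e.
  rewrite -ler_pdivrMr // mul1r; apply: le_trans (ltW hK0) _; by rewrite ler_nat.
have KR : 0 < K%:R :> R by rewrite ltr0n.
have x0 : 0 < x by lra.
pose k0 := Num.truncn (x / (1 + e)); pose k1 := (N %/ t)%N.
have xe0 : 0 <= x / (1 + e) by rewrite divr_ge0 //; lra.
have /andP[k0l k0u] : k0%:R <= x / (1 + e) < k0.+1%:R by rewrite /k0 truncn_itv.
have k1l : k1%:R <= x := divn_le_div R N t0.
have k1u : x < k1%:R + 1 := div_lt_divnS R N t0.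
have k1t : (k1 * t <= N)%N by rewrite leq_divM.
have xt : x * t%:R = N%:R by rewrite divfK // gt_eqF.
clearbody k0 k1 x T.
have xe : x / (1 + e) <= x - x * e / 2.
  rewrite ler_pdivrMr; last lra.
  have : 0 <= x * e * (1 - e) by rewrite !mulr_ge0 //; lra.
  lra.
have xe4 : 4 <= x * e by have : 4 * K%:R * e <= x * e; [rewrite ler_wpM2r //; lra | lra].
have k01 : k0%:R < k1%:R :> R by lra.
have {}k01 : (k0 < k1)%N by rewrite -(ltr_nat R).
have Kk0 : (K <= k0)%N.
  rewrite -ltnS -(ltr_nat R); apply: le_lt_trans k0u.
  rewrite ler_pdivlMr; last lra.
  have : K%:R * (1 + e) <= K%:R * 2 by rewrite ler_wpM2l //; lra.
  lra.
have k1K : (k1 <= K * (8 * B))%N by rewrite -(ler_nat R) (le_trans k1l) // ltW.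
clear NT TN T2 KN TT0 HT tT Tt KB0 xK hK0.
have good k : (k0 < k <= k1)%N -> `|m (N %/ k)| <= 2 * e.
  move=> /andP[k0k kk1]; have k_0 : (0 < k)%N := leq_ltn_trans (leq0n _) k0k.
  set n := (N %/ k)%N.
  have tn : (t <= n)%N by rewrite /n leq_divRL // mulnC (leq_trans _ k1t) // leq_mul2r kk1 orbT.
  have nt : n%:R <= (1 + e) * t%:R.
    apply: le_trans (divn_le_div R N k_0) _; rewrite ler_pdivrMr ?ltr0n //.
    have : x / (1 + e) <= k%:R by apply: le_trans (ltW k0u) _; rewrite ler_nat.
    rewrite ler_pdivrMr; last lra.
    move/(ler_wpM2r (ltW tR)); lra.
  have := mu_sum_sub R tn; have tn0 : (0 < t <= n)%N by rewrite t0.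
  have := harmonic_sum_sub_le tn0; have : (n%:R - t%:R) / t%:R <= e.
    by rewrite ler_pdivrMr //; lra.
  by have := ler_normD (m n - m t) (m t); rewrite subrK; lra.
move: k1K; set L := (K * (8 * B))%N; clearbody L => k1K.
have k0L : (k0.+1 <= L.+1)%N by rewrite ltnS (leq_trans (ltnW k01)).
have Kk0' : (K.+1 <= k0.+1)%N by [].
have k1L : (k1.+1 <= L.+1)%N by [].
have k01' : (k0.+1 <= k1.+1)%N by rewrite ltnW.
rewrite (big_cat_nat Kk0' k0L) /= [X in _ + X](big_cat_nat k01' k1L) /=.
have pos a b : 0 <= \sum_(a <= k < b) (mu_sum_small e (N %/ k))%:R / k%:R :> R.
  by apply: sumr_ge0 => k _; rewrite divr_ge0.
apply: ler_wpDl => //; apply: ler_wpDr => //.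
have -> : \sum_(k0.+1 <= k < k1.+1) (mu_sum_small e (N %/ k))%:R / k%:R = H k1 - H k0.
  rewrite /harmonic_sum [X in _ = X - _](big_cat_nat _ (n := k0.+1)) //=.
  rewrite addrAC subrr add0r; apply: eq_big_nat => k kk.
  by rewrite /mu_sum_small good ?div1r.
have k10 : (0 < k1)%N := leq_ltn_trans (leq0n _) k01.
apply: le_trans (harmonic_sum_sub_ge (ltnW k01) k10).
have k1R : 0 < k1%:R :> R by rewrite ltr0n.
rewrite ler_pdivlMr //; have : k1%:R * e <= x * e by rewrite ler_wpM2r // ltW.
lra.
Qed.

(** The disjoint windows (K0 B^J, K0 B^(J+1)] each carry mass c with weight ln k >= J ln B; summing
    over J < I, with I ln B at least about ln N / 2, gives a multiple of ln^2 N. *)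
Lemma mu_sum_small_mass (e : R) : 0 < e <= 1 -> exists (c : R) N1, 0 < c /\
  forall N, (N1 <= N)%N -> c * ln N%:R ^+ 2 <=
    \sum_(1 <= k < N.+1) ln k%:R / k%:R * (mu_sum_small e (N %/ k))%:R.
Proof.
move=> e01; have [K0 [T1 [B [c [K00 T10 B1 [c0 HW]]]]]] := mu_sum_small_window e01.
have lB : 0 < ln B%:R :> R by rewrite ln_gt0 // ltr1n.
pose D : R := ln (K0 * T1)%:R + 2 * ln B%:R.
have [N1 N10 hN1] := exists_ln_gt (2 * D).
have N2_0 : (0 < maxn N1 (K0 * T1))%N by lia.
exists (c / (8 * ln B%:R)), (maxn N1 (K0 * T1)); split.
  by rewrite divr_gt0 // mulr_gt0.
move=> N; rewrite geq_max => /andP[NN1 NKT].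
have KT0 : (0 < K0 * T1)%N by rewrite muln_gt0 K00.
have N0 : (0 < N)%N by lia.
pose S M := \sum_(1 <= k < M.+1) ln k%:R / k%:R * (mu_sum_small e (N %/ k))%:R : R.
have term_ge0 k : 0 <= ln k%:R / k%:R * (mu_sum_small e (N %/ k))%:R :> R.
  by rewrite !mulr_ge0 ?ln_nat_ge0 ?invr_ge0.
pose I := trunc_log B (N %/ (K0 * T1)).
have NKT0 : (0 < N %/ (K0 * T1))%N by rewrite divn_gt0.
have /andP[IN NI] := trunc_log_bounds B1 NKT0; rewrite -/I in IN NI.
have NltB : (N < B ^ I.+1 * (K0 * T1))%N by rewrite -ltn_divLR.
have BIN : (B ^ I * (K0 * T1) <= N)%N by rewrite -leq_divRL.
clearbody I.
have B_gt0 n : (0 < B ^ n)%N by rewrite expn_gt0 (ltnW B1).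
have lnB n : ln (B ^ n)%:R = n%:R * ln B%:R :> R.
  by rewrite natrX lnXn ?mulr_natl // ltr0n ltnW.
have win J : (J <= I)%N -> c * ln B%:R * (J%:R * (J%:R - 1) / 2) <= S (K0 * B ^ J)%N.
  elim: J => [|J IH] JI; first by rewrite mul0r mul0r mulr0 sumr_ge0.
  have {}IH := IH (ltnW JI).
  have KJ : (K0 * B ^ J * T1 <= N)%N.
    by apply: leq_trans BIN; rewrite mulnAC mulnC leq_mul2r leq_pexp2l ?orbT // ltnW // ltnW.
  have := HW N (K0 * B ^ J)%N (leq_pmulr _ (B_gt0 J)) KJ.
  rewrite -mulnA -expnSr => hw.
  have KK : (K0 * B ^ J <= K0 * B ^ J.+1)%N.
    by rewrite leq_mul2l leq_exp2l // leqnSn orbT.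
  rewrite /S (big_cat_nat (n := (K0 * B ^ J).+1)) //= -/(S _).
  have h : c * (J%:R * ln B%:R) <=
      \sum_((K0 * B ^ J).+1 <= k < (K0 * B ^ J.+1).+1)
        ln k%:R / k%:R * (mu_sum_small e (N %/ k))%:R.
    have J0 : (0 : R) <= J%:R * ln B%:R by apply: mulr_ge0 => //; apply: ltW.
    apply: (le_trans (ler_wpM2r J0 hw)); rewrite mulr_suml.
    rewrite [leLHS]big_nat [leRHS]big_nat; apply: ler_sum => k /andP[kJ _].
    have -> : ln k%:R / k%:R * (mu_sum_small e (N %/ k))%:R =
        (mu_sum_small e (N %/ k))%:R / k%:R * ln k%:R :> R by ring.
    rewrite ler_wpM2l ?divr_ge0 // -lnB ler_ln_nat //.
    by apply: leq_trans (ltnW kJ); rewrite leq_pmull.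
  apply: le_trans (lerD IH h); rewrite -natr1.
  move: (J%:R : R) (ln B%:R) => p q.
  lra.
have KBN : (K0 * B ^ I <= N)%N.
  by apply: leq_trans BIN; rewrite mulnA [(B ^ I * K0)%N]mulnC leq_pmulr.
apply: (@le_trans _ _ (S (K0 * B ^ I)%N)); last first.
  by rewrite [leRHS](big_cat_nat (n := (K0 * B ^ I).+1)) //= lerDl sumr_ge0.
apply: le_trans (win I (leqnn I)).
have lN : ln N%:R <= ln (K0 * T1)%:R + (I%:R + 1) * ln B%:R :> R.
  have -> : I%:R + 1 = I.+1%:R :> R by rewrite natr1.
  rewrite -lnB addrC -lnM ?posrE ?ltr0n // -natrM.
  by apply: ler_ln_nat => //; apply: ltnW.
have lD : 2 * D < ln N%:R.
  by apply: lt_le_trans hN1 _; apply: ler_ln_nat => //; apply: ltnW.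
have lK : (0 : R) <= ln (K0 * T1)%:R := ln_nat_ge0 R _.
have h1 : ln N%:R / 2 <= (I%:R - 1) * ln B%:R :> R by rewrite ler_pdivrMr //; rewrite /D in lD; lra.
have h2 : ln N%:R / 2 <= I%:R * ln B%:R :> R by lra.
have lN0 := ln_nat_ge0 R N.
have h3 : ln N%:R / 2 * (ln N%:R / 2) <= (I%:R - 1) * ln B%:R * (I%:R * ln B%:R) :> R.
  by apply: ler_pM => //; rewrite divr_ge0.
have -> : c / (8 * ln B%:R) * ln N%:R ^+ 2 =
    c / (2 * ln B%:R) * (ln N%:R / 2 * (ln N%:R / 2)) by field; rewrite gt_eqF.
have -> : c * ln B%:R * (I%:R * (I%:R - 1) / 2) =
    c / (2 * ln B%:R) * ((I%:R - 1) * ln B%:R * (I%:R * ln B%:R)) by field; rewrite gt_eqF.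
by rewrite ler_wpM2l // divr_ge0 ?mulr_ge0 // ltW.
Qed.

Definition eventually_le (b : R) := exists N0, forall N, (N0 <= N)%N -> `|m N| <= b.

(** The real inequality behind [mu_sum_contraction], with l = ln N and M = |m(N)|. For the weights
    ln k / k: S1 is the mass of the k for which the bound b is not yet available at N/k, S2 the sum
    of |m(N/k)|, S3 the total mass and S4 the mass of small values. *)
Lemma contraction_arith (b e c A l M S1 S2 S3 S4 : R) :
  0 <= b -> 0 < e -> 0 < c -> 0 <= A -> b <= 1 ->
  1 + (2 + 2 * (1 + A) + 1200) / (2 * e * c) < l ->
  S1 <= l * (1 + A) -> S2 <= b * S3 - 2 * e * S4 + S1 -> S3 <= l ^+ 2 / 2 + 1 ->
  c * l ^+ 2 <= S4 -> M * l ^+ 2 <= 2 * S2 + 600 * (1 + l) -> M <= b - 2 * e * c.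
Proof.
move=> b0 e0 c0 A0 b1 hl h1 h2 h3 h4 main.
set D := 2 + 2 * (1 + A) + 1200 in hl; have D0 : 0 < D by rewrite /D; lra.
have ec : 0 < 2 * e * c by rewrite !mulr_gt0.
have l1 : 1 < l by apply: le_lt_trans hl; rewrite lerDl divr_ge0 // ltW.
have q3 : D * l <= 2 * e * c * l ^+ 2.
  rewrite expr2 mulrA ler_wpM2r //; first by apply: le_trans (ltW l1).
  by rewrite -ler_pdivrMl // mulrC; apply: le_trans (ltW hl); rewrite lerDr.
have l2 : 0 < l ^+ 2 by rewrite exprn_gt0 //; lra.
rewrite -(ler_pM2r l2); apply: (le_trans main).
have q1 : b * S3 <= b * (l ^+ 2 / 2 + 1) by rewrite ler_wpM2l.
have q2 : e * (c * l ^+ 2) <= e * S4 by rewrite ler_wpM2l // ltW.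
have q4 : (1 + A) * 1 <= (1 + A) * l by rewrite ler_wpM2l //; lra.
move: q3; rewrite /D; clear - b1 l1 q1 q2 q4 h1 h2; lra.
Qed.

(** The gain depends on e and not on b, so finitely many iterations suffice. Since 4 e <= b, a small
    value, at most 2 e, undercuts b by at least 2 e. *)
Lemma mu_sum_contraction (e : R) : 0 < e <= 1 -> exists2 kappa, 0 < kappa &
  forall b, 4 * e <= b <= 1 -> eventually_le b -> eventually_le (b - kappa).
Proof.
move=> e01; have [c [N1 [c0 hc]]] := mu_sum_small_mass e01.
have /andP[e0 e1] := e01.
(* The small values save 4 e c ln^2 N in total; half of it pays for the terms of order ln N. *)
exists (2 * e * c) => [|b /andP[be b1] [n0 hn0]]; first by rewrite !mulr_gt0.
have n0' : 0 <= ln n0.+1%:R :> R := ln_nat_ge0 R _.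
pose D : R := 2 + 2 * (1 + ln n0.+1%:R) + 1200.
have D0 : 0 < D by rewrite /D; lra.
have [N2 N21 hN2] := exists_ln_gt (1 + D / (2 * e * c)).
exists (maxn N1 (maxn N2 n0.+1)) => N; rewrite !geq_max => /and3P[NN1 NN2 Nn0].
have N0 : (0 < N)%N by lia.
have lN : 1 + D / (2 * e * c) < ln N%:R by apply: lt_le_trans hN2 _; rewrite ler_ln_nat // ltnW.
have lN1 : 1 < ln N%:R :> R.
  by apply: le_lt_trans lN; rewrite lerDl divr_ge0 ?mulr_ge0 // ltW.
have big_k : \sum_(1 <= k < N.+1) ln k%:R / k%:R * (N %/ k < n0.+1)%N%:R <=
    ln N%:R * (1 + ln n0.+1%:R) :> R.
  apply: (@le_trans _ _ (ln N%:R * (H N - H (N %/ n0.+1)))).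
    rewrite /harmonic_sum [X in _ * (X - _)](big_cat_nat (n := (N %/ n0.+1).+1)) //=; last first.
      by rewrite ltnS leq_div.
    rewrite addrAC subrr add0r (big_cat_nat (n := (N %/ n0.+1).+1)) //=; last first.
      by rewrite ltnS leq_div.
    rewrite [X in X + _]big_nat [X in X + _]big1 ?add0r => [|k /andP[k0]]; last first.
      rewrite ltnS leq_divRL // => kn; rewrite ltnNge leq_divRL // [(n0.+1 * k)%N]mulnC.
      by rewrite kn mulr0.
    rewrite mulr_sumr [leLHS]big_nat [leRHS]big_nat; apply: ler_sum => k /andP[kn kN].
    have k0 : (0 < k)%N := leq_ltn_trans (leq0n _) kn.
    apply: (@le_trans _ _ (ln k%:R / k%:R)).
      by rewrite ler_piMr ?lern1 ?leq_b1 // divr_ge0 // ln_nat_ge0.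
    by rewrite ler_wpM2r ?invr_ge0 // ler_ln_nat.
  rewrite ler_wpM2l ?ln_nat_ge0 //.
  have := harmonic_sum_le R N0; have := harmonic_sum_ge R (N %/ n0.+1).
  have : ln N%:R <= ln (N %/ n0.+1).+1%:R + ln n0.+1%:R :> R.
    rewrite -lnM ?posrE ?ltr0n // -natrM; apply: ler_ln_nat => //.
    by apply: ltnW; apply: ltn_ceil.
  lra.
have pt k : (1 <= k < N.+1)%N -> ln k%:R / k%:R * `|m (N %/ k)| <=
    b * (ln k%:R / k%:R) - 2 * e * (ln k%:R / k%:R * (mu_sum_small e (N %/ k))%:R) +
    ln k%:R / k%:R * (N %/ k < n0.+1)%N%:R.
  move=> /andP[k0 kN]; have L0 : 0 <= ln k%:R / k%:R :> R by rewrite divr_ge0 ?ln_nat_ge0.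
  set L := ln k%:R / k%:R in L0 *.
  have -> : b * L - 2 * e * (L * (mu_sum_small e (N %/ k))%:R) + L * (N %/ k < n0.+1)%N%:R =
      L * (b - 2 * e * (mu_sum_small e (N %/ k))%:R + (N %/ k < n0.+1)%N%:R) by ring.
  rewrite ler_wpM2l //; have := norm_mu_sum_le1 R predT (N %/ k).
  have [|sm] := boolP (mu_sum_small e (N %/ k)).
    by rewrite /mu_sum_small => sm _; case: ltnP => _; rewrite ?mulr1 ?mulr1n ?mulr0n; lra.
  by case: ltnP => [_|/ltnW/hn0 h _]; rewrite ?mulr0 ?mulr0n ?mulr1n; lra.
have main := mu_sum_log_average R N0.
have sumpt : \sum_(1 <= k < N.+1) ln k%:R / k%:R * `|m (N %/ k)| <=
    b * (\sum_(1 <= k < N.+1) ln k%:R / k%:R)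
    - 2 * e * (\sum_(1 <= k < N.+1) ln k%:R / k%:R * (mu_sum_small e (N %/ k))%:R)
    + \sum_(1 <= k < N.+1) ln k%:R / k%:R * (N %/ k < n0.+1)%N%:R.
  rewrite !mulr_sumr -sumrB -big_split /= [leLHS]big_nat [leRHS]big_nat.
  exact: ler_sum.
have s1 := sum_ln_over_le R N0; have s2 := hc N NN1.
move: big_k sumpt s1 s2 main; rewrite /D in lN.
by apply: contraction_arith => //; lra.
Qed.

Lemma mu_sum_cvg0 (e : R) : 0 < e -> eventually_le e.
Proof.
move=> e0; wlog e1 : e e0 / e <= 1 => [hw|].
  have [e1|e1] := leP e 1; first exact: hw.
  by exists 0%N => N _; apply: le_trans (norm_mu_sum_le1 R _ _) (ltW e1).
have e4 : 0 < e / 4 <= 1 by apply/andP; split; lra.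
have [kappa k0 hk] := mu_sum_contraction e4.
have [J J0 hJ] := exists_nat_gt kappa^-1.
have it j : eventually_le e \/ (e <= 1 - j%:R * kappa /\ eventually_le (1 - j%:R * kappa)).
  elim: j => [|j [|[ej hj]]]; [right| by left |].
    by rewrite mul0r subr0; split=> //; exists 0%N => N _; apply: norm_mu_sum_le1.
  have jk : 0 <= j%:R * kappa by rewrite mulr_ge0 // ltW.
  have := hk (1 - j%:R * kappa); rewrite mulrC divfK // => /(_ _ hj).
  have -> : 1 - j%:R * kappa - kappa = 1 - j.+1%:R * kappa by rewrite -natr1; ring.
  move=> h; have {}h := h ltac:(apply/andP; split; lra).
  have [le|/ltW le] := leP e (1 - j.+1%:R * kappa); first by right.
  by left; case: h => N0 hN0; exists N0 => N /hN0 hN; apply: le_trans le.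
case: (it J) => // -[h _]; exfalso.
have : 1 < J%:R * kappa by rewrite -ltr_pdivrMr // mul1r.
lra.
Qed.


End Contraction.

(** * Decay of the rough and smooth Moebius sums *)

Section Rough_smooth.
Variable R : realType.
Local Notation mu := (mu R).
Local Notation mu_on := (mu_on R).
Local Notation mu_sum := (mu_sum R).
Local Notation recip_sum := (recip_sum R).
Local Notation mangoldt := (mangoldt R).
Local Notation mangoldt_sum := (mangoldt_sum R).

Lemma roughP z n : (0 < n)%N ->
  reflect (forall p, prime p -> (p %| n)%N -> (z < p)%N) ((rough z).-nat n).
Proof.
move=> n0; apply: (iffP (pnatP _ n0)) => h p pp pn.
  by have := h p pp pn; rewrite !inE /= -ltnNge.
by rewrite !inE /= -ltnNge h.
Qed.

Lemma smoothP z n : (0 < n)%N ->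
  reflect (forall p, prime p -> (p %| n)%N -> (p <= z)%N) ((smooth z).-nat n).
Proof. by move=> n0; apply: (iffP (pnatP _ n0)) => h p pp pn; have := h p pp pn; rewrite inE. Qed.

Lemma rough0 n : (0 < n)%N -> (rough 0).-nat n.
Proof. by move=> n0; apply/roughP => // p /prime_gt0. Qed.

Lemma roughS z n : (0 < n)%N ->
  (rough z).-nat n = (rough z.+1).-nat n || ((rough z).-nat n && prime z.+1 && (z.+1 %| n)%N).
Proof.
move=> n0; apply/idP/orP => [nz|[/roughP h|/andP[/andP[//]]]]; last first.
  by apply/roughP => // p pp pn; rewrite ltnW // h.
have [/andP[pz zn]|no] := boolP (prime z.+1 && (z.+1 %| n)%N); first by right; rewrite nz pz.
left; apply/roughP => // p pp pn; have /roughP -/(_ n0 p pp pn) := nz.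
by rewrite leq_eqVlt => /orP[/eqP zp|//]; move: no; rewrite zp pp pn.
Qed.

Lemma roughS_ndvd z n : (0 < n)%N -> prime z.+1 -> (z.+1 %| n)%N -> (rough z.+1).-nat n = false.
Proof.
move=> n0 pz zn; apply/negP => /roughP -/(_ n0 _ pz zn).
by rewrite ltnn.
Qed.

Lemma rough_mu_sumS z N :
  mu_sum (rough z) N = mu_sum (rough z.+1) N -
    (prime z.+1)%:R / z.+1%:R * mu_sum (rough z.+1) (N %/ z.+1).
Proof.
have [pz|npz] := boolP (prime z.+1); last first.
  rewrite mul0r mul0r subr0; apply: eq_big_nat => n /andP[n0 _].
  by rewrite /mu_on (roughS z n0) (negPf npz) andbF /= orbF.
rewrite mul1r.
have -> : mu_sum (rough z) N = mu_sum (rough z.+1) N +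
    \sum_(1 <= n < N.+1 | (z.+1 %| n)%N) mu_on (rough z) n / n%:R.
  rewrite [X in _ + X]big_mkcond -big_split /=; apply: eq_big_nat => n /andP[n0 _].
  case: ifPn => zn; rewrite /mu_on.
    by rewrite [(rough z.+1).-nat n]roughS_ndvd // mul0r add0r.
  by rewrite (roughS z n0) (negPf zn) andbF orbF addr0.
rewrite sum_multiples // -mulNr; congr (_ + _).
rewrite /mu_sum mulr_sumr; apply: eq_big_nat => k /andP[k0 _].
rewrite natrM invfM; suff -> : mu_on (rough z) (z.+1 * k) = - mu_on (rough z.+1) k by ring.
rewrite /mu_on pnatM rough_prime // ltnSn /= (roughS z k0) pz andbT.
have [zk|zk] := boolP (z.+1 %| k)%N; last by rewrite andbF orbF; case: ifP; rewrite ?oppr0 // mu_prime_mul.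
rewrite roughS_ndvd // oppr0 (mu_square _ pz) ?if_same //.
by rewrite expnS expn1 dvdn_pmul2l.
Qed.

(** By [rough_mu_sumS], with p = z + 1 prime, the p-rough sum at N is the z-rough sum at N plus 1/p
    <= 1/2 times the p-rough sum at N/p. A bound B for large N thus improves to e/4 + B/2, and
    iterating gives e/2 + 2^(-j). *)
Lemma rough_mu_sum_cvg0 z (e : R) : 0 < e ->
  exists N0, forall N, (N0 <= N)%N -> `|mu_sum (rough z) N| <= e.
Proof.
elim: z e => [|z IH] e e0.
  have [N0 hN0] := mu_sum_cvg0 e0; exists N0 => N /hN0.
  suff -> : mu_sum (rough 0) N = mu_sum predT N by [].
  by apply: eq_big_nat => n /andP[n0 _]; rewrite /mu_on rough0 // pnat_predT.
have [pz|npz] := boolP (prime z.+1); last first.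
  have [N0 hN0] := IH e e0; exists N0 => N /hN0.
  by rewrite rough_mu_sumS (negPf npz) !mul0r subr0.
have e4 : 0 < e / 4 by lra.
have [N1 hN1] := IH (e / 4) e4.
have it j : exists N0, forall N, (N0 <= N)%N -> `|mu_sum (rough z.+1) N| <= e / 2 + (2 ^- j).
  elim: j => [|j [N0 hN0]].
    exists 0%N => N _; apply: le_trans (norm_mu_sum_le1 R _ _) _.
    by rewrite expr0 invr1; lra.
  exists (maxn N1 (N0 * z.+1)%N) => N; rewrite geq_max => /andP[NN1 NN0].
  have h1 := hN1 N NN1; have h2 := hN0 (N %/ z.+1)%N ltac:(by rewrite leq_divRL).
  move: h1; rewrite rough_mu_sumS pz mul1r => h1.
  set a := mu_sum _ N in h1 *; set b := mu_sum _ (N %/ _) in h1 h2.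
  have h3 : `|z.+1%:R^-1 * b| <= 2^-1 * (e / 2 + 2 ^- j).
    rewrite normrM ger0_norm ?invr_ge0 //; apply: ler_pM; rewrite ?invr_ge0 //.
    by rewrite lef_pV2 ?posrE ?ltr0n // ler_nat prime_gt1.
  have := ler_normD (a - z.+1%:R^-1 * b) (z.+1%:R^-1 * b); rewrite subrK => h4.
  rewrite exprS invfM; move: h3 h4; move: (2 ^- j : R) => y h3 h4.
  move: h1 h3 h4; move: `|_ - _| `|_ * b| `|a| => u v w; lra.
have [j j0 hj] := exists_nat_gt (2 / e).
have [N0 hN0] := it j; exists N0 => N /hN0 /le_trans; apply.
suff : 2 ^- j <= e / 2 by lra.
have : (j%:R : R) <= 2 ^+ j by rewrite -natrX ler_nat ltnW // ltn_expl.
move=> h; rewrite -[e / 2]invrK invf_div lef_pV2 ?posrE ?exprn_gt0 ?divr_gt0 //.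
by apply: le_trans (ltW hj) h.
Qed.

Lemma norm_mu_sum_step pi n : `|\sum_(1 <= k < n) mu_on pi k / k%:R| <= 1.
Proof. by case: n => [|n]; [rewrite big_geq ?normr0 | apply: norm_mu_sum_le1]. Qed.

Lemma sum_norm_mu_on_le pi N :
  \sum_(1 <= n < N.+1) `|mu_on pi n| / n%:R <= recip_sum pi N.
Proof.
apply: ler_sum => n _; rewrite ler_wpM2r ?invr_ge0 // /mu_on.
by case: ifP => _; rewrite ?normr0 ?norm_mu_le1.
Qed.

(* By [mu_on_ln_sum'] and Mertens' theorem, up to [O(recip_sum)] the left-hand side
   is the sum of [mu n / n] with the monotone weights
   [Num.min (ln z) (ln (N / n))], to which [abel_le] applies. *)
Lemma rough_mu_sum_log_le z N : (0 < z)%N -> (0 < N)%N ->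
  `|mu_sum (rough z) N| * ln N%:R <= ln z%:R + 19 * recip_sum (rough z) N.
Proof.
move=> z0 N0; have lN := ln_nat_ge0 R N; have lz := ln_nat_ge0 R z.
pose phi n : R := Num.min (ln z%:R) (ln N%:R - ln n%:R).
pose th n : R := ln N%:R - ln n%:R - mangoldt_rough_sum R z (N %/ n) - phi n.
have E : mu_sum (rough z) N * ln N%:R =
    \sum_(1 <= n < N.+1) mu_on (rough z) n / n%:R * phi n +
    \sum_(1 <= n < N.+1) mu_on (rough z) n / n%:R * th n.
  transitivity (\sum_(1 <= n < N.+1) mu_on (rough z) n / n%:R * (ln N%:R - ln n%:R) +
      \sum_(1 <= n < N.+1) mu_on (rough z) n * ln n%:R / n%:R).
    by rewrite mulr_suml -big_split /=; apply: eq_bigr => n _; ring.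
  rewrite mu_on_ln_sum' -sumrN -!big_split /=; apply: eq_bigr => n _.
  by rewrite /th /mangoldt_rough_sum; ring.
have h1 : `|\sum_(1 <= n < N.+1) mu_on (rough z) n / n%:R * phi n| <= ln z%:R.
  have phiN : phi N = 0 by rewrite /phi subrr; apply/min_idPr.
  rewrite big_nat_recr //= phiN mulr0 addr0.
  apply: le_trans (abel_le (C := 1) N0 _ _ _) _; rewrite ?phiN //.
  - move=> n /andP[n0 nN]; rewrite /phi; apply: le_min2 => //.
    by rewrite lerD2l lerN2 ler_ln_nat.
  - by move=> n _; apply: norm_mu_sum_step.
  by rewrite mul1r /phi ge_min lexx.
(* The rough Mertens sum up to N/n is about max(0, ln (N/n) - ln z), which makes [phi] the minimum;
   19 is 18 from [mangoldt_rough_sum_large] plus 1 for rounding. *)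
have thb n : (1 <= n < N.+1)%N -> `|th n| <= 19.
  move=> /andP[n0]; rewrite ltnS => nN; have nR : 0 < n%:R :> R by rewrite ltr0n.
  have NR : 0 < N%:R :> R by rewrite ltr0n.
  have s0 : (0 < N %/ n)%N by rewrite divn_gt0.
  have sR : 1 <= (N %/ n)%:R :> R by rewrite ler1n.
  have l2 := divn_le_div R N n0; have u2 := div_lt_divnS R N n0.
  rewrite /th /phi -ln_div ?posrE //; have [zs|sz] := leqP z (N %/ n)%N.
    have zNn : ln z%:R <= ln (N%:R / n%:R) :> R.
      rewrite ler_ln ?posrE ?ltr0n ?divr_gt0 //; apply: le_trans l2.
      by rewrite ler_nat.
    rewrite min_l //.
    have := @mangoldt_rough_sum_large R z (N %/ n) ltac:(by rewrite z0 zs).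
    have l3 : 0 <= ln (N%:R / n%:R) - ln (N %/ n)%:R :> R.
      by rewrite subr_ge0 ler_ln ?posrE ?divr_gt0 // ltr0n.
    have u3 : ln (N%:R / n%:R) - ln (N %/ n)%:R <= 1 :> R.
      apply: le_trans (ln_sub_le _ _) _; rewrite ?divr_gt0 ?ltr0n //.
      by rewrite ler_pdivrMr ?ltr0n // mul1r; lra.
    move: l3 u3; move: (ln (_ / _)) => a l3 u3; rewrite !ler_norml => /andP[l4 u4].
    apply/andP; split; lra.
  rewrite mangoldt_rough_sum_small ?(ltnW sz) // subr0 min_r ?subrr ?normr0 //.
  rewrite ler_ln ?posrE ?ltr0n ?divr_gt0 //; apply: le_trans (ltW u2) _.
  by rewrite natr1 ler_nat.
have h2 : `|\sum_(1 <= n < N.+1) mu_on (rough z) n / n%:R * th n| <= 19 * recip_sum (rough z) N.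
  apply: le_trans (ler_norm_sum _ _ _) _.
  apply: (@le_trans _ _ (19 * \sum_(1 <= n < N.+1) `|mu_on (rough z) n| / n%:R)).
    rewrite mulr_sumr [leLHS]big_nat [leRHS]big_nat; apply: ler_sum => n nN.
    rewrite normrM mulrC normrM [X in _ * (_ * X) <= _]ger0_norm ?invr_ge0 //.
    by rewrite ler_wpM2r ?thb // divr_ge0.
  by rewrite ler_wpM2l // sum_norm_mu_on_le.
rewrite -[X in _ * X](ger0_norm lN) -normrM E; apply: le_trans (ler_normD _ _) _.
exact: lerD.
Qed.

(** In [mu_sum_log] the smooth part of mangoldt(k)/k has mass at most ln z + 10, so bounding each
    Moebius sum by 1 is already enough. *)
Lemma smooth_mu_sum_log_le z N : (0 < z)%N -> (0 < N)%N ->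
  `|mu_sum (smooth z) N| * ln N%:R <= ln z%:R + 13 + recip_sum (rough z) N.
Proof.
move=> z0 N0; have lN := ln_nat_ge0 R N.
have := mu_sum_log R (smooth z) N0; rewrite -/(rough z).
have := mangoldt_smooth_sum R N z0; have := recip_sum_ge0 R (rough z) N.
set S := \sum_(_ <= _ < _) _ / _ * _; set T := \sum_(_ <= _ < _) _ => r0 hT hS.
have ST : `|S| <= T.
  apply: le_trans (ler_norm_sum _ _ _) _; apply: ler_sum => k _.
  rewrite normrM ger0_norm ?divr_ge0 ?mangoldt_on_ge0 //.
  by rewrite ler_piMr ?norm_mu_sum_le1 // divr_ge0 ?mangoldt_on_ge0.
rewrite -[X in _ * X](ger0_norm lN) -normrM.
move: hS ST; rewrite !ler_norml => /andP[l1 u1] /andP[l2 u2].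
apply/andP; split; lra.
Qed.

Lemma ln_nat_ge_half n : (2 <= n)%N -> 1 / 2 <= ln n%:R :> R.
Proof.
move=> n2; apply: (@le_trans _ _ (ln 2%:R)); last by apply: ler_ln_nat.
by have := @ln_sub_ge R 1 2; rewrite ln1 !subr0 => h; have := h ltac:(lra) ltac:(lra); lra.
Qed.

(** [h] stands for the modulus of a rough or a smooth sum; the hypothesis is weak enough to follow
    from both estimates above. *)
Lemma mu_sum_decay (h : R) z N : (2 <= z <= N)%N ->
  h * ln N%:R <= ln z%:R + 13 + 19 * recip_sum (rough z) N ->
  h <= ln z%:R / ln N%:R + 100 / ln z%:R.
Proof.
move=> /andP[z2 zN] hh.
have lz := ln_nat_ge_half z2; have lN := ln_nat_ge_half (leq_trans z2 zN).
have lzN : ln z%:R <= ln N%:R :> R by apply: ler_ln_nat => //; lia.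
have N0 : (0 < N)%N by lia.
have r := @recip_sum_rough_le R z N z2 N0.
move: hh r; set r := recip_sum _ _; set a := ln z%:R in lz lzN *; set b := ln N%:R in lN lzN *.
have a0 : 0 < a by lra.
have b0 : 0 < b by lra.
move=> hh; rewrite ler_pdivlMr // => hr.
have -> : a / b + 100 / a = (a + 100 * b / a) / b by field; rewrite !gt_eqF.
rewrite ler_pdivlMr //; apply: (le_trans hh).
suff : (13 + 19 * r) * a <= 100 * b by rewrite -ler_pdivlMr //; lra.
lra.
Qed.

Lemma mangoldt_prime p : prime p -> mangoldt p = ln p%:R.
Proof.
move=> pp; have p0 := prime_gt0 pp; rewrite -sum_mangoldt_divisors //.
rewrite (sum_single (i := p)) ?p0 ?ltnSn // => d _ dp ndp.
have /primeP[_ /(_ d dp)] := pp; rewrite (negPf ndp) orbF => /eqP ->.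
exact: mangoldt1.
Qed.

End Rough_smooth.

(** * Sums over primes and Buchstab's identity *)

Section Prime_sums.
Variable R : realType.
Local Notation mu := (mu R).
Local Notation mu_on := (mu_on R).
Local Notation mu_sum := (mu_sum R).
Local Notation recip_sum := (recip_sum R).
Local Notation mangoldt := (mangoldt R).
Local Notation mangoldt_sum := (mangoldt_sum R).

(** Partial summation with weight [phi] = 1/ln^2. The partial sums of mangoldt(k)/k - [beta k] are
    at most 8 + 8 by Mertens, and [beta k] times [phi k] is dominated by a telescoping difference of
    1/ln. As ln P >= 1/2, the total is 16 * 2 + 1 over ln P. *)
Lemma sum_prime_inv_ln_le P N : (2 <= P)%N ->
  \sum_(P.+1 <= p < N.+1 | prime p) (p%:R * ln p%:R)^-1 <= 33 / ln P%:R :> R.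
Proof.
move=> P2; have lP := ln_nat_ge_half R P2.
have [NP|PN] := leqP N P; first by rewrite big_geq // divr_ge0 //; lra.
pose phi k : R := (ln k%:R ^+ 2)^-1.
pose beta k : R := ln k%:R - ln k.-1%:R.
have lk k : (P < k)%N -> ln P%:R <= ln k%:R :> R.
  by move=> Pk; apply: ler_ln_nat; lia.
have h1 : \sum_(P.+1 <= p < N.+1 | prime p) (p%:R * ln p%:R)^-1 <=
    \sum_(P.+1 <= k < N.+1) mangoldt k / k%:R * phi k.
  rewrite big_mkcond [leLHS]big_nat [leRHS]big_nat; apply: ler_sum => k /andP[Pk _].
  have := lk k Pk => lPk; have k0 : 0 < k%:R :> R by rewrite ltr0n; lia.
  case: ifP => pk; last by rewrite mulr_ge0 ?invr_ge0 ?sqr_ge0 // divr_ge0 ?mangoldt_ge0.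
  rewrite mangoldt_prime // /phi le_eqVlt; apply/orP; left; apply/eqP; field.
  by rewrite !gt_eqF //; lra.
have h2 : `|\sum_(P.+1 <= k < N.+1) (mangoldt k / k%:R - beta k) * phi k| <= 16 * phi P.+1.
  apply: abel_le; first by lia.
  - by rewrite invr_ge0 sqr_ge0.
  - move=> k /andP[Pk _]; have := lk k Pk => lPk.
    rewrite /phi lef_pV2 ?posrE ?exprn_gt0 //; [|have := lk k.+1 (ltnW Pk : (P < k.+1)%N)|]; try lra.
    have := lk k.+1 (ltnW Pk : (P < k.+1)%N) => lPk1.
    by rewrite ler_sqr ?nnegrE ?ln_nat_ge0 //; apply: ler_ln_nat; lia.
  move=> n nN; have [nP|Pn] := leqP n P.+1; first by rewrite big_geq // normr0.
  case: n nN Pn => // n nN Pn.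
  rewrite sumrB; have -> : \sum_(P.+1 <= k < n.+1) beta k = ln n%:R - ln P%:R.
    rewrite big_add1 /=; rewrite telescope_sumr //; lia.
  have -> : \sum_(P.+1 <= k < n.+1) mangoldt k / k%:R = mangoldt_sum n - mangoldt_sum P.
    rewrite /mangoldt_sum [X in _ = X - _](big_cat_nat (n := P.+1)) //=; last by lia.
    by rewrite addrAC subrr add0r.
  have n0 : (0 < n)%N by lia.
  have P0 : (0 < P)%N by lia.
  have := mertens R n0; have := mertens R P0; rewrite !ler_norml => /andP[l1 u1] /andP[l2 u2].
  apply/andP; split; lra.
have h3 : \sum_(P.+1 <= k < N.+1) beta k * phi k <= (ln P%:R)^-1.
  apply: (@le_trans _ _ (\sum_(P.+1 <= k < N.+1) ((ln k.-1%:R)^-1 - (ln k%:R)^-1))).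
    rewrite [leLHS]big_nat [leRHS]big_nat; apply: ler_sum => k /andP[Pk _].
    have lPk := lk k Pk; have lPk1 : ln P%:R <= ln k.-1%:R :> R by apply: ler_ln_nat; lia.
    have lkk : ln k.-1%:R <= ln k%:R :> R by apply: ler_ln_nat; lia.
    rewrite /beta /phi; move: lPk lPk1 lkk; set a := ln k.-1%:R; set b := ln k%:R => h4 h5 h6.
    have -> : a^-1 - b^-1 = (b - a) * (a * b)^-1 by field; rewrite !gt_eqF //; lra.
    rewrite ler_wpM2l ?subr_ge0 // lef_pV2 ?posrE ?exprn_gt0 ?mulr_gt0 //; try lra.
    by rewrite expr2 ler_wpM2r //; lra.
  rewrite big_add1 /= -[leLHS]opprK -sumrN.
  rewrite (eq_bigr (fun k => (ln k.+1%:R)^-1 - (ln k%:R)^-1)); last by move=> k _; rewrite opprB.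
  rewrite telescope_sumr; last by lia.
  by rewrite opprB lerBlDr lerDl invr_ge0 ln_nat_ge0.
apply: (le_trans h1).
have -> : \sum_(P.+1 <= k < N.+1) mangoldt k / k%:R * phi k =
    \sum_(P.+1 <= k < N.+1) (mangoldt k / k%:R - beta k) * phi k +
    \sum_(P.+1 <= k < N.+1) beta k * phi k.
  by rewrite -big_split /=; apply: eq_bigr => k _; rewrite -mulrDl subrK.
have h4 : phi P.+1 <= 2 * (ln P%:R)^-1.
  have := lk P.+1 (ltnSn P); rewrite /phi; set a := ln P%:R in lP *; set b := ln _ => ab.
  rewrite -[2]invrK -invfM lef_pV2 ?posrE ?exprn_gt0 ?mulr_gt0 //; try lra.
  nra.
move: h2; rewrite ler_norml => /andP[_ h2].
have -> : 33 / ln P%:R = 16 * (2 * (ln P%:R)^-1) + (ln P%:R)^-1 :> R by ring.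
by apply: lerD => //; apply: (le_trans h2); rewrite ler_wpM2l.
Qed.

Lemma sum_prime_ln_le w : (0 < w)%N ->
  \sum_(1 <= p < w.+1 | prime p) ln p%:R / p%:R <= ln w%:R + 8 :> R.
Proof.
move=> w0; have := mertens R w0; rewrite ler_norml => /andP[_ h].
apply: (@le_trans _ _ (mangoldt_sum w)); last by lra.
rewrite big_mkcond; apply: ler_sum => k _; case: ifP => pk.
  by rewrite mangoldt_prime.
by rewrite divr_ge0 ?mangoldt_ge0.
Qed.

Lemma sum_prime_mid_le P w N (h : nat -> R) (K : R) : (2 <= P)%N -> (2 <= N)%N -> (0 < w)%N ->
  0 <= K ->
  (forall p, prime p -> (P < p <= w)%N -> `|h p| <= 2 * ln p%:R / ln N%:R + K / ln p%:R) ->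
  \sum_(P.+1 <= p < w.+1 | prime p) `|h p| / p%:R <=
  2 * (ln w%:R + 8) / ln N%:R + K * (33 / ln P%:R).
Proof.
move=> P2 N2 w0 K0 hh; have lN := ln_nat_ge_half R N2.
have lP := ln_nat_ge_half R P2.
have [wP|Pw] := leqP w P.
  rewrite big_geq // addr_ge0 ?mulr_ge0 ?invr_ge0 ?addr_ge0 ?ln_nat_ge0 //.
apply: (@le_trans _ _ (2 / ln N%:R * (\sum_(P.+1 <= p < w.+1 | prime p) ln p%:R / p%:R) +
    K * \sum_(P.+1 <= p < w.+1 | prime p) (p%:R * ln p%:R)^-1)).
  rewrite !mulr_sumr -big_split /= [leLHS]big_nat_cond [leRHS]big_nat_cond.
  apply: ler_sum => p /andP[/andP[Pp pw] pp].
  have := hh p pp; rewrite Pp -ltnS pw => /(_ isT) h1.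
  apply: (@le_trans _ _ ((2 * ln p%:R / ln N%:R + K / ln p%:R) / p%:R)).
    by rewrite ler_wpM2r ?invr_ge0.
  by rewrite invfM le_eqVlt; apply/orP; left; apply/eqP; ring.
apply: lerD; last by rewrite ler_wpM2l // sum_prime_inv_ln_le.
have -> : 2 * (ln w%:R + 8) / ln N%:R = 2 / ln N%:R * (ln w%:R + 8) :> R by ring.
rewrite ler_wpM2l ?divr_ge0 //; first by lra.
apply: le_trans (sum_prime_ln_le w0).
rewrite [leRHS](big_cat_nat (n := P.+1)) //=; last by rewrite ltnS ltnW.
rewrite lerDr.
by apply: sumr_ge0 => p _; rewrite divr_ge0 ?ln_nat_ge0.
Qed.

Lemma sum_prime_rough_le w N :
  \sum_(w.+1 <= p < N.+1 | prime p) p%:R^-1 <= recip_sum (rough w) N.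
Proof.
have [Nw|wN] := leqP N w; first by rewrite big_geq ?recip_sum_ge0.
rewrite /recip_sum [leRHS](big_cat_nat (n := w.+1)) //=; last by rewrite ltnS ltnW.
apply: ler_wpDl; first by apply: sumr_ge0 => n _; rewrite divr_ge0.
rewrite big_mkcond [leLHS]big_nat [leRHS]big_nat; apply: ler_sum => p /andP[wp _].
by case: ifP => pp; rewrite ?divr_ge0 // rough_prime // wp div1r.
Qed.

Lemma recip_sum_rough_pow w N k : (2 <= w)%N -> (0 < N)%N -> (N <= w ^ k)%N ->
  recip_sum (rough w) N <= k%:R + 3.
Proof.
move=> w2 N0 Nk; have lw := ln_nat_ge_half R w2.
apply: le_trans (recip_sum_rough_le R w2 N0) _; rewrite ler_pdivrMr; last lra.
have h : ln N%:R <= k%:R * ln w%:R :> R.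
  rewrite mulr_natl -lnXn ?ltr0n -?natrX; last by lia.
  exact: ler_ln_nat.
lra.
Qed.

(** Between N/Y and N the sum of ln p / p is bounded by Mertens, while ln p is at least ln (N %/ Y),
    which tends to infinity. *)
Lemma sum_prime_tail_le Y (e : R) : (0 < Y)%N -> 0 < e -> exists N0, forall N, (N0 <= N)%N ->
  \sum_((N %/ Y).+1 <= p < N.+1 | prime p) p%:R^-1 <= e.
Proof.
move=> Y0 e0; pose D : R := ln (2 * Y)%:R + 16.
have lY := ln_nat_ge0 R (2 * Y).
have [v0 v02 hv0] := exists_ln_gt (D / e).
exists (v0 * Y)%N => N NY; pose v := (N %/ Y)%N.
have v0v : (v0 <= v)%N by rewrite leq_divRL.
have vN : (v <= N)%N by rewrite leq_div.
have v_0 : (0 < v)%N by lia.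
have N0 : (0 < N)%N by lia.
have lv : D / e < ln v%:R by apply: lt_le_trans hv0 _; apply: ler_ln_nat => //; lia.
have lv0 : 0 < ln v%:R :> R by apply: le_lt_trans lv; rewrite divr_ge0 ?(ltW e0) // /D; lra.
have NvY : ln N%:R <= ln v%:R + ln (2 * Y)%:R :> R.
  rewrite -lnM ?posrE ?ltr0n ?muln_gt0 //= -natrM; apply: ler_ln_nat => //.
  by have := ltn_ceil N Y0; rewrite -/v; nia.
rewrite -/v.
have : ln v%:R * \sum_(v.+1 <= p < N.+1 | prime p) p%:R^-1 <= D.
  apply: (@le_trans _ _ (mangoldt_sum N - mangoldt_sum v)).
    have -> : mangoldt_sum N = mangoldt_sum v + \sum_(v.+1 <= n < N.+1) mangoldt n / n%:R.
      by rewrite /mangoldt_sum (big_cat_nat (n := v.+1)).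
    rewrite addrAC subrr add0r.
    rewrite mulr_sumr big_mkcond [leLHS]big_nat [leRHS]big_nat; apply: ler_sum => p /andP[vp _].
    case: ifP => pp; last by rewrite divr_ge0 ?mangoldt_ge0.
    by rewrite mangoldt_prime // ler_wpM2r ?invr_ge0 // ler_ln_nat // ltnW.
  have := mertens R N0; have := mertens R v_0; rewrite !ler_norml /D => /andP[l1 u1] /andP[l2 u2].
  lra.
move: (\sum_(_ <= _ < _ | _) _) => s hs.
rewrite -(ler_pM2l lv0); apply: (le_trans hs).
by move: lv; rewrite ltr_pdivrMr // => /ltW.
Qed.

(** The range splits at p = N/Y: below it [h] is at most e' and the 1/p have total at most k + 3;
    above it the bound 1 and [sum_prime_tail_le] apply. *)
Lemma sum_prime_high_le k Y (e : R) : (0 < Y)%N -> 0 < e -> exists N0, forall N w (h : nat -> R) (e' : R),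
  (N0 <= N)%N -> (2 <= w)%N -> (N <= w ^ k)%N -> 0 <= e' -> (forall p, `|h p| <= 1) ->
  (forall p, prime p -> (w < p <= N)%N -> (Y <= N %/ p)%N -> `|h p| <= e') ->
  \sum_(w.+1 <= p < N.+1 | prime p) `|h p| / p%:R <= e' * (k%:R + 3) + e.
Proof.
move=> Y0 e0; have [N0 hN0] := sum_prime_tail_le Y0 e0.
exists (maxn 1 N0) => N w h e'; rewrite geq_max => /andP[N_0 NN0] w2 Nk e'0 h1 hh.
apply: (@le_trans _ _ (e' * (\sum_(w.+1 <= p < N.+1 | prime p) p%:R^-1) +
    \sum_((N %/ Y).+1 <= p < N.+1 | prime p) p%:R^-1)); last first.
  apply: lerD; last exact: hN0.
  by rewrite ler_wpM2l // (le_trans (sum_prime_rough_le _ _)) // recip_sum_rough_pow.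
have -> : \sum_((N %/ Y).+1 <= p < N.+1 | prime p) p%:R^-1 =
    \sum_(1 <= p < N.+1 | prime p && (N %/ Y < p)%N) p%:R^-1 :> R.
  rewrite [RHS](big_cat_nat (n := (N %/ Y).+1)) //=; last by rewrite ltnS leq_div.
  rewrite [X in _ = X + _]big_nat_cond [X in _ = X + _]big_pred0 ?add0r; last first.
    by move=> p; case: (ltnP (N %/ Y) p) => h'; rewrite ?andbF //; lia.
  rewrite big_nat_cond [RHS]big_nat_cond; apply: eq_bigl => p.
  by case: (ltnP (N %/ Y) p) => h'; rewrite ?andbT.
apply: (@le_trans _ _ (e' * (\sum_(w.+1 <= p < N.+1 | prime p) p%:R^-1) +
    \sum_(w.+1 <= p < N.+1 | prime p && (N %/ Y < p)%N) p%:R^-1)); last first.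
  rewrite lerD2l; have [Nw|wN] := leqP N w.
    by rewrite big_geq // sumr_ge0 // => p _; rewrite invr_ge0.
  rewrite [leRHS](big_cat_nat (n := w.+1)) //=; last by rewrite ltnS ltnW.
  by apply: ler_wpDl => //; apply: sumr_ge0 => p _; rewrite invr_ge0.
rewrite mulr_sumr [X in _ + X]big_mkcondr -big_split /= [leLHS]big_nat_cond [leRHS]big_nat_cond.
apply: ler_sum => p /andP[/andP[wp pN] pp].
have p0 : (0 < p)%N by lia.
have ip : 0 <= p%:R^-1 :> R by rewrite invr_ge0.
case: ltnP => pY.
  apply: ler_wpDl; first by rewrite mulr_ge0.
  by rewrite ler_piMl.
rewrite addr0 ler_wpM2r //; apply: hh => //; first by rewrite wp -ltnS.
by move: pY; rewrite !leq_divRL // mulnC.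
Qed.

End Prime_sums.

(** * Buchstab's identity and estimates for each range of primes *)

Section Buchstab.
Variable R : realType.
Local Notation mu := (mu R).
Local Notation mu_on := (mu_on R).
Local Notation mu_sum := (mu_sum R).
Local Notation recip_sum := (recip_sum R).

Lemma leq_expn_base (x y k : nat) : (x <= y)%N -> (x ^ k <= y ^ k)%N.
Proof. by move=> xy; elim: k => // k IH; rewrite !expnS leq_mul. Qed.

Definition selected_sum (sel : nat -> nat) (T : pred nat) N : R :=
  \sum_(1 <= n < N.+1 | T (sel n)) mu n / n%:R.

(** [sel] stands for P^- or P^+, and [pi p] for the primes allowed in the cofactor k of n = p k. If
    p still divides k, both sides contribute nothing: mu(n) = 0, and k is not a [pi p]-number. *)
Lemma buchstab (sel : nat -> nat) (pi : nat -> nat_pred) (T : pred nat) N :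
  ~~ prime (sel 1%N) ->
  (forall n, (1 < n)%N -> prime (sel n) && (sel n %| n)%N) ->
  (forall p k, prime p -> (0 < k)%N -> (pi p).-nat k ->
     ~~ (p %| k)%N && (sel (p * k)%N == p)) ->
  (forall n, (1 < n)%N -> ~~ (sel n %| n %/ sel n)%N -> (pi (sel n)).-nat (n %/ sel n)%N) ->
  (forall p, T p -> prime p) ->
  selected_sum sel T N =
  - \sum_(1 <= p < N.+1 | T p) mu_sum (pi p) (N %/ p) / p%:R.
Proof.
move=> sel1 seln pik pin Tp; rewrite -sumrN big_mkcond.
pose F d k : R := if T d then - (mu_on (pi d) k / (d * k)%:R) else 0.
rewrite (eq_bigr (fun p => \sum_(1 <= k < (N %/ p).+1) F p k)) => [|p _]; last first.
  rewrite /F; case: ifP => _; last by rewrite big1.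
  rewrite /mu_sum -mulNr -sumrN mulr_suml; apply: eq_bigr => k _.
  by rewrite natrM invfM; ring.
rewrite -dirichlet_sum /selected_sum big_mkcond; apply: eq_big_nat => n /andP[n0 _].
have [->|n1] := eqVneq n 1%N.
  rewrite [RHS]big_mkcond big_nat1 dvdnn /F.
  by case: ifP => [/Tp|_]; [rewrite (negPf sel1) | case: ifP => // /Tp].
have {}n1 : (1 < n)%N by lia.
have /andP[pp pn] := seln n n1; set p := sel n in pp pn *; have p0 := prime_gt0 pp.
have k0 := dvdn_div_gt0 n0 pn.
have pr : (1 <= p < n.+1)%N by rewrite p0 ltnS (dvdn_leq n0 pn).
rewrite (sum_single (P := fun d => (d %| n)%N) (F := fun d => F d (n %/ d)%N) pr pn); last first.
  move=> d /andP[d0 _] dn dp; rewrite /F; case: ifP => // /Tp pd; rewrite /mu_on.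
  case: ifPn => [dk|_]; last by rewrite mul0r oppr0.
  have /andP[_] := pik d _ pd (dvdn_div_gt0 n0 dn) dk.
  by rewrite mulnC divnK // -/p eq_sym (negPf dp).
rewrite /F [(p * _)%N]mulnC divnK //; case: ifP => // _.
have En : n = (p * (n %/ p))%N by rewrite mulnC divnK.
have [pk|pk] := boolP (p %| n %/ p)%N.
  rewrite [mu n](mu_square _ pp); last by rewrite En expnS expn1 dvdn_pmul2l.
  rewrite /mu_on; case: ifPn => [h|_]; last by rewrite mul0r oppr0.
  by have /andP[] := pik p _ pp k0 h; rewrite pk.
by rewrite /mu_on (pin n n1 pk) [in LHS]En mu_prime_mul // -En mulNr.
Qed.

Lemma buchstab_max (T : pred nat) N : (forall p, T p -> prime p) ->
  selected_sum max_pdiv T N =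
  - \sum_(1 <= p < N.+1 | T p) mu_sum (smooth p.-1) (N %/ p) / p%:R.
Proof.
apply: buchstab => // [n n1|p k pp k0 /smoothP -/(_ k0) hk|n n1 hn].
- by rewrite max_pdiv_prime // max_pdiv_dvd.
- have p0 := prime_gt0 pp; have pk1 : (1 < p * k)%N.
    by apply: leq_trans (prime_gt1 pp) _; rewrite leq_pmulr.
  apply/andP; split; first by apply/negP => /(hk _ pp); lia.
  rewrite eqn_leq; apply/andP; split.
    have := max_pdiv_dvd (p * k); rewrite Euclid_dvdM ?max_pdiv_prime //.
    move=> /orP[/dvdn_leq -/(_ p0)//|/hk]; rewrite max_pdiv_prime // => /(_ isT); lia.
  by apply: max_pdiv_max; rewrite mem_primes pp muln_gt0 p0 k0 dvdn_mulr.
set p := max_pdiv n in hn *; have n0 : (0 < n)%N by lia.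
have k0 : (0 < n %/ p)%N by rewrite dvdn_div_gt0 // max_pdiv_dvd.
apply/smoothP => // q pq qn; have qp : q != p by apply: contraNneq hn => qE; rewrite -{1}qE.
have : (q <= p)%N.
  by apply: max_pdiv_max; rewrite mem_primes pq n0 (dvdn_trans qn) // dvdn_div // max_pdiv_dvd.
by have := max_pdiv_gt0 n; rewrite -/p; lia.
Qed.

Lemma buchstab_min (T : pred nat) N : (forall p, T p -> prime p) ->
  selected_sum pdiv T N =
  - \sum_(1 <= p < N.+1 | T p) mu_sum (rough p) (N %/ p) / p%:R.
Proof.
apply: buchstab => // [n n1|p k pp k0 /roughP -/(_ k0) hk|n n1 hn].
- by rewrite pdiv_prime // pdiv_dvd.
- have p0 := prime_gt0 pp; have pk1 : (1 < p * k)%N.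
    by apply: leq_trans (prime_gt1 pp) _; rewrite leq_pmulr.
  apply/andP; split; first by apply/negP => /(hk _ pp); rewrite ltnn.
  rewrite eqn_leq; apply/andP; split.
    by apply: pdiv_min_dvd; rewrite ?prime_gt1 // dvdn_mulr.
  have := pdiv_dvd (p * k); rewrite Euclid_dvdM ?pdiv_prime //.
  move=> /orP[|/hk]; last by rewrite pdiv_prime // => /(_ isT)/ltnW.
  by rewrite dvdn_prime2 ?pdiv_prime // => /eqP ->.
set p := pdiv n in hn *; have n0 : (0 < n)%N by lia.
have k0 : (0 < n %/ p)%N by rewrite dvdn_div_gt0 // pdiv_dvd.
apply/roughP => // q pq qn; have qp : q != p by apply: contraNneq hn => qE; rewrite -{1}qE.
rewrite ltn_neqAle eq_sym qp; apply: pdiv_min_dvd; first exact: prime_gt1.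
by rewrite (dvdn_trans qn) // dvdn_div // pdiv_dvd.
Qed.

(** A squarefree z-smooth number is a product of distinct primes up to z. Hence the smooth sum is
    constant beyond z!, an explicit threshold. *)
Lemma smooth_squarefree_le z n : (0 < n)%N -> (smooth z).-nat n -> mu n != 0 -> (n <= z`!)%N.
Proof.
elim: z n => [|z IH] n n0 /smoothP -/(_ n0) hn mn.
  have [n1|n1] := leqP n 1; first by [].
  by have := hn _ (pdiv_prime n1) (pdiv_dvd n); rewrite leqNgt pdiv_gt0.
rewrite factS; have [/andP[pz zn]|no] := boolP (prime z.+1 && (z.+1 %| n)%N); last first.
  apply: leq_trans (IH n n0 _ mn) (leq_pmull _ _) => //.
  apply/smoothP => // p pp pn; have := hn p pp pn; rewrite leq_eqVlt ltnS.
  by case/orP=> // /eqP pE; move: no; rewrite -pE pp pn.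
have k0 := dvdn_div_gt0 n0 zn; have En : n = (z.+1 * (n %/ z.+1))%N by rewrite mulnC divnK.
have zk : ~~ (z.+1 %| n %/ z.+1)%N.
  apply/negP => zk; move: mn; rewrite (mu_square _ pz) ?eqxx //.
  by rewrite En expnS expn1 dvdn_pmul2l.
rewrite En leq_mul2l /=; apply: IH => //.
  apply/smoothP => // p pp pk.
  have := hn p pp (dvdn_trans pk (dvdn_div zn)); rewrite leq_eqVlt ltnS.
  by case/orP=> // /eqP pE; move: zk; rewrite -{1}pE pk.
by move: mn; rewrite {1}En mu_prime_mul // oppr_eq0.
Qed.

Lemma smooth_mu_sum_const z N : (z`! <= N)%N -> mu_sum (smooth z) N = mu_sum (smooth z) z`!.
Proof.
move=> zN; rewrite /mu_sum (big_cat_nat (n := (z`!).+1)) //=.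
rewrite [X in _ + X]big_nat [X in _ + X]big1 ?addr0 // => n /andP[zn _].
rewrite /mu_on; case: ifP => nz; last by rewrite mul0r.
have [->|mn] := eqVneq (mu n) 0; first by rewrite mul0r.
have n0 : (0 < n)%N by lia.
by have := smooth_squarefree_le n0 nz mn; rewrite leqNgt zn.
Qed.

Lemma sum_selected_split z N :
  mu_sum (smooth z) N = mu_sum predT N -
    selected_sum max_pdiv (fun p => prime p && (z < p)%N) N.
Proof.
rewrite /selected_sum big_mkcond -sumrB; apply: eq_big_nat => n /andP[n0 _].
rewrite {2}/mu_on pnat_predT //.
have [->|n1] := eqVneq n 1%N; first by rewrite subr0.
have {}n1 : (1 < n)%N by lia.
rewrite max_pdiv_prime //= /mu_on; case: (ltnP z (max_pdiv n)) => h.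
  case: ifP => nz; last by rewrite mul0r subrr.
  have /smoothP -/(_ n0 _ (max_pdiv_prime n1) (max_pdiv_dvd n)) := nz.
  by rewrite leqNgt h.
rewrite subr0; case: ifPn => // /negP[]; apply/smoothP => // p pp pn.
by apply: leq_trans h; apply: max_pdiv_max; rewrite mem_primes pp n0.
Qed.

(** Induction on k through Buchstab's identity: the z-smooth sum at y is m(y) plus the (p-1)-smooth
    sums at y/p, over p, for z < p <= y. If y <= z^(k+1) then y/p <= (p-1)^k, so the induction
    hypothesis covers all y/p >= Y. *)
Lemma smooth_mu_sum_uniform k (e : R) : 0 < e -> exists Y, (0 < Y)%N /\
  forall y z, (Y <= y)%N -> (2 <= z)%N -> (y <= z ^ k)%N -> `|mu_sum (smooth z) y| <= e.
Proof.
elim: k e => [|k IH] e e0.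
  by exists 2%N; split=> // y z y2 _; rewrite expn0; lia.
(* Chosen so that e' times (k + 1) + 3, the bound on the sum of 1/p over z < p <= y, is e/4. *)
pose e' : R := e / (4 * (k%:R + 4)).
have k0 : 0 <= k%:R :> R by [].
have e'0 : 0 < e' by rewrite divr_gt0 //; lra.
have [Y [Y0 hY]] := IH e' e'0.
have e4 : 0 < e / 4 by lra.
have [N1 hN1] := mu_sum_cvg0 e4.
have [N2 hN2] := sum_prime_high_le k.+1 Y0 e4.
exists (maxn 1 (maxn N1 N2)); split; first by lia.
move=> y z; rewrite !geq_max => /and3P[y0 yN1 yN2] z2 yz.
rewrite sum_selected_split buchstab_max; last by move=> p /andP[].
rewrite opprK.
have := hN1 y yN1 => my.
pose h p := mu_sum (smooth p.-1) (y %/ p).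
have hh p : prime p -> (z < p <= y)%N -> (Y <= y %/ p)%N -> `|h p| <= e'.
  move=> pp /andP[zp py] Yp; apply: hY => //; first by lia.
  have p0 := prime_gt0 pp; rewrite -ltnS ltn_divLR //.
  apply: leq_ltn_trans yz _; rewrite expnS mulnC.
  have zk : (z ^ k <= p.-1 ^ k)%N by apply: leq_expn_base; rewrite -ltnS prednK.
  apply: (@leq_ltn_trans (p.-1 ^ k * z)); first by rewrite leq_mul2r zk orbT.
  apply: leq_ltn_trans (leq_mul (leqnn _) (ltnW zp)) _.
  by rewrite ltn_mul2r p0 /=; apply: ltnSn.
have := hN2 y z h e' yN2 z2 yz (ltW e'0) (fun p => norm_mu_sum_le1 R _ _) hh.
rewrite -(big_nat_widenl _ _ _ prime) //.
set S1 := \sum_(_ <= _ < _ | _) _; set S2 := \sum_(_ <= _ < _ | _) _ => hS.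
have S12 : `|S2| <= S1.
  apply: le_trans (ler_norm_sum _ _ _) _; apply: ler_sum => p pp.
  by rewrite normrM [X in _ * X <= _]ger0_norm ?invr_ge0.
have E : e' * (k.+1%:R + 3) = e / 4.
  have -> : k.+1%:R + 3 = k%:R + 4 :> R by rewrite -natr1; ring.
  by rewrite /e'; field; lra.
rewrite E in hS; have := ler_normD (mu_sum predT y) S2; lra.
Qed.

Lemma exists_root U N : (0 < U)%N -> (0 < N)%N -> exists2 w, (w ^ U <= N)%N & (N < w.+1 ^ U)%N.
Proof.
move=> U0 N0; have ex : exists w, (w ^ U <= N)%N by exists 1%N; rewrite exp1n.
have bd w : (w ^ U <= N)%N -> (w <= N)%N.
  by apply: leq_trans; case: w => // w; rewrite -{1}(expn1 w.+1) leq_pexp2l.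
case: (ex_maxnP ex bd) => w wN wmax; exists w => //.
by rewrite ltnNge; apply/negP => /wmax; rewrite ltnn.
Qed.

Lemma sum_prime_mid_root_le (U P N w : nat) (h : nat -> R) (K : R) :
  (4 <= U)%N -> (2 <= P)%N -> (2 <= w)%N -> (w ^ U <= N)%N -> 0 <= K ->
  (forall p, prime p -> (P < p <= w)%N -> `|h p| <= 2 * ln p%:R / ln N%:R + K / ln p%:R) ->
  \sum_(P.+1 <= p < w.+1 | prime p) `|h p| / p%:R <=
  2 / U%:R + 16 / ln N%:R + K * (33 / ln P%:R).
Proof.
move=> U4 P2 w2 wN K0 hh.
have N2 : (2 <= N)%N.
  have w0 := ltnW w2; apply: leq_trans w2 (leq_trans _ wN); rewrite -{1}(expn1 w).
  by apply: leq_pexp2l => //; apply: (@leq_trans 4).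
have lN := ln_nat_ge_half R N2.
have UR : 0 < U%:R :> R by rewrite ltr0n; lia.
have h1 : U%:R * ln w%:R <= ln N%:R :> R.
  rewrite mulr_natl -lnXn ?ltr0n -?natrX; last by lia.
  by apply: ler_ln_nat => //; rewrite expn_gt0; lia.
apply: le_trans (sum_prime_mid_le P2 N2 (ltnW w2) K0 hh) _.
rewrite lerD2r; have -> : 2 * (ln w%:R + 8) / ln N%:R = 2 * ln w%:R / ln N%:R + 16 / ln N%:R :> R.
  by field; lra.
rewrite lerD2r ler_pdivrMr; last lra.
by rewrite mulrAC ler_pdivlMr //; lra.
Qed.

Lemma divn_sqr_ge p N : (2 <= p)%N -> (p ^ 4 <= N)%N -> (p <= N %/ p)%N /\ (N <= (N %/ p) ^ 2)%N.
Proof.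
move=> p2 pN; have p0 : (0 < p)%N by lia.
have h : (p ^ 3 <= N %/ p)%N by rewrite leq_divRL // -expnSr.
have h' : (2 * p <= p ^ 3)%N by rewrite expnS mulnC leq_mul2l -[2%N]/(2 * 1)%N; nia.
split; first by lia.
have := ltn_ceil N p0; move: h h'; set s := (N %/ p)%N => h h' hN.
by apply: leq_trans (ltnW hN) _; nia.
Qed.

(** [mu_sum_decay] at N/p, in terms of p and N: p^4 <= N gives ln N <= 2 ln (N/p), and p <= z^2
    gives ln p <= 2 ln z. The cases are z = p for rough and z = p - 1 for smooth sums. *)
Lemma mu_sum_decay_div (h : R) p z N : (2 <= z)%N -> (z <= p)%N -> (p <= z ^ 2)%N -> (p ^ 4 <= N)%N ->
  h * ln (N %/ p)%:R <= ln z%:R + 13 + 19 * recip_sum (rough z) (N %/ p) ->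
  h <= 2 * ln p%:R / ln N%:R + 200 / ln p%:R.
Proof.
move=> z2 zp pz pN hh; have p2 := leq_trans z2 zp.
have [pN1 pN2] := divn_sqr_ge p2 pN.
have zN : (2 <= z <= N %/ p)%N by rewrite z2 (leq_trans zp).
have N2 : (2 <= N)%N by apply: leq_trans p2 (leq_trans pN1 (leq_div _ _)).
apply: le_trans (mu_sum_decay zN hh) _.
have lz := ln_nat_ge_half R z2; have lN := ln_nat_ge_half R N2.
have lp := ln_nat_ge_half R p2.
have ls := ln_nat_ge_half R (leq_trans p2 pN1).
have lzp : ln z%:R <= ln p%:R :> R by apply: ler_ln_nat => //; lia.
have lpz : ln p%:R <= 2 * ln z%:R :> R.
  rewrite mulr_natl -lnXn ?ltr0n -?natrX; last by lia.
  by apply: ler_ln_nat => //; lia.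
have lNs : ln N%:R <= 2 * ln (N %/ p)%:R :> R.
  rewrite mulr_natl -lnXn ?ltr0n -?natrX; last by lia.
  by apply: ler_ln_nat => //; lia.
move: lz lN lp ls lzp lpz lNs; move: (ln z%:R : R) (ln N%:R : R) (ln p%:R : R) (ln (N %/ p)%:R : R).
move=> a b c d a0 b0 c0 d0 ac ca bd; apply: lerD.
  rewrite ler_pdivrMr; last lra.
  rewrite mulrAC ler_pdivlMr; last lra.
  have : a * b <= c * (2 * d) by apply: ler_pM => //; lra.
  lra.
rewrite ler_pdivrMr; last lra.
rewrite mulrAC ler_pdivlMr; lra.
Qed.

Lemma leq_pow4_root U p w N : (4 <= U)%N -> (0 < w)%N -> (p <= w)%N -> (w ^ U <= N)%N ->
  (p ^ 4 <= N)%N.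
Proof.
move=> U4 w0 pw wN; apply: leq_trans wN; apply: leq_trans (leq_expn_base 4 pw) _.
exact: leq_pexp2l.
Qed.

Lemma rough_mu_sum_mid_le p N : (2 <= p)%N -> (p ^ 4 <= N)%N ->
  `|mu_sum (rough p) (N %/ p)| <= 2 * ln p%:R / ln N%:R + 200 / ln p%:R.
Proof.
move=> p2 pN; have [pN1 _] := divn_sqr_ge p2 pN.
have pz : (p <= p ^ 2)%N by rewrite -{1}(expn1 p) leq_pexp2l // ltnW.
apply: (mu_sum_decay_div p2 (leqnn p) pz pN).
have := rough_mu_sum_log_le R (ltnW p2) (leq_trans (ltnW p2) pN1); lra.
Qed.

Lemma smooth_mu_sum_mid_le p N : (3 <= p)%N -> (p ^ 4 <= N)%N ->
  `|mu_sum (smooth p.-1) (N %/ p)| <= 2 * ln p%:R / ln N%:R + 200 / ln p%:R.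
Proof.
move=> p3 pN; have [pN1 _] := divn_sqr_ge (ltnW p3) pN.
have z2 : (2 <= p.-1)%N by lia.
have pz : (p <= p.-1 ^ 2)%N by rewrite -mulnn; nia.
apply: (mu_sum_decay_div z2 (leq_pred p) pz pN).
have N0 : (0 < N %/ p)%N by apply: leq_trans pN1; apply: ltnW (ltnW p3).
have := smooth_mu_sum_log_le R (ltnW z2) N0.
have := recip_sum_ge0 R (rough p.-1) (N %/ p); lra.
Qed.

End Buchstab.

(** * Convergence of the selected sums *)

Section Largest_prime_factor.
Variable R : realType.
Local Notation mu_sum := (mu_sum R).
Local Notation recip_sum := (recip_sum R).

Lemma exists_inv_le (x e : R) : 0 <= x -> 0 < e -> exists2 U, (0 < U)%N &
  forall V, (U <= V)%N -> x / V%:R <= e.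
Proof.
move=> x0 e0; have [U U0 hU] := exists_nat_gt (x / e).
exists U => // V UV; have V0 : 0 < V%:R :> R by rewrite ltr0n; lia.
rewrite ler_pdivrMr // mulrC -ler_pdivrMr //; apply: le_trans (ltW hU) _.
by rewrite ler_nat.
Qed.

Lemma exists_inv_ln_le (x e : R) : 0 <= x -> 0 < e -> exists2 U, (1 < U)%N &
  forall V, (U <= V)%N -> x / ln V%:R <= e.
Proof.
move=> x0 e0; have [U U1 hU] := exists_ln_gt (x / e).
exists U => // V UV; have lV : ln U%:R <= ln V%:R :> R by apply: ler_ln_nat => //; lia.
have lV0 : 0 < ln V%:R :> R by rewrite ln_gt0 // ltr1n; lia.
by rewrite ler_pdivrMr // mulrC -ler_pdivrMr //; lra.
Qed.

Lemma root_pow_le U N w : (2 <= w)%N -> (N < w.+1 ^ U)%N -> (N <= w ^ (2 * U))%N.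
Proof.
move=> w2 Nw; apply: leq_trans (ltnW Nw) _; rewrite expnM.
have ww : (w.+1 <= w ^ 2)%N by rewrite -mulnn; nia.
exact: leq_expn_base.
Qed.

Lemma root_gt P U N w : (P.+1 ^ U <= N)%N -> (N < w.+1 ^ U)%N -> (P < w)%N.
Proof.
move=> PN Nw; rewrite ltnNge; apply/negP => wP.
have : (w.+1 ^ U <= P.+1 ^ U)%N by apply: leq_expn_base.
by rewrite leqNgt => /negP; apply; apply: leq_ltn_trans PN Nw.
Qed.

Lemma norm_sum_prime_le (T : pred nat) (h : nat -> R) a b : (forall p, T p -> prime p) ->
  `|\sum_(a <= p < b | T p) h p / p%:R| <= \sum_(a <= p < b | prime p) `|h p| / p%:R.
Proof.
move=> Tp; apply: le_trans (ler_norm_sum _ _ _) _.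
rewrite big_mkcond [leRHS]big_mkcond; apply: ler_sum => p _.
have nn : 0 <= `|h p| / p%:R by rewrite divr_ge0.
case: ifP => [/Tp ->|_]; last by case: ifP.
by rewrite normrM [X in _ * X <= _]ger0_norm ?invr_ge0.
Qed.

(** L may depend on e, which makes this a Cauchy condition: the sum stays close to the contribution
    of p <= P, and that is constant for large N. *)
Lemma selected_sum_max_cauchy (T : pred nat) (e : R) : (forall p, T p -> prime p) -> 0 < e ->
  exists L N0, forall N, (N0 <= N)%N -> `|selected_sum R max_pdiv T N - L| <= e.
Proof.
move=> Tp e0; have e8 : 0 < e / 8 by lra.
have [P' P'1 hP'] := @exists_inv_ln_le (200 * 33) (e / 8) ltac:(lra) e8.
pose P := maxn 2 P'; have P2 : (2 <= P)%N by rewrite leq_maxl.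
have hP : 200 * (33 / ln P%:R) <= e / 8 by rewrite mulrA; apply: hP'; rewrite leq_maxr.
have [U' U'0 hU'] := @exists_inv_le 2 (e / 8) ltac:(lra) e8.
pose U := maxn 4 U'; have U4 : (4 <= U)%N by rewrite leq_maxl.
have hU : 2 / U%:R <= e / 8 by apply: hU'; rewrite leq_maxr.
have [N3 N31 hN3] := @exists_inv_ln_le 16 (e / 8) ltac:(lra) e8.
clearbody P U.
pose k := (2 * U)%N; pose e' : R := e / 8 / (k%:R + 3).
have k3 : 0 < k%:R + 3 :> R by have : (0 : R) <= k%:R; [by [] | lra].
have e'0 : 0 < e' by rewrite divr_gt0.
have [Y [Y0 hY]] := smooth_mu_sum_uniform k e'0.
have [N2 hN2] := sum_prime_high_le k Y0 e8.
(* By [smooth_mu_sum_const] the value at (p-1)! is the limit of the (p-1)-smooth sum. *)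
exists (- \sum_(1 <= p < P.+1 | T p) mu_sum (smooth p.-1) (p.-1)`! / p%:R).
exists (maxn N3 (maxn N2 (maxn (P.+1 ^ U) (P * P`!)))) => N.
rewrite !geq_max => /and4P[NN3 NN2 NPU NPP].
have N0 : (0 < N)%N by apply: leq_trans (ltnW N31) NN3.
have [w wN Nw] := @exists_root U N (ltn_trans (isT : (0 < 3)%N) U4) N0.
have Pw := root_gt NPU Nw.
have w2 : (2 <= w)%N := leq_trans P2 (ltnW Pw).
have Nk := root_pow_le w2 Nw; rewrite -/k in Nk.
pose h p := mu_sum (smooth p.-1) (N %/ p).
have wNl : (w <= N)%N.
  apply: leq_trans wN; rewrite -{1}(expn1 w); apply: leq_pexp2l; first exact: ltnW w2.
  by apply: leq_trans U4.
have b1 : (1 <= P.+1)%N by [].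
have b2 : (P.+1 <= w.+1)%N by rewrite ltnS ltnW.
have b3 : (P.+1 <= N.+1)%N by apply: leq_trans b2 _; rewrite ltnS.
have b4 : (w.+1 <= N.+1)%N by rewrite ltnS.
rewrite buchstab_max // -opprD normrN (big_cat_nat b1 b3) /=.
rewrite [X in _ + X + _](big_cat_nat b2 b4) /=.
have -> : \sum_(1 <= p < P.+1 | T p) mu_sum (smooth p.-1) (N %/ p) / p%:R =
    \sum_(1 <= p < P.+1 | T p) mu_sum (smooth p.-1) (p.-1)`! / p%:R.
  rewrite big_nat_cond [RHS]big_nat_cond; apply: eq_bigr => p /andP[/andP[p0 pP] _].
  rewrite ltnS in pP; rewrite smooth_mu_sum_const // leq_divRL //.
  apply: leq_trans NPP; rewrite mulnC; apply: leq_mul => //.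
  by apply: leq_fact; lia.
rewrite [X in `|X|]addrC addKr.
have mid : `|\sum_(P.+1 <= p < w.+1 | T p) h p / p%:R| <= 3 * (e / 8).
  apply: le_trans (norm_sum_prime_le _ _ _ Tp) _.
  apply: (le_trans (sum_prime_mid_root_le (K := 200) U4 P2 w2 wN _ _)) => //; last first.
    by have := hN3 N NN3; lra.
  move=> p pp /andP[Pp pw]; apply: smooth_mu_sum_mid_le; first exact: leq_trans Pp.
  exact: leq_pow4_root U4 (ltnW w2) pw wN.
have high : `|\sum_(w.+1 <= p < N.+1 | T p) h p / p%:R| <= 2 * (e / 8).
  apply: le_trans (norm_sum_prime_le _ _ _ Tp) _.
  apply: (le_trans (hN2 N w h e' NN2 w2 Nk (ltW e'0) (fun p => norm_mu_sum_le1 R _ _) _)).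
    move=> p pp /andP[wp pN] Yp; have wp1 : (w <= p.-1)%N by rewrite -ltnS (ltn_predK wp).
    apply: hY => //; first exact: leq_trans w2 wp1.
    by apply: leq_trans (leq_div _ _) (leq_trans Nk _); apply: leq_expn_base.
  by rewrite /e' divfK ?gt_eqF //; lra.
rewrite -/h; apply: le_trans (ler_normD _ _) _.
move: mid high; rewrite /h; lra.
Qed.

End Largest_prime_factor.

(** * The smallest prime factor: comparison with all primes through the density *)

Section Smallest_prime_factor.
Variable R : realType.
Local Notation mu_sum := (mu_sum R).
Local Notation recip_sum := (recip_sum R).
Local Notation H := (harmonic_sum R).

Definition prime_count (T : pred nat) n : R := \sum_(1 <= p < n.+1 | T p) 1.

Lemma prime_count_ge0 T n : 0 <= prime_count T n.
Proof. by apply: sumr_ge0. Qed.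

(** For a prime p write ln n = ln p + (ln n - ln p). The first parts sum to at most psi(n) <= 8 n;
    the second, extended to all k <= n, costs at most n by Stirling. *)
Lemma prime_count_le n : (0 < n)%N -> prime_count prime n * ln n%:R <= 9 * n%:R.
Proof.
move=> n0; have := psi_le R n; have /andP[l _] := ln_sum_bounds R n0 => hpsi.
have h1 : prime_count prime n * ln n%:R <= psi R n + \sum_(1 <= k < n.+1) (ln n%:R - ln k%:R).
  rewrite /psi -big_split /= /prime_count mulr_suml big_mkcond.
  rewrite [leLHS]big_nat [leRHS]big_nat; apply: ler_sum => p /andP[p0 pn].
  have lpn : ln p%:R <= ln n%:R :> R by apply: ler_ln_nat.
  case: ifP => pp; first by rewrite mangoldt_prime //; lra.
  by have := mangoldt_ge0 R p; lra.
move: h1; rewrite sumrB sumr_const_nat subn1 -/(ln_sum R n) /= -[ln n%:R *+ n]mulr_natl; lra.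
Qed.

(** The discrepancy of the counts up to n is at most a small multiple of pi(n), hence of n / ln w.
    Partial summation against 1/n multiplies this by about ln t <= k ln w, so the factor ln w
    cancels. *)
Lemma density_sum_le (T : pred nat) (d : R) :
  (forall e, 0 < e -> exists n1, forall n, (n1 <= n)%N ->
     `|prime_count T n - d * prime_count prime n| <= e * prime_count prime n) ->
  forall k (e : R), 0 < e -> exists w0, forall N w t, (w0 <= w)%N -> (2 <= w)%N ->
    (N <= w ^ k)%N -> (t <= N)%N ->
    `|\sum_(w.+1 <= n < t.+1) ((T n)%:R - d * (prime n)%:R) * n%:R^-1| <= e.
Proof.
move=> dens k e e0; pose ep : R := e / (18 * (k%:R + 4)).
have k0 : (0 : R) <= k%:R by [].
have ep0 : 0 < ep by rewrite divr_gt0 //; lra.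
have [n1 hn1] := dens ep ep0.
exists n1 => N w t wn1 w2 Nw tN.
have [tw|wt] := leqP t w; first by rewrite big_geq // normr0 ltW.
pose c n : R := (T n)%:R - d * (prime n)%:R.
have cE n : \sum_(1 <= j < n.+1) c j = prime_count T n - d * prime_count prime n.
  rewrite /prime_count sumrB -mulr_sumr; congr (_ - _ * _).
    by rewrite [RHS]big_mkcond; apply: eq_bigr => j _; case: (T j).
  by rewrite [RHS]big_mkcond; apply: eq_bigr => j _; case: (prime j).
have lw := ln_nat_ge_half R w2; have lw0 : 0 < ln w%:R :> R by lra.
have cB n : (w <= n)%N -> `|\sum_(w.+1 <= j < n.+1) c j| <= 18 * ep / ln w%:R * n%:R.
  move=> wn; have n0 : (0 < n)%N by lia.
  have E : \sum_(w.+1 <= j < n.+1) c j =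
      \sum_(1 <= j < n.+1) c j - \sum_(1 <= j < w.+1) c j.
    by rewrite [X in _ = X - _](big_cat_nat (n := w.+1)) //= addrAC subrr add0r.
  rewrite E !cE; apply: le_trans (ler_normB _ _) _.
  have h1 := hn1 n (leq_trans wn1 wn); have h2 := hn1 w wn1.
  have mono : prime_count prime w <= prime_count prime n.
    rewrite /prime_count [leRHS](big_cat_nat (n := w.+1)) //= lerDl.
    by apply: sumr_ge0.
  have lwn : ln w%:R <= ln n%:R :> R by apply: ler_ln_nat => //; lia.
  have h3 : prime_count prime n * ln w%:R <= 9 * n%:R.
    by apply: le_trans (prime_count_le n0); rewrite ler_wpM2l // prime_count_ge0.
  have h4 : ep * prime_count prime w <= ep * prime_count prime n by rewrite ler_wpM2l // ltW.
  have h5 : ep * (prime_count prime n * ln w%:R) <= ep * (9 * n%:R) by rewrite ler_wpM2l // ltW.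
  rewrite mulrAC ler_pdivlMr //.
  have h6 : `|prime_count T n - d * prime_count prime n| +
    `|prime_count T w - d * prime_count prime w| <= 2 * (ep * prime_count prime n) by lra.
  have h7 := ler_wpM2r (ltW lw0) h6; lra.
have C0 : 0 <= 18 * ep / ln w%:R by rewrite divr_ge0 ?mulr_ge0 // ltW.
have t0 : (0 < t)%N by lia.
have N0 : (0 < N)%N by lia.
rewrite abel_summation; last exact: ltnW.
apply: le_trans (ler_normD _ _) _.
set C := 18 * ep / ln w%:R in cB C0 *.
apply: (@le_trans _ _ (C * (1 + H t))).
  rewrite mulrDr; apply: lerD.
    rewrite normrM; apply: le_trans (ler_wpM2r _ (cB t (ltnW wt))) _ => //.
    rewrite -mulrA ler_wpM2l // ger0_norm ?invr_ge0 //.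
    by rewrite ler_pdivrMr ?ltr0n // mul1r ler_nat.
  apply: le_trans (ler_norm_sum _ _ _) _.
  rewrite /harmonic_sum mulr_sumr [leRHS](big_cat_nat (n := w.+1)) //=; last by rewrite ltnS ltnW.
  apply: ler_wpDl; first by apply: sumr_ge0 => n _; rewrite mulr_ge0 ?invr_ge0.
  rewrite [leLHS]big_nat [leRHS]big_nat; apply: ler_sum => n /andP[wn nt].
  have nR : 0 < n%:R :> R by rewrite ltr0n; lia.
  rewrite normrM; apply: le_trans (ler_wpM2r _ (cB n (ltnW wn))) _ => //.
  rewrite -mulrA ler_wpM2l //.
  have -> : n%:R^-1 - n.+1%:R^-1 = n%:R^-1 * n.+1%:R^-1 :> R.
    have -> : n.+1%:R = n%:R + 1 :> R by rewrite natr1.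
    by field; lra.
  rewrite ger0_norm ?mulr_ge0 ?invr_ge0 // mulrA divff ?gt_eqF // mul1r.
  by rewrite lef_pV2 ?posrE // ler_nat.
have hH := harmonic_sum_le R t0.
have ltN : ln t%:R <= ln N%:R :> R by apply: ler_ln_nat.
have lNw : ln N%:R <= k%:R * ln w%:R :> R.
  rewrite mulr_natl -lnXn ?ltr0n -?natrX; last by lia.
  exact: ler_ln_nat.
apply: (@le_trans _ _ (C * (ln w%:R * (k%:R + 4)))).
  by rewrite ler_wpM2l //; lra.
have -> : C * (ln w%:R * (k%:R + 4)) = e.
  by rewrite /C /ep; field; lra.
by [].
Qed.

Lemma recip_sum_le pi u v : (v <= u)%N -> recip_sum pi v <= recip_sum pi u.
Proof.
move=> vu; rewrite /recip_sum [leRHS](big_cat_nat (n := v.+1)) //= lerDl.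
by apply: sumr_ge0 => n _; rewrite divr_ge0.
Qed.

Lemma rough_sub w n j : (w <= n)%N -> (rough n).-nat j -> (rough w).-nat j.
Proof.
move=> wn /[dup] /andP[j0 _] /roughP -/(_ j0) h; apply/roughP => // p pp pj.
exact: leq_ltn_trans wn (h p pp pj).
Qed.

(** From n to n + 1 the argument drops from u to v, removing only w-rough terms, and the sieving set
    changes only if n + 1 is prime, by [rough_mu_sumS]. *)
Lemma rough_mu_sum_variation w n u v : (w <= n)%N -> (v <= u)%N ->
  `|mu_sum (rough n) u - mu_sum (rough n.+1) v| <=
  recip_sum (rough w) u - recip_sum (rough w) v + (prime n.+1)%:R / n.+1%:R.
Proof.
move=> wn vu.
have h1 : `|mu_sum (rough n) u - mu_sum (rough n) v| <=
    recip_sum (rough w) u - recip_sum (rough w) v.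
  rewrite /mu_sum /recip_sum [X in `|X - _|](big_cat_nat (n := v.+1)) //= addrAC subrr add0r.
  rewrite [X in _ <= X - _](big_cat_nat (n := v.+1)) //= addrAC subrr add0r.
  apply: le_trans (ler_norm_sum _ _ _) _; apply: ler_sum => j _.
  rewrite normrM [X in _ * X <= _]ger0_norm ?invr_ge0 // ler_wpM2r ?invr_ge0 //.
  rewrite /mu_on; case: ifP => [/(rough_sub wn) ->|_]; first exact: norm_mu_le1.
  by rewrite normr0.
have h2 : `|mu_sum (rough n) v - mu_sum (rough n.+1) v| <= (prime n.+1)%:R / n.+1%:R.
  rewrite rough_mu_sumS addrAC subrr add0r normrN normrM ger0_norm ?divr_ge0 //.
  by rewrite ler_piMr ?divr_ge0 // norm_mu_sum_le1.
have := ler_normD (mu_sum (rough n) u - mu_sum (rough n) v)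
  (mu_sum (rough n) v - mu_sum (rough n.+1) v).
rewrite addrA subrK; lrai.
Qed.

(** Partial summation against the variation: the changes of argument telescope to one [recip_sum],
    and the primes beyond w sum to another. The extra 1 covers the prime that N + 1 may be. *)
Lemma rough_abel_le (c : nat -> R) (eta : R) w N : (w <= N)%N -> 0 <= eta ->
  (forall t, (t <= N)%N -> `|\sum_(w.+1 <= n < t.+1) c n| <= eta) ->
  `|\sum_(w.+1 <= n < N.+1) c n * mu_sum (rough n) (N %/ n)| <=
  eta * (2 * recip_sum (rough w) N + 1).
Proof.
move=> wN eta0 hc; rewrite abel_summation //.
have -> : mu_sum (rough N.+1) (N %/ N.+1) = 0 by rewrite divn_small // /mu_sum big_geq.
rewrite mulr0 add0r; apply: le_trans (ler_norm_sum _ _ _) _.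
set r := recip_sum (rough w).
have r0 n : 0 <= r n := recip_sum_ge0 R _ _.
apply: (@le_trans _ _ (\sum_(w.+1 <= n < N.+1)
    eta * (r (N %/ n)%N - r (N %/ n.+1)%N + (prime n.+1)%:R / n.+1%:R))).
  rewrite [leLHS]big_nat [leRHS]big_nat; apply: ler_sum => n /andP[wn nN].
  rewrite normrM; apply: ler_pM => //; first exact: hc.
  apply: rough_mu_sum_variation; first exact: ltnW.
  by apply: leq_div2l; lia.
rewrite -mulr_sumr ler_wpM2l // big_split /=.
have tel : \sum_(w.+1 <= n < N.+1) (r (N %/ n)%N - r (N %/ n.+1)%N) <= r N.
  rewrite -[leLHS]opprK -sumrN (eq_bigr (fun n => r (N %/ n.+1)%N - r (N %/ n)%N)); last first.
    by move=> n _; rewrite opprB.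
  rewrite telescope_sumr // divn_small //.
  have : r (N %/ w.+1)%N <= r N by apply: recip_sum_le; apply: leq_div.
  by have := r0 0%N; lra.
have pr : \sum_(w.+1 <= n < N.+1) (prime n.+1)%:R / n.+1%:R <= r N + 1 :> R.
  have -> : \sum_(w.+1 <= n < N.+1) (prime n.+1)%:R / n.+1%:R =
      \sum_(w.+2 <= n < N.+2) (prime n)%:R / n%:R :> R.
    by rewrite [RHS]big_add1.
  apply: (@le_trans _ _ (\sum_(w.+1 <= n < N.+2) (prime n)%:R / n%:R)).
    rewrite [leRHS](big_cat_nat (n := w.+2)) //= ?ltnS //.
    by rewrite lerDr; apply: sumr_ge0 => n _; rewrite divr_ge0.
  rewrite big_nat_recr //=; apply: lerD.
    apply: le_trans (sum_prime_rough_le R w N); rewrite [leRHS]big_mkcond.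
    by apply: ler_sum => n _; case: (prime n); rewrite ?mul1r ?mul0r.
  rewrite ler_pdivrMr ?ltr0n // mul1r.
  by case: (prime _) => //=; rewrite ler1n.
lra.
Qed.

Lemma rough_mu_sum_low P (e : R) : 0 < e -> exists N0, forall N, (N0 <= N)%N ->
  \sum_(1 <= p < P.+1) `|mu_sum (rough p) (N %/ p)| / p%:R <= e.
Proof.
elim: P e => [|P IH] e e0.
  by exists 0%N => N _; rewrite big_geq // ltW.
have e2 : 0 < e / 2 by lra.
have [N1 hN1] := IH (e / 2) e2; have [N2 hN2] := rough_mu_sum_cvg0 P.+1 e2.
exists (maxn N1 (N2 * P.+1)) => N; rewrite geq_max => /andP[NN1 NN2].
rewrite big_nat_recr //=; have h1 := hN1 N NN1.
have h2 := hN2 (N %/ P.+1)%N ltac:(by rewrite leq_divRL).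
have h3 : `|mu_sum (rough P.+1) (N %/ P.+1)| / P.+1%:R <= e / 2.
  by apply: le_trans h2; rewrite ler_pdivrMr ?ltr0n // ler_peMr // ler1n.
by apply: le_trans (lerD h1 h3) _; lra.
Qed.

Lemma selected_sum_min_prime N : (0 < N)%N ->
  selected_sum R pdiv prime N = mu_sum predT N - 1.
Proof.
move=> N0; rewrite /selected_sum /mu_sum big_ltn_cond // [in RHS]big_ltn //=.
rewrite /mu_on pnat_predT // mu1 divr1 [X in _ = X - 1]addrC addrK.
rewrite big_nat_cond [RHS]big_nat; apply: eq_big => [n|n /andP[/andP[n1 _] _]].
  by case: (ltnP 1 n) => //= n1; rewrite pdiv_prime ?andbT.
by rewrite pnat_predT // ltnW.
Qed.

(** For all primes the selected sum is m(N) - 1, by [selected_sum_min_prime]. Subtracting d times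
    this replaces the indicator of T by [c], which has mean zero relative to the primes. *)
Lemma selected_sum_min_cvg (T : pred nat) (d : R) : (forall p, T p -> prime p) ->
  (forall e, 0 < e -> exists n1, forall n, (n1 <= n)%N ->
     `|prime_count T n - d * prime_count prime n| <= e * prime_count prime n) ->
  forall e : R, 0 < e -> exists N0, forall N, (N0 <= N)%N ->
    `|selected_sum R pdiv T N - - d| <= e.
Proof.
move=> Tp dens e e0; pose D : R := 1 + `|d|.
have D1 : 1 <= D by rewrite /D lerDl.
(* D bounds |c p|. The low, middle and high ranges and d m(N) then cost 1, 3, 1 and 1 eighths of
   e. *)
pose e1 := e / (8 * D); have e10 : 0 < e1 by rewrite divr_gt0 //; lra.
have De1 : D * e1 = e / 8 by rewrite /e1; field; lra.
have [P' P'1 hP'] := @exists_inv_ln_le R (200 * 33) e1 ltac:(lra) e10.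
pose P := maxn 2 P'; have P2 : (2 <= P)%N by rewrite leq_maxl.
have hP : 200 * (33 / ln P%:R) <= e1 by rewrite mulrA; apply: hP'; rewrite leq_maxr.
have [U' U'0 hU'] := @exists_inv_le R 2 e1 ltac:(lra) e10.
pose U := maxn 4 U'; have U4 : (4 <= U)%N by rewrite leq_maxl.
have hU : 2 / U%:R <= e1 by apply: hU'; rewrite leq_maxr.
have [N3 N31 hN3] := @exists_inv_ln_le R 16 e1 ltac:(lra) e10.
clearbody P U.
pose k := (2 * U)%N; pose e2 : R := e1 / (2 * (k%:R + 3) + 1).
have k0 : (0 : R) <= k%:R by [].
have e20 : 0 < e2 by rewrite divr_gt0 //; lra.
have [w0 hw0] := density_sum_le dens k e20.
have [N1 hN1] := rough_mu_sum_low P e10.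
have [N2 hN2] := mu_sum_cvg0 e10.
exists (maxn N1 (maxn N2 (maxn N3 ((maxn P w0).+1 ^ U)))) => N.
rewrite !geq_max => /and4P[NN1 NN2 NN3 NPU].
have N0 : (0 < N)%N by apply: leq_trans (ltnW N31) NN3.
have [w wN Nw] := @exists_root U N (ltn_trans (isT : (0 < 3)%N) U4) N0.
have := root_gt NPU Nw; rewrite gtn_max => /andP[Pw w0w].
have w2 : (2 <= w)%N := leq_trans P2 (ltnW Pw).
have Nk := root_pow_le w2 Nw; rewrite -/k in Nk.
pose h p := mu_sum (rough p) (N %/ p).
pose c p : R := (T p)%:R - d * (prime p)%:R.
have wNl : (w <= N)%N.
  apply: leq_trans wN; rewrite -{1}(expn1 w); apply: leq_pexp2l; first exact: ltnW w2.
  by apply: leq_trans U4.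
have b1 : (1 <= P.+1)%N by [].
have b2 : (P.+1 <= w.+1)%N by rewrite ltnS ltnW.
have b3 : (P.+1 <= N.+1)%N by apply: leq_trans b2 _; rewrite ltnS.
have b4 : (w.+1 <= N.+1)%N by rewrite ltnS.
have E : selected_sum R pdiv T N - - d =
    d * mu_sum predT N - \sum_(1 <= p < N.+1) c p * (h p / p%:R).
  have := selected_sum_min_prime N0; rewrite !buchstab_min // => E1.
  have -> : \sum_(1 <= p < N.+1) c p * (h p / p%:R) =
      \sum_(1 <= p < N.+1 | T p) h p / p%:R - d * \sum_(1 <= p < N.+1 | prime p) h p / p%:R.
    rewrite mulr_sumr [X in _ = X - _]big_mkcond [X in _ = _ - X]big_mkcond -sumrB /=.
    apply: eq_bigr => p _; rewrite /c.
    have := Tp p; case: (T p) => [/(_ isT) ->|_]; rewrite ?mulr1 ?mulr1n ?mulr0n.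
      by ring.
    by case: (prime p); rewrite ?mulr1n ?mulr0n; ring.
  have -> : mu_sum predT N = 1 - \sum_(1 <= p < N.+1 | prime p) h p / p%:R.
    by move: E1; rewrite /h; lra.
  by rewrite /h; ring.
have cD p : `|c p| <= D * (prime p)%:R.
  rewrite /c /D; have := Tp p; case: (T p) => [/(_ isT) ->|_].
    by have := ler_normB 1 d; rewrite normr1 !mulr1.
  rewrite sub0r normrN; case: (prime p); rewrite ?mulr1 ?mulr0 ?normr0 //.
  by rewrite lerDr.
have csum a b : `|\sum_(a <= p < b) c p * (h p / p%:R)| <=
    D * \sum_(a <= p < b | prime p) `|h p| / p%:R.
  apply: le_trans (ler_norm_sum _ _ _) _; rewrite mulr_sumr [leRHS]big_mkcond.
  apply: ler_sum => p _; rewrite normrM normrM [X in _ * (_ * X) <= _]ger0_norm ?invr_ge0 //.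
  apply: le_trans (ler_wpM2r _ (cD p)) _; first by rewrite divr_ge0.
  by case: (prime p); rewrite ?mulr1 ?mulr0 ?mul0r.
have low : `|\sum_(1 <= p < P.+1) c p * (h p / p%:R)| <= e / 8.
  apply: (le_trans (csum _ _)); rewrite -De1 ler_wpM2l //; first by lra.
  apply: le_trans (hN1 N NN1); rewrite big_mkcond; apply: ler_sum => p _.
  by case: ifP => // _; rewrite divr_ge0.
have mid : `|\sum_(P.+1 <= p < w.+1) c p * (h p / p%:R)| <= 3 * (e / 8).
  apply: (le_trans (csum _ _)); rewrite -De1 mulrCA ler_wpM2l //; first by lra.
  apply: (le_trans (sum_prime_mid_root_le (K := 200) U4 P2 w2 wN _ _)) => //; last first.
    by have := hN3 N NN3; lra.
  move=> p pp /andP[Pp pw]; apply: rough_mu_sum_mid_le; first exact: leq_trans (ltnW Pp).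
  exact: leq_pow4_root U4 (ltnW w2) pw wN.
have high : `|\sum_(w.+1 <= p < N.+1) c p * (h p / p%:R)| <= e / 8.
  rewrite (eq_bigr (fun p => c p * p%:R^-1 * h p)); last by move=> p _; ring.
  apply: (le_trans (rough_abel_le wNl (ltW e20) _)).
    move=> t tN; exact: (hw0 N w t (ltnW w0w) w2 Nk tN).
  apply: (@le_trans _ _ (e2 * (2 * (k%:R + 3) + 1))).
    by rewrite ler_wpM2l ?(ltW e20) // lerD2r ler_wpM2l // recip_sum_rough_pow.
  rewrite /e2 divfK; last by rewrite gt_eqF //; lra.
  by rewrite -De1; apply: ler_peMl => //; apply: ltW.
have hm : `|d * mu_sum predT N| <= e / 8.
  rewrite -De1 normrM; apply: ler_pM => //; last exact: hN2.
  by rewrite /D lerDr.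
move: low mid high; rewrite E (big_cat_nat b1 b3) /= [X in _ - (_ + X)](big_cat_nat b2 b4) /=.
set S1 := \sum_(1 <= _ < _) _; set S2 := \sum_(P.+1 <= _ < _) _.
set S3 := \sum_(w.+1 <= _ < _) _ => s1 s2 s3.
have := ler_normB (d * mu_sum predT N) (S1 + (S2 + S3)).
have := ler_normD S1 (S2 + S3); have := ler_normD S2 S3; lra.
Qed.

End Smallest_prime_factor.

(** * Partial summation with logarithmic weights, and passage to real x *)

Section Log_weights.
Variable R : realType.

(** Writing the partial sums as L + [delta n], the contributions of L cancel because the increments
    of ln telescope. The increments weighted by [delta] give the constant C up to N0 and at most e/5
    times ln (N + 1) beyond it. *)
Lemma log_weighted_sum_small (a : nat -> R) :
  (forall e, 0 < e -> exists L N0, forall N, (N0 <= N)%N ->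
     `|\sum_(1 <= n < N.+1) a n - L| <= e) ->
  forall e : R, 0 < e -> exists N0, forall N, (N0 <= N)%N ->
    `|\sum_(1 <= n < N.+1) a n * ln n%:R| <= e * ln N%:R.
Proof.
move=> cauchy e e0; have e5 : 0 < e / 5 by lra.
have [L [N0 hN0]] := cauchy (e / 5) e5.
pose delta n := \sum_(1 <= k < n.+1) a k - L.
pose C : R := \sum_(1 <= n < N0.+1) `|delta n| * (ln n.+1%:R - ln n%:R).
have dl n : (0 < n)%N -> 0 <= ln n.+1%:R - ln n%:R :> R.
  by move=> n0; rewrite subr_ge0 ler_ln_nat.
have C0 : 0 <= C.
  rewrite /C big_nat; apply: sumr_ge0 => n /andP[n0 _].
  by rewrite mulr_ge0 // dl.
have [N1 N11 hN1] := exists_ln_gt (1 + C / (e / 5)).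
exists (maxn N1 N0) => N; rewrite geq_max => /andP[NN1 NN0].
have N_0 : (0 < N)%N by lia.
have lN : 1 + C / (e / 5) < ln N%:R by apply: lt_le_trans hN1 _; apply: ler_ln_nat => //; lia.
have lN1 : 1 < ln N%:R :> R by apply: le_lt_trans lN; rewrite lerDl divr_ge0 // ltW.
have hC : C <= e / 5 * ln N%:R by rewrite -ler_pdivrMl // mulrC; lra.
have tel M : \sum_(1 <= n < M.+1) (ln n.+1%:R - ln n%:R) = ln M.+1%:R :> R.
  by rewrite telescope_sumr // ln1 subr0.
have lN2 : ln N.+1%:R <= 2 * ln N%:R :> R.
  have := lnS_le R N_0; have : N%:R^-1 <= 1 :> R by rewrite invf_le1 ?ltr0n // ler1n.
  by lrai.
have E : \sum_(1 <= n < N.+1) a n * ln n%:R =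
    delta N * ln N.+1%:R - \sum_(1 <= n < N.+1) delta n * (ln n.+1%:R - ln n%:R).
  rewrite abel_summation //.
  have -> : \sum_(1 <= n < N.+1) delta n * (ln n.+1%:R - ln n%:R) =
      - \sum_(1 <= n < N.+1) (\sum_(1 <= k < n.+1) a k) * (ln n%:R - ln n.+1%:R) - L * ln N.+1%:R.
    rewrite -tel mulr_sumr -sumrN -sumrB; apply: eq_bigr => n _; rewrite /delta; ring.
  by rewrite /delta; ring.
rewrite E; apply: le_trans (ler_normB _ _) _.
have h1 : `|delta N * ln N.+1%:R| <= e / 5 * (2 * ln N%:R).
  rewrite normrM (ger0_norm (ln_nat_ge0 R _)); apply: ler_pM => //; first exact: ln_nat_ge0.
  exact: hN0.
have h2 : `|\sum_(1 <= n < N.+1) delta n * (ln n.+1%:R - ln n%:R)| <=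
    C + e / 5 * (2 * ln N%:R).
  apply: le_trans (ler_norm_sum _ _ _) _.
  rewrite (big_cat_nat (n := N0.+1)) //=.
  apply: lerD.
    rewrite /C [leLHS]big_nat [leRHS]big_nat; apply: ler_sum => n /andP[n0 _].
    by rewrite normrM (ger0_norm (dl n n0)).
  apply: (@le_trans _ _ (e / 5 * \sum_(1 <= n < N.+1) (ln n.+1%:R - ln n%:R))); last first.
    by rewrite tel ler_wpM2l // ltW.
  rewrite mulr_sumr [leRHS](big_cat_nat (n := N0.+1)) //=.
  apply: ler_wpDl.
    by rewrite big_nat; apply: sumr_ge0 => n /andP[n0 _]; rewrite mulr_ge0 ?dl // ltW.
  rewrite [leLHS]big_nat [leRHS]big_nat; apply: ler_sum => n /andP[Nn _].
  have n0 : (0 < n)%N := leq_ltn_trans (leq0n _) Nn.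
  by rewrite normrM (ger0_norm (dl n n0)) ler_wpM2r ?dl //; apply: hN0; apply: ltnW.
lra.
Qed.

Lemma moebius_log_sum_cvg0 (f : nat -> nat) (S : set nat) :
  (forall e : R, 0 < e -> exists L N0, forall N, (N0 <= N)%N ->
     `|selected_sum R f (fun n => n \in S) N - L| <= e) ->
  (ln x)^-1 * moebius_log_sum f S x @[x --> +oo%R] --> (0 : R).
Proof.
move=> cauchy; apply/cvgrPdist_le => e e0.
pose a n : R := if f n \in S then mu R n / n%:R else 0.
have ha e' : 0 < e' -> exists L N0, forall N, (N0 <= N)%N ->
    `|\sum_(1 <= n < N.+1) a n - L| <= e'.
  move=> e'0; have [L [N0 hN0]] := cauchy e' e'0; exists L, N0 => N /hN0.
  by rewrite /selected_sum big_mkcond.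
have [N0 hN0] := log_weighted_sum_small ha e0.
near=> x.
have x1 : 1 < x by near: x; apply: nbhs_pinfty_gt; rewrite num_real.
have xN0 : N0%:R < x by near: x; apply: nbhs_pinfty_gt; rewrite num_real.
have lx : 0 < ln x by rewrite ln_gt0.
have NN0 : (N0 <= Num.truncn x)%N by rewrite truncn_ge_nat ?(ltW xN0) //; lra.
have N1 : (1 <= Num.truncn x)%N by rewrite truncn_ge_nat ?(ltW x1) //; lra.
have h := hN0 _ NN0.
have -> : moebius_log_sum f S x = \sum_(1 <= n < (Num.truncn x).+1) a n * ln n%:R.
  rewrite /moebius_log_sum big_mkcond; apply: eq_bigr => n _; rewrite /a /mu.
  by case: ifP => _; rewrite ?mul0r // mulrAC.
rewrite sub0r normrN normrM ger0_norm ?invr_ge0 ?(ltW lx) // ler_pdivrMl //.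
apply: (le_trans h); rewrite mulrC ler_wpM2r ?(ltW e0) //.
have x0 : 0 < x by lra.
by rewrite ler_ln ?posrE ?ltr0n // truncn_le // ltW.
Unshelve. all: by end_near.
Qed.

Lemma natural_density_prime_count (S : set nat) :
  S `<=` [set p | prime p] -> has_natural_density R S ->
  exists d : R, forall e, 0 < e -> exists n1, forall n, (n1 <= n)%N ->
    `|prime_count R (fun p => p \in S) n - d * prime_count R prime n| <=
    e * prime_count R prime n.
Proof.
move=> SP [d hd]; exists d => e e0.
have /cvgrPdist_le /(_ e e0) [M [_ hM]] := hd.
have [n1 n10 hn1] := exists_nat_gt M.
(* From 2 on there is a prime up to n, so the denominator of the density quotient can be cleared. *)
exists (maxn 2 n1) => n; rewrite geq_max => /andP[n2 nn1].
have Mn : M < n%:R by apply: lt_le_trans hn1 _; rewrite ler_nat.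
have := hM n%:R Mn; rewrite /count_upto natrK !natr_sum.
rewrite [X in _ / X](eq_bigl prime) => [|p]; last by apply/idP/idP => [/set_mem|/mem_set].
rewrite -/(prime_count R prime n) -/(prime_count R (fun p => p \in S) n).
have c0 : 0 < prime_count R prime n.
  rewrite /prime_count (big_cat_nat (n := 3)) //= big_mkcond.
  rewrite big_ltn // big_ltn // big_geq //= add0r addr0.
  by rewrite ltr_wpDr // sumr_ge0.
move=> h; rewrite -ler_pdivrMr // -[X in _ / X](ger0_norm (ltW c0)) -normf_div.
by rewrite mulrBl mulfK ?gt_eqF // distrC.
Qed.

End Log_weights.

Unset Implicit Arguments.
Set Strict Implicit.

Theorem theorem1 (R : realType) (S : set nat)
    (S_primes : S `<=` [set p | prime p])
    (S_density : has_natural_density R S) :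
  ((ln x)^-1 * moebius_log_sum pdiv S x @[x --> +oo%R] --> (0 : R)) /\
  ((ln x)^-1 * moebius_log_sum max_pdiv S x @[x --> +oo%R] --> (0 : R)).
Proof.
have Sp p : p \in S -> prime p by move=> /set_mem /S_primes.
split; apply: moebius_log_sum_cvg0 => e e0.
  have [d hd] := natural_density_prime_count S_primes S_density.
  by exists (- d); apply: selected_sum_min_cvg.
exact: selected_sum_max_cauchy.
Qed.
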